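(* There exist two positive constants $a_1$ and $a_2$ such that, for every surface $\Sigma$ with Euler characteristic $c\leq -2$, \[ a_1\frac{\sqrt{-c}}{\log(-c)} \leq \vec{\chi}(\Sigma) \leq a_2\frac{\sqrt{-c}}{\log(-c)}. \]
   Context: All surfaces are closed (and connected): each is homeomorphic either to $\mathbb{S}_k$ (the sphere with $k$ handles, Euler characteristic $2-2k$) or to $\mathbb{N}_k$ (the sphere with $k$ cross-caps, Euler characteristic $2-k$). A $k$-dicolouring of a digraph is a partition of its vertex set into $k$ subsets each inducing an acyclic subdigraph (no directed cycle); the dichromatic number $\vec{\chi}(D)$ is the least $k$ such that $D$ has a $k$-dicolouring. An oriented graph is a digraph obtained from a finite simple graph (its underlying graph) by replacing each edge by exactly one of the two possible arcs; it is embeddable on a surface if its underlying graph is. The dichromatic number $\vec{\chi}(\Sigma)$ of a surface $\Sigma$ is the least integer $k$ such that every oriented graph embeddable on $\Sigma$ is $k$-dicolourable. *)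

(* Defs.v *)
From Stdlib Require Import Relation_Operators.
From HB Require Import structures.
From mathcomp Require Import all_boot all_order all_algebra generic_quotient.
From mathcomp Require Import all_classical all_reals all_analysis.
Import Order.TTheory GRing.Theory Num.Theory.
Import numFieldNormedType.Exports.

Set Implicit Arguments.
Unset Strict Implicit.
Unset Printing Implicit Defensive.

Local Open Scope classical_set_scope.
Local Open Scope ring_scope.

Definition homeomorphic (X Y : topologicalType) : Prop :=
  exists (f : X -> Y) (g : Y -> X),
    [/\ continuous f, continuous g, cancel f g & cancel g f].

Section GeneratedQuotient.
Variables (X : topologicalType) (r : X -> X -> Prop).

Definition generated_rel (x y : X) : bool := `[< clos_refl_sym_trans X r x y >].

Fact generated_rel_refl : reflexive generated_rel.
Proof. by move=> x; apply/asboolP; exact: rst_refl. Qed.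

Fact generated_rel_sym : symmetric generated_rel.
Proof. by move=> x y; apply/asboolP/asboolP; exact: rst_sym. Qed.

Fact generated_rel_trans : transitive generated_rel.
Proof.
move=> y x z /asboolP xy /asboolP yz; apply/asboolP; exact: rst_trans xy yz.
Qed.

Definition generated_equiv : equiv_rel X :=
  EquivRel generated_rel generated_rel_refl generated_rel_sym
    generated_rel_trans.

(* [X] modulo the equivalence relation generated by [r]. *)
Definition glued_space : topologicalType :=
  quotient_topology {eq_quot generated_equiv}%qT.

End GeneratedQuotient.

Section Surfaces.
Variable R : realType.

(* The sphere is the one-point compactification of the plane [R * R].  The
   norm of [R * R] is the sup norm, so the "discs" below are squares of side 2;
   they are pairwise disjoint. *)
Definition hole_center (j : nat) : R * R := (4 * j%:R, 0).

(* The sphere minus the interiors of [m] disjoint closed discs. *)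
Definition holed_sphere (m : nat) : set (one_point_compactification (R * R)) :=
  [set p | forall (z : R * R) (j : nat),
     p = Some z -> (j < m)%N -> 1 <= `|z - hole_center j|].

(* The i-th handle identifies the boundaries of the holes of indices 2i and
   2i+1 by the reflection exchanging them; a translation would reverse the
   orientation and produce a non-orientable surface instead. *)
Definition handle_gluing (k : nat) (p q : holed_sphere k.*2) : Prop :=
  exists (i : nat) (v : R * R),
    [/\ (i < k)%N, `|v| = 1,
        set_val p = Some (hole_center i.*2 + v)
      & set_val q = Some (hole_center i.*2.+1 + (- v.1, v.2))].

(* The i-th cross-cap identifies the antipodal boundary points of hole i. *)
Definition crosscap_gluing (k : nat) (p q : holed_sphere k) : Prop :=
  exists (i : nat) (v : R * R),
    [/\ (i < k)%N, `|v| = 1,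
        set_val p = Some (hole_center i + v)
      & set_val q = Some (hole_center i - v)].

Definition sphere_with_handles (k : nat) : topologicalType :=
  glued_space (@handle_gluing k).

Definition sphere_with_crosscaps (k : nat) : topologicalType :=
  glued_space (@crosscap_gluing k).

Definition surface_of_euler_char (S : topologicalType) (c : int) : Prop :=
  (exists k : nat,
     homeomorphic S (sphere_with_handles k) /\ c = 2 - 2 * k%:Z)
  \/ (exists k : nat,
     [/\ (0 < k)%N, homeomorphic S (sphere_with_crosscaps k) & c = 2 - k%:Z]).

(* The simple graph [e] drawn on [S] without crossings: vertices are distinct
   points, the edge xy is a simple arc [arc x y] parametrized from x to y by
   [0, 1] (and [arc y x] is the same arc reversed), and the interior of an edge
   contains no vertex and no point of another edge. *)
Definition embeddable (S : topologicalType) (V : finType) (e : rel V) : Prop :=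
  exists (pt : V -> S) (arc : V -> V -> R -> S),
    [/\ injective pt,
        forall x y, e x y ->
          [/\ {within `[0, 1], continuous (arc x y)},
              {in `[0, 1] &, injective (arc x y)},
              arc x y 0 = pt x, arc x y 1 = pt y
            & {in `[0, 1], forall t, arc y x t = arc x y (1 - t)}],
        forall x y z t, e x y -> t \in `]0, 1[ -> arc x y t <> pt z
      & forall x y z w s t, e x y -> e z w ->
          [set x; y]%SET != [set z; w]%SET ->
          s \in `]0, 1[ -> t \in `]0, 1[ -> arc x y s <> arc z w t].

End Surfaces.

Section Digraphs.
Variables (V : finType) (D : rel V).

Definition oriented : Prop := forall x y, ~~ (D x y && D y x).

Definition underlying : rel V := fun x y => D x y || D y x.

Definition acyclic_on (A : {set V}) : Prop :=
  forall p : seq V, p != [::] -> {subset p <= A} -> ~ ucycle D p.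

Definition dicolourable (k : nat) : Prop :=
  exists f : V -> 'I_k, forall i : 'I_k, acyclic_on [set x | f x == i]%SET.

End Digraphs.

Section SurfaceDichromatic.
Variables (R : realType) (S : topologicalType).

Definition surface_dicolourable (k : nat) : Prop :=
  forall (V : finType) (D : rel V),
    oriented D -> embeddable R S (underlying D) -> dicolourable D k.

Definition surface_dichromatic_number (k : nat) : Prop :=
  surface_dicolourable k /\ forall j, surface_dicolourable j -> (k <= j)%N.

End SurfaceDichromatic.

(* Main.v *)
Require Import Defs.
From Stdlib Require Import Relation_Operators.
From mathcomp Require Import all_boot all_order all_algebra generic_quotient.
From mathcomp Require Import all_classical all_reals all_analysis.
From mathcomp Require Import zify lra ring.
Import Order.TTheory GRing.Theory Num.Theory.
Import numFieldNormedType.Exports.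
Set Implicit Arguments.
Unset Strict Implicit.
Unset Printing Implicit Defensive.

(** Write [g = - c].  The surface is the one-point compactification of the plane with
    the rims of [g + 2] square holes glued by reflections: in pairs for handles, each
    hole to itself for cross-caps.

    Upper bound.  As Euler's formula predicts, a graph with [n] vertices drawn on the
    surface has [O(n + g)] edges, and so have its subgraphs ([embeddable_sparse]).
    Faces of a topological drawing are hard to control, so the drawing is made
    combinatorial first.  A large square is divided into a fine mesh, completed to a
    torus grid; glued along the rims of the holes, the grid is a complex whose homology
    over the field with two elements is explicit: up to [2 + O(g)] linear conditions
    and [O(g)] exceptional chains, cycles are boundaries ([grid_homology],
    [glued_homology]).  The first thirds of the edges at a vertex form a star, the
    middle thirds of the edges join the stars, and all these compact connected sets
    are disjoint except for the intended contacts.  When the mesh is fine enough, the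
    cells they touch form connected hulls with the same incidences
    ([curve_system_bound]), so the graph is a minor of the mesh.  For a minor, Euler's
    inequality is linear algebra: lifts of cycles that bound are combinations of
    boundaries of face classes, each of which has at least three edges in a simple
    graph, while an edge has two sides ([minor_edge_bound]).  At most one vertex or
    edge passes through infinity and can be discarded.

    It remains to colour an oriented graph in which every vertex set [W] has degree
    sum at most [C * (#|W| + g)] ([dichromatic_sparse_bound]).  Acyclic sets are
    extracted one after the other.  An oriented version of a theorem of Erdos and
    Szemeredi ([ranked_sparse]) exploits sparsity: among [N] uncoloured vertices with
    [sqrt g <= N <= g] there is an acyclic set of size about
    [ln g * (N / sqrt g) ^ (3/2)], so that [O(sqrt g / ln g)] rounds bring [N] down to
    [sqrt g].  From there, sets of logarithmic size suffice.  More than [g] vertices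
    contain a vertex of bounded degree, which is coloured last.

    Lower bound.  The complete graph on [n] vertices, with [n] about [sqrt (g / 2)], can
    be drawn on the surface ([complete_embeddable]): every half-edge is a strand running
    along the row of holes, and every edge owns two consecutive holes, through which
    the strands lying between its two halves pass, leaving room for the two halves to
    be joined.  Some tournament on [n] vertices has no acyclic set larger than
    [O(ln n)], by counting ([tournament_without_large_acyclic]), so it needs
    [n / O(ln n)] colours. *)

(** * Ranked sets and sparse digraphs *)

Section AcyclicSets.
Import mathcomp.boot.fintype mathcomp.boot.finset.
Local Open Scope nat_scope.
Variables (V : finType) (D : rel V).

(** Acyclicity certified by a topological numbering; this form restricts and
    glues along unions more easily than the absence of directed cycles. *)
Definition ranked (A : {set V}) : Prop :=
  exists f : V -> nat, {in A &, forall x y, D x y -> f x < f y}.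

Lemma ranked_acyclic (A : {set V}) : ranked A -> acyclic_on D A.
Proof.
case=> f fD [//|x p] _ pA /andP[cyc _].
have : path (fun a b => f a < f b) x (rcons p x).
  apply: (sub_in_path (P := mem A)) cyc; first by move=> a b aA bA; exact: fD.
  by apply/allP => y; rewrite inE mem_rcons inE orbA orbb => yp; apply: pA; rewrite inE.
have tr : transitive (fun a b : V => f a < f b) by move=> b a c; exact: ltn_trans.
move/(order_path_min tr)/allP/(_ x).
by rewrite mem_rcons mem_head ltnn => /(_ isT).
Qed.

Lemma ranked_sub (A B : {set V}) : B \subset A -> ranked A -> ranked B.
Proof.
by move=> /subsetP BA [f fD]; exists f => x y /BA xA /BA yA; exact: fD.
Qed.

Lemma ranked0 : ranked set0.
Proof. by exists (fun=> 0) => x y; rewrite inE. Qed.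

(** A source added in front of an acyclic set gets rank 0. *)
Lemma ranked_source (A : {set V}) v :
  ~~ D v v -> {in A, forall x, ~~ D x v} -> ranked A -> ranked (v |: A).
Proof.
move=> Dvv Dv [f fD]; exists (fun x => if x == v then 0 else (f x).+1) => x y.
rewrite !inE; case: (eqVneq x v) => [->|xv] /=; case: (eqVneq y v) => [->|yv] //=.
- by rewrite (negbTE Dvv).
- by move=> xA _ Dxv; have := Dv _ xA; rewrite Dxv.
- by move=> xA yA /fD; rewrite ltnS; apply.
Qed.

Lemma ranked_sink (A : {set V}) v :
  ~~ D v v -> {in A, forall x, ~~ D v x} -> ranked A -> ranked (v |: A).
Proof.
move=> Dvv Dv [f fD].
exists (fun x => if x == v then (\max_(y in A) f y).+1 else f x) => x y.
rewrite !inE; case: (eqVneq x v) => [->|xv] /=; case: (eqVneq y v) => [->|yv] //=.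
- by rewrite (negbTE Dvv).
- by move=> _ yA Dxv; have := Dv _ yA; rewrite Dxv.
- by move=> xA _ _; rewrite ltnS; exact: leq_bigmax_cond.
- exact: fD.
Qed.

(** Acyclic sets with no arc between them do not interact, so each keeps its own
    ranks. *)
Lemma ranked_union (A B : {set V}) :
  {in A & B, forall x y, ~~ underlying D x y} ->
  ranked A -> ranked B -> ranked (A :|: B).
Proof.
move=> AB [f fD] [h hD].
exists (fun x => if x \in A then f x else h x) => x y; rewrite !inE.
case: (boolP (x \in A)) => xA; case: (boolP (y \in A)) => yA //=.
- by move=> _ _; exact: fD.
- by move=> _ yB Dxy; have := AB _ _ xA yB; rewrite /underlying Dxy.
- by move=> xB _ Dxy; have := AB _ _ yA xB; rewrite /underlying Dxy orbT.
- exact: hD.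
Qed.

Hypothesis oD : oriented D.

Let Dirr v : ~~ D v v.
Proof. by have := oD v v; rewrite andbb. Qed.

(** Every vertex [v] is a source over its non-in-neighbours and a sink over its
    non-out-neighbours; as no vertex is both an in- and an out-neighbour, one
    of these two sets contains half of what remains. *)
Lemma ranked_log t (W : {set V}) :
  2 ^ t <= #|W| -> exists A : {set V}, [/\ A \subset W, ranked A & #|A| = t.+1].
Proof.
elim: t W => [|t IH] W Wt.
  have [v vW] : exists v, v \in W by apply/card_gt0P; exact: leq_trans Wt.
  exists [set v]; rewrite sub1set vW cards1; split=> //.
  by exists (fun=> 0) => x y /set1P-> /set1P->; rewrite (negbTE (Dirr _)).
have [v vW] : exists v, v \in W.
  by apply/card_gt0P; apply: leq_trans Wt; rewrite expn_gt0.
pose O := [set x in W :\ v | ~~ D v x]; pose I := [set x in W :\ v | ~~ D x v].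
have cW : W :\ v \subset O :|: I.
  apply/subsetP => x xW; rewrite !inE; move: xW; rewrite !inE => -> /=.
  by rewrite -negb_and oD.
have {cW} : 2 ^ t.+1 <= (#|O| + #|I|).+1.
  apply: leq_trans Wt _; rewrite (cardsD1 v) vW add1n ltnS.
  by apply: leq_trans (subset_leq_card cW) _; rewrite -[X in _ <= X]cardsUI leq_addr.
rewrite expnS mul2n -addnn => OI.
have [tO|tI] : 2 ^ t <= #|O| \/ 2 ^ t <= #|I|.
  apply/orP; case: (leqP (2 ^ t) #|O|) => //= lO.
  rewrite -(leq_add2l (2 ^ t)); apply: leq_trans OI _.
  by rewrite -addSn leq_add2r.
- have [A [/subsetP AO rA cA]] := IH _ tO.
  have vA : v \notin A by apply/negP => /AO; rewrite !inE eqxx.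
  exists (v |: A); split; last by rewrite cardsU1 vA cA.
    by rewrite subUset sub1set vW; apply/subsetP => x /AO; rewrite !inE => /andP[/andP[]].
  by apply: ranked_sink => // x /AO; rewrite !inE => /andP[].
- have [A [/subsetP AO rA cA]] := IH _ tI.
  have vA : v \notin A by apply/negP => /AO; rewrite !inE eqxx.
  exists (v |: A); split; last by rewrite cardsU1 vA cA.
    by rewrite subUset sub1set vW; apply/subsetP => x /AO; rewrite !inE => /andP[/andP[]].
  by apply: ranked_source => // x /AO; rewrite !inE => /andP[].
Qed.

Let nbr (W : {set V}) x := [set y in W | underlying D x y].

Let underlyingC x y : underlying D x y = underlying D y x.
Proof. by rewrite /underlying orbC. Qed.

(** Both sides count the adjacent pairs between [A] and [W]. *)
Lemma sum_nbr (A W : {set V}) :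
  \sum_(x in A) #|nbr W x| = \sum_(y in W) #|nbr A y|.
Proof.
have H Y x : #|nbr Y x| = \sum_(y in Y) underlying D x y :> nat.
  by rewrite -sum1_card; under eq_bigl do rewrite inE;
     rewrite big_mkcondr; apply: eq_bigr => y _; case: (underlying _ _ _).
under eq_bigr do rewrite H.
under [RHS]eq_bigr do rewrite H.
rewrite exchange_big; apply: eq_bigr => y _; apply: eq_bigr => x _.
by rewrite underlyingC.
Qed.

Lemma card_markov (W : {set V}) (f : V -> nat) t :
  #|[set x in W | t <= f x]| * t <= \sum_(x in W) f x.
Proof.
rewrite -sum1_card big_distrl /= [X in _ <= X](bigID (fun x => t <= f x)) /=.
apply: leq_trans (leq_addr _ _); under eq_bigl do rewrite inE.
by apply: leq_sum => x /andP[_ tf]; rewrite mul1n.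
Qed.

Lemma pigeonhole_fibre (T : finType) (f : V -> T) (W : {set V}) (Y : {set T}) :
  {in W, forall x, f x \in Y} -> W != set0 ->
  exists2 y, y \in Y & #|W| <= #|Y| * #|[set x in W | f x == y]|.
Proof.
move=> fW W0; have [x0 x0W] := set0Pn _ W0.
pose y0 := [arg max_(y > f x0 in Y) #|[set x in W | f x == y]|].
have : y0 \in Y /\ forall y, y \in Y ->
    #|[set x in W | f x == y]| <= #|[set x in W | f x == y0]|.
  by rewrite /y0; case: arg_maxnP => [|y yY H]; [exact: fW | split].
case=> y0Y ymax; exists y0 => //.
rewrite -[#|W|]sum1_card (partition_big f (mem Y)) //=.
rewrite -sum_nat_const; apply: leq_sum => y yY; rewrite sum1dep_card.
by apply: leq_trans (ymax _ yY); apply/subset_leq_card/subsetP => x; rewrite !inE.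
Qed.

Lemma card_small_subsets (A : {set V}) b :
  #|[set B : {set V} | (B \subset A) && (#|B| <= b)]| =
  \sum_(i < b.+1) 'C(#|A|, i).
Proof.
rewrite -sum1_card.
rewrite (partition_big (fun B : {set V} => inord #|B| : 'I_b.+1) xpredT) //=.
apply: eq_bigr => i _; rewrite sum1dep_card -cards_draws; apply: eq_card => B.
rewrite !inE -andbA; congr (_ && _); apply/andP/eqP => [[lb /eqP <-]|cB].
  by rewrite inordK.
by rewrite cB; split; [rewrite -ltnS | apply/eqP/val_inj; rewrite /= inordK].
Qed.

Lemma ex_max_ranked (W : {set V}) :
  exists A : {set V}, [/\ A \subset W, ranked A &
    forall B : {set V}, B \subset W -> ranked B -> #|B| <= #|A|].
Proof.
pose P n := `[< exists A : {set V}, [/\ A \subset W, ranked A & #|A| = n] >].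
have P0 : exists n, P n.
  by exists 0; apply/asboolP; exists set0; rewrite sub0set cards0; split=> //; exact: ranked0.
have Pb n : P n -> n <= #|W|.
  by move/asboolP => [A [AW _ <-]]; exact: subset_leq_card.
case: (ex_maxnP P0 Pb) => n /asboolP[A [AW rA cA]] nmax.
exists A; split=> // B BW rB; rewrite cA; apply: nmax; apply/asboolP.
by exists B.
Qed.

(** Oriented analogue of the Erdos-Szemeredi theorem.  Let [A] be a largest
    acyclic set among the vertices of small degree.  Most vertices have at most
    [b] neighbours in [A], so many of them have the same set [B] of neighbours
    in [A]; if there are [2 ^ b] of these, they contain an acyclic set larger
    than [B], by which [B] can be replaced. *)
Lemma ranked_sparse (W : {set V}) (M a b : nat) :
  \sum_(x in W) #|nbr W x| <= M -> 0 < #|W| ->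
  4 * a <= #|W| -> 16 * M * a <= b.+1 * #|W| ^ 2 ->
  8 * 2 ^ b * (\sum_(i < b.+1) 'C(a, i)) <= #|W| ->
  exists A : {set V}, [/\ A \subset W, ranked A & a < #|A|].
Proof.
move=> sM N0 aN bN TN; set N := #|W| in N0 aN bN TN.
pose W' := [set x in W | #|nbr W x| * N <= 2 * M].
have W'W : W' \subset W by apply/subsetP => x; rewrite inE => /andP[].
have cW' : N <= 2 * #|W'|.
  have : #|W :\: W'| * (2 * M).+1 <= N * M.
    apply: (@leq_trans (\sum_(x in W) #|nbr W x| * N)); last first.
      by rewrite -big_distrl /= mulnC leq_mul2l sM orbT.
    apply: leq_trans (card_markov _ _ (2 * M).+1).
    rewrite leq_mul2r; apply/orP; right; apply/subset_leq_card/subsetP => x.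
    by rewrite !inE; case: (x \in W) => //=; rewrite -ltnNge andbT.
  have := cardsID W' W; rewrite (setIidPr W'W) -/N => <-; nia.
have [A [AW' rA Amax]] := ex_max_ranked W'.
have [//|Aa] := ltnP a #|A|; first by exists A; split=> //; exact: subset_trans W'W.
exfalso.
(* vertices of [W'] with at most [b] neighbours in [A]: by Markov's inequality
   the others are at most an eighth of [W], because [A] sends few edges out *)
pose Z := [set v in W' :\: A | #|nbr A v| <= b].
have cZ : N <= 8 * #|Z|.
  have sA : N * (\sum_(v in W') #|nbr A v|) <= 2 * M * a.
    rewrite -(sum_nbr A W') big_distrr /=.
    apply: (@leq_trans (\sum_(x in A) 2 * M)); last first.
      by rewrite sum_nat_const mulnC leq_mul2l Aa orbT.
    apply: leq_sum => x /(subsetP AW'); rewrite inE => /andP[_].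
    rewrite [N * _]mulnC; apply: leq_trans; rewrite leq_mul2r; apply/orP; right.
    by apply/subset_leq_card/subsetP => y; rewrite !inE => /andP[/andP[-> _]].
  have bad : 8 * #|[set v in W' | b < #|nbr A v|]| <= N.
    have := card_markov W' (fun v => #|nbr A v|) b.+1.
    set q := #|_| => qb.
    have : 8 * q * (b.+1 * N ^ 2) <= N * (b.+1 * N ^ 2).
      apply: (@leq_trans (8 * N ^ 2 * (\sum_(v in W') #|nbr A v|))); first by nia.
      apply: (@leq_trans (N * (16 * M * a))); first by nia.
      by rewrite leq_mul2l bN orbT.
    by rewrite leq_pmul2r // muln_gt0 expn_gt0 N0.
  have : #|W'| <= #|Z| + #|[set v in W' | b < #|nbr A v|]| + #|A|.
    rewrite -addnA; apply: (@leq_trans #|Z :|: ([set v in W' | b < #|nbr A v|] :|: A)|).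
      apply/subset_leq_card/subsetP => x xW'; rewrite !inE; move: xW'; rewrite !inE.
      by move=> ->; case: (x \in A); rewrite ?orbT //= orbF; case: leqP.
    by apply: leq_trans (leq_of_leqif (leq_card_setU _ _)) _; rewrite leq_add2l;
       exact: leq_of_leqif (leq_card_setU _ _).
  by lia.
have [Z0|Z0] := eqVneq Z set0; first by move: cZ; rewrite Z0 cards0; lia.
pose Y := [set B : {set V} | (B \subset A) && (#|B| <= b)].
have fY : {in Z, forall x, nbr A x \in Y}.
  move=> x; rewrite !inE => /andP[_ ->]; rewrite andbT.
  by apply/subsetP => y; rewrite inE => /andP[].
have [B BY cB] := pigeonhole_fibre fY Z0.
have cY : #|Y| <= \sum_(i < b.+1) 'C(a, i).
  rewrite card_small_subsets; apply: leq_sum => i _; exact: leq_bin2l.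
set X := [set x in Z | nbr A x == B] in cB.
have cX : 2 ^ b <= #|X|.
  have : 8 * 2 ^ b * (\sum_(i < b.+1) 'C(a, i)) <= 8 * (\sum_(i < b.+1) 'C(a, i)) * #|X|.
    apply: leq_trans TN (leq_trans cZ _); rewrite -mulnA leq_mul2l /=.
    by apply: leq_trans cB _; rewrite leq_mul2r cY orbT.
  rewrite mulnAC leq_pmul2l // muln_gt0 /=.
  by rewrite big_ord_recl /= bin0.
have [I [IX rI cI]] := ranked_log cX.
have /andP[BA cBb] : (B \subset A) && (#|B| <= b) by rewrite inE in BY.
have XZ x : x \in X -> [/\ x \in W', x \notin A & nbr A x = B].
  by rewrite !inE => /andP[/andP[/andP[-> ->] _] /eqP].
(* [I] has more elements than [B] and sees nothing of [A] outside [B], so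
   replacing [B] by [I] would beat the maximality of [A] *)
have : #|(A :\: B) :|: I| <= #|A|.
  apply: Amax.
    rewrite subUset (subset_trans (subsetDl _ _) AW') /=.
    by apply/subsetP => x /(subsetP IX) /XZ[].
  apply: ranked_union => //; last exact: ranked_sub (subsetDl _ _) rA.
  move=> x y; rewrite inE => /andP[xB xA] /(subsetP IX) /XZ[_ _ yB].
  by apply: contra xB; rewrite -yB inE xA underlyingC.
rewrite cardsU (_ : _ :&: I = set0) ?cards0 ?subn0; last first.
  apply/setP => x; rewrite !inE; apply/negP => /andP[/andP[_ xA]].
  by move=> /(subsetP IX) /XZ[_]; rewrite xA.
rewrite cardsD (setIidPr BA) cI; have := subset_leq_card BA; lia.
Qed.

End AcyclicSets.

(** * Colouring by repeated extraction *)

Section Colourings.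
Import mathcomp.boot.fintype mathcomp.boot.finset.
Local Open Scope nat_scope.
Variables (V : finType) (D : rel V).

Definition ranked_colouring (W : {set V}) (k : nat) : Prop :=
  exists f : V -> nat, {in W, forall x, f x < k} /\
    forall i, ranked D [set x in W | f x == i].

Lemma ranked_colouring_card (W : {set V}) : (forall v, ~~ D v v) ->
  ranked_colouring W #|W|.
Proof.
move=> Dirr; exists (fun x => index x (enum W)); split.
  by move=> x xW; rewrite cardE index_mem mem_enum.
move=> i; exists (fun=> 0) => x y; rewrite !inE => /andP[xW /eqP xi] /andP[yW /eqP yi].
have -> : x = y by rewrite -(nth_index x (s := enum W) (x := x)) ?mem_enum // xi -yi nth_index ?mem_enum.
by rewrite (negbTE (Dirr _)).
Qed.

Lemma ranked_colouring_mono (W : {set V}) k l :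
  k <= l -> ranked_colouring W k -> ranked_colouring W l.
Proof.
move=> kl [f [fk fr]]; exists f; split=> // x xW; exact: leq_trans (fk x xW) kl.
Qed.

Lemma ranked_colouring_extract (W A : {set V}) k :
  ranked D A -> ranked_colouring (W :\: A) k -> ranked_colouring W k.+1.
Proof.
move=> rA [f [fk fr]].
exists (fun x => if x \in A then k else f x); split.
  move=> x xW; case: ifPn => // xA; rewrite ltnW // ltnS; apply: fk.
  by rewrite inE xA.
move=> i; have [->|ik] := eqVneq i k.
  apply: ranked_sub rA; apply/subsetP => x; rewrite inE => /andP[xW].
  by case: ifPn => // xA /eqP fx; have := fk x; rewrite inE xA xW fx ltnn => /(_ isT).
apply: ranked_sub (fr i); apply/subsetP => x; rewrite !inE => /andP[-> ].
by case: ifPn => // _ /eqP ki; rewrite -ki eqxx in ik.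
Qed.

(** A vertex of degree below [2 * k] has fewer than [k] in-neighbours or fewer
    than [k] out-neighbours; a colour missing on that side makes it a source or a
    sink of its colour class. *)
Lemma ranked_colouring_add (W : {set V}) (v : V) k : ~~ D v v -> v \in W ->
  #|[set y in W | underlying D v y]| < 2 * k -> oriented D ->
  ranked_colouring (W :\ v) k -> ranked_colouring W k.
Proof.
move=> Dvv vW dv oD [f [fk fr]].
pose O := [set y in W | D v y]; pose I := [set y in W | D y v].
have OI : #|O| + #|I| < 2 * k.
  apply: leq_ltn_trans dv; rewrite -cardsUI (_ : O :&: I = set0) ?cards0 ?addn0.
    apply/subset_leq_card/subsetP => y; rewrite !inE /underlying.
    by case: (y \in W) => //=; case: (D v y).
  by apply/setP => y; rewrite !inE; have := oD v y; case: (y \in W); case: (D v y); case: (D y v).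
have free (X : {set V}) : #|X| < k -> exists2 i, i < k & forall y, y \in X -> f y != i.
  move=> Xk; apply: contrapT => nfree.
  have : #|'I_k| <= #|[set y in X | f y < k]|.
    pose g (i : 'I_k) := odflt v [pick y in X | f y == i].
    have gP i : g i \in X /\ f (g i) = i.
      rewrite /g; case: pickP => [y /andP[yX /eqP] //|none].
      case: nfree; exists i => // y yX; apply/negP => /eqP fy.
      by have := none y; rewrite /= yX fy eqxx.
    have ginj : injective g.
      by move=> i j gij; apply/val_inj; rewrite /= -(gP i).2 -(gP j).2 gij.
    rewrite -(card_codom ginj); apply/subset_leq_card/subsetP => y /codomP[i ->].
    by rewrite inE (gP i).1 (gP i).2 /=.
  rewrite card_ord leqNgt; apply/negP; rewrite negbK.
  by apply: leq_ltn_trans Xk; apply/subset_leq_card/subsetP => y; rewrite inE => /andP[].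
have dist i : i < k -> ((forall y, y \in O -> f y != i) \/ (forall y, y \in I -> f y != i)) ->
    ranked_colouring W k.
  move=> ik avoid; exists (fun x => if x == v then i else f x); split.
    by move=> x xW; case: eqVneq => // xv; apply: fk; rewrite !inE xv.
  move=> j; have [->|ji] := eqVneq j i; last first.
    apply: ranked_sub (fr j); apply/subsetP => x; rewrite !inE.
    by case: (eqVneq x v) => /= [_ /andP[_ /eqP ij]|_]; [rewrite ij eqxx in ji | ].
  have cl : ranked D (v |: [set x in W :\ v | f x == i]).
    case: avoid => av.
      apply: ranked_sink => // x; rewrite !inE => /andP[/andP[xv xW] fx].
      by apply/negP => Dvx; have := av x; rewrite inE xW Dvx fx => /(_ isT).
    apply: ranked_source => // x; rewrite !inE => /andP[/andP[xv xW] fx].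
    by apply/negP => Dvx; have := av x; rewrite inE xW Dvx fx => /(_ isT).
  apply: ranked_sub cl; apply/subsetP => x; rewrite !inE.
  by case: (eqVneq x v) => //= _.
have [Ok|Ik] : #|O| < k \/ #|I| < k by lia.
  by have [i ik iO] := free _ Ok; apply: (dist i) => //; left.
by have [i ik iO] := free _ Ik; apply: (dist i) => //; right.
Qed.

Lemma ranked_colouring_degenerate k n0 (W : {set V}) :
  oriented D ->
  (forall U : {set V}, n0 < #|U| -> exists2 v, v \in U &
     #|[set y in U | underlying D v y]| < 2 * k) ->
  (forall U : {set V}, #|U| <= n0 -> ranked_colouring U k) ->
  ranked_colouring W k.
Proof.
move=> oD dU sU; have [n] := ubnP #|W|.
elim: n W => // n IH W Wn; have [/sU //|n0W] := leqP #|W| n0.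
have [v vW dv] := dU _ n0W.
apply: (@ranked_colouring_add _ v) => //; first by have := oD v v; rewrite andbb.
apply: IH; rewrite -ltnS; apply: leq_trans Wn; rewrite ltnS.
by rewrite [X in _ < X](cardsD1 v) vW add1n ltnSn.
Qed.

Lemma ranked_colouring_dicolourable k :
  ranked_colouring setT k -> dicolourable D k.
Proof.
case=> f [fk fr]; exists (fun x => Ordinal (fk x (in_setT x))) => i.
apply: ranked_acyclic; apply: ranked_sub (fr i).
by apply/subsetP => x; rewrite !inE => /eqP <- /=; rewrite eqxx.
Qed.

Lemma ex_low_degree (U : {set V}) (d : nat) : 0 < #|U| ->
  \sum_(x in U) #|[set y in U | underlying D x y]| < d * #|U| ->
  exists2 v, v \in U & #|[set y in U | underlying D v y]| < d.
Proof.
move=> U0 lt; apply: contrapT => no; move: lt; rewrite ltnNge => /negP; apply.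
rewrite mulnC -sum_nat_const; apply: leq_sum => x xU.
by rewrite leqNgt; apply/negP => xd; apply: no; exists x.
Qed.

End Colourings.

Section ColourBound.
Local Open Scope ring_scope.
Variable R : realType.

(** The usual tail bound: weight the [i]-th term of the expansion of
    [(1 + r^-1) ^+ a] by [r ^+ (b - i) >= 1]. *)
Lemma sum_bin_le (r : R) (a b : nat) : 1 <= r ->
  (\sum_(i < b.+1) 'C(a, i))%:R <= r ^+ b * (1 + r^-1) ^+ a.
Proof.
move=> r1; have r0 : 0 < r by lra.
rewrite exprDn mulr_sumr natr_sum.
pose F i : R := r ^+ b * ((1 ^+ (a - i) * r^-1 ^+ i) *+ 'C(a, i)).
have F0 i : 0 <= F i.
  by rewrite /F mulr_ge0 ?exprn_ge0 ?(ltW r0)// mulrn_wge0// mulr_ge0// exprn_ge0// invr_ge0 ltW.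
have FC i : (i < b.+1)%N -> 'C(a, i)%:R <= F i.
  move=> ib; rewrite /F expr1n mul1r mulrnAr -[leLHS]mulr1 mulr_natl lerMn2r.
  apply/orP; right; rewrite exprVn ler_pdivlMr ?exprn_gt0// mul1r.
  by rewrite ler_weXn2l// -ltnS.
apply: (@le_trans _ _ (\sum_(i < b.+1) (if (i < a.+1)%N then F i else 0))).
  apply: ler_sum => i _; case: ifPn => ia; first exact: FC.
  by rewrite bin_small// ltnNge -ltnS.
rewrite -(big_mkord xpredT (fun i => if (i < a.+1)%N then F i else 0)).
rewrite -(big_mkord xpredT F) -big_mkcond /=.
have [ba|ab] := leqP b.+1 a.+1.
  rewrite [leRHS](big_cat_nat (n := b.+1))//=.
  rewrite -[leLHS]addr0; apply: lerD; last by apply: sumr_ge0.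
  by rewrite [leLHS]big_mkcond /=; apply: ler_sum => i _; case: ifP.
rewrite (big_cat_nat (n := a.+1))//=; last exact: ltnW.
rewrite [X in _ + X]big1_seq ?addr0; last first.
  by move=> i /=; rewrite mem_index_iota => /andP[ia /andP[ai _]]; rewrite ltnNge ai in ia.
by rewrite [leLHS]big_mkcond /=; apply: ler_sum => i _; case: ifP.
Qed.

Lemma exprn_expR_ln (x : R) n : 0 < x -> x ^+ n = expR (n%:R * ln x).
Proof. by move=> x0; rewrite mulrC expRM_natr lnK. Qed.

Lemma ln_le_subr1 (x : R) : 0 < x -> ln x <= x - 1.
Proof. by move=> x0; have := le_ln1Dx (x := x - 1); rewrite addrCA subrr addr0; apply; lra. Qed.

End ColourBound.

(** * Counting colours *)

Section ColourCount.
Local Open Scope ring_scope.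
Variables (R : realType) (V : finType) (D : rel V) (C g : nat).
Hypothesis oD : oriented D.
Hypothesis C0 : (0 < C)%N.
Let nbr (W : {set V}) x := [set y in W | underlying D x y].
Hypothesis sparse : forall W : {set V},
  (\sum_(x in W) #|nbr W x| <= C * (#|W| + g))%N.

(** The scales of the argument.  Writing [N] for the number of uncoloured
    vertices, [s ~ sqrt g] is where the sparsity [C * (N + g)] stops saying anything
    beyond the trivial [N ^ 2], [y = g ^ (1/4)] is negligible against the final
    bound, and [L] is a small multiple of [ln g]. *)
Definition colour_scale (s y L : R) : Prop :=
  [/\ s = Num.sqrt (2 * C%:R * g%:R), y = Num.sqrt (Num.sqrt g%:R),
      L = ln y / 50 & 8 <= y].

Lemma colour_scale_facts s y L : colour_scale s y L ->
  [/\ y ^+ 4 = g%:R, s ^+ 2 = 2 * C%:R * g%:R, y ^+ 2 <= s, 0 < L &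
      50 * L <= y - 1].
Proof.
case=> s_def y_def L_def y8; split.
- by rewrite y_def (exprM _ 2 2) !sqr_sqrtr ?sqrtr_ge0.
- by rewrite s_def sqr_sqrtr ?mulr_ge0.
- rewrite s_def y_def sqr_sqrtr ?sqrtr_ge0// ler_sqrt ?mulr_ge0//.
  rewrite -[leLHS]mul1r ler_wpM2r//.
  have : (1 : R) <= C%:R by rewrite ler1n.
  lra.
- by rewrite L_def divr_gt0// ln_gt0//; lra.
- rewrite L_def mulrC divfK ?pnatr_eq0//.
  by apply: ln_le_subr1; lra.
Qed.

(** Between [s] and [g] vertices the average degree is [O(s ^ 2 / N)], and the
    oriented Erdos-Szemeredi theorem gives acyclic sets of size [L * u ^ 3], where
    [u = sqrt (N / s)]; the factor [u ^ 3] gained over [ranked_small] keeps the total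
    number of rounds small. *)
Lemma ranked_dense s y L (W : {set V}) : colour_scale s y L -> s <= #|W|%:R -> (#|W| <= g)%N ->
  exists A : {set V}, [/\ A \subset W, ranked D A &
    L * Num.sqrt (#|W|%:R / s) ^+ 3 <= #|A|%:R].
Proof.
move=> sc; have [s_def y_def L_def y8] := sc.
have [y4 s2 sy L0 Ly] := colour_scale_facts sc.
move=> sN Ng; set N := #|W| in sN Ng *.
have s0 : 0 < s by apply: lt_le_trans sy; rewrite exprn_gt0//; lra.
have N0 : (0 < N)%N by rewrite -(ltr_nat R); apply: lt_le_trans sN.
pose u := Num.sqrt (N%:R / s); rewrite -/u.
have u2 : s * u ^+ 2 = N%:R.
  by rewrite sqr_sqrtr ?divr_ge0 ?(ltW s0)// mulrC divfK ?gt_eqF.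
have u1 : 1 <= u.
  by rewrite -sqrtr1 ler_sqrt ?divr_ge0 ?(ltW s0)// ler_pdivlMr ?mul1r.
clearbody u.
have NgR : N%:R <= y ^+ 4 by rewrite y4 ler_nat.
have us : u ^+ 2 <= s.
  rewrite -(ler_pM2l s0) u2; apply: le_trans NgR _.
  by rewrite (exprM _ 2 2) -[s * s]expr2 lerXn2r ?nnegrE ?sqr_ge0 ?(ltW s0).
pose r := u ^+ 3; have rE : r = u ^+ 3 by []; rewrite -/r.
have r1 : 1 <= r by rewrite exprn_ege1.
clearbody r.
have r0 : 0 < r by lra.
pose M := (2 * C * g)%N; have ME : M = (2 * C * g)%N by [].
clearbody M; have MR : M%:R = s ^+ 2 by rewrite s2 ME !natrM.
pose a := Num.truncn (L * r).
have aL : a%:R <= L * r by rewrite /a truncn_le// mulr_ge0 ?ltW.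
have aL' : L * r < a.+1%:R by exact: truncnS_gt.
(* [b] is a bound for the number of neighbours that a typical vertex has in an
   acyclic set of size [a]; it is at most [16 * L / u] *)
pose b := Num.truncn (16 * M%:R * a%:R / N%:R ^+ 2 : R).
have N20 : 0 < N%:R ^+ 2 :> R by rewrite exprn_gt0 // ltr0n.
have bE : b%:R <= 16 * M%:R * a%:R / N%:R ^+ 2 :> R.
  by rewrite truncn_le// divr_ge0 ?mulr_ge0.
have bE' : 16 * M%:R * a%:R / N%:R ^+ 2 < b.+1%:R :> R by exact: truncnS_gt.
have bu : b%:R * u <= 16 * L.
  apply: (@le_trans _ _ (16 * M%:R * (L * r) / N%:R ^+ 2 * u)).
    apply: ler_wpM2r; first by lra.
    apply: le_trans bE _; rewrite ler_pM2r ?invr_gt0//.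
    by apply: ler_wpM2l => //; rewrite mulr_ge0.
  rewrite MR -u2 mulrAC ler_pdivrMr; last by rewrite u2.
  by rewrite le_eqVlt; apply/orP; left; apply/eqP; rewrite ?rE; ring.
have sumW : (\sum_(x in W) #|nbr W x| <= M)%N.
  apply: leq_trans (sparse W) _; rewrite -/N ME.
  by rewrite [(2 * C)%N]mulnC -mulnA leq_mul2l mul2n -addnn leq_add2r Ng orbT.
have [A [AW rA aA]] : exists A : {set V}, [/\ A \subset W, ranked D A & (a < #|A|)%N].
  apply: (@ranked_sparse _ _ oD W M a b) => //.
  - rewrite -(ler_nat R) natrM -/N -u2.
    apply: (@le_trans _ _ (4 * (L * r))); first by apply: ler_wpM2l.
    rewrite rE; have : 4 * L * u <= s.
      have : u * u <= s by rewrite -expr2.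
      have : y * y <= s by rewrite -expr2.
      have [uy|yu] := leP u y => yy uu; first by nra.
      by apply: le_trans uu; rewrite ler_wpM2r; lra.
    move=> h; have : 0 <= u ^+ 2 by rewrite sqr_ge0.
    move=> h2; rewrite (_ : 4 * _ = 4 * L * u * u ^+ 2); last by ring.
    by rewrite ler_wpM2r.
  - rewrite -(ler_nat R) !natrM -expr2 -/N.
    by move: bE'; rewrite ltr_pdivrMr// => /ltW.
  - rewrite -(ler_nat R) !natrM natrX -/N.
    apply: (@le_trans _ _ (8 * expR (49 * L))).
      rewrite -mulrA; apply: ler_wpM2l => //.
      apply: (@le_trans _ _ (2 ^+ b * (r ^+ b * (1 + r^-1) ^+ a))).
        by apply: ler_wpM2l; [rewrite exprn_ge0 | exact: sum_bin_le].
      have e1 : 2 ^+ b <= expR (b%:R) :> R.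
        rewrite -[X in expR X]mulr1 expRM_natl lerXn2r ?nnegrE ?expR_ge0//.
        by have := expR_ge1Dx (1 : R); rewrite -[1 + 1]/(2 : R).
      have e2 : r ^+ b = expR (b%:R * ln r) by apply: exprn_expR_ln.
      have e3 : (1 + r^-1) ^+ a <= expR (a%:R * r^-1).
        rewrite expRM_natl lerXn2r ?nnegrE ?expR_ge0 ?addr_ge0 ?invr_ge0 ?(ltW r0)//.
        exact: expR_ge1Dx.
      apply: (@le_trans _ _ (expR b%:R * (expR (b%:R * ln r) * expR (a%:R * r^-1)))).
        apply: ler_pM; [by rewrite exprn_ge0 | | exact: e1 | ].
          by rewrite mulr_ge0 ?exprn_ge0 ?addr_ge0 ?invr_ge0 ?(ltW r0).
        by rewrite e2; apply: ler_wpM2l => //; rewrite expR_ge0.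
      rewrite -!expRD ler_expR.
      have : ln r <= 3 * (u - 1).
        rewrite rE lnXn; last by lra.
        by rewrite -[ln u *+ 3]mulr_natl ler_wpM2l// ln_le_subr1//; lra.
      have : a%:R * r^-1 <= L by rewrite ler_pdivrMr.
      have : 0 <= b%:R :> R by [].
      nra.
    apply: (@le_trans _ _ (8 * y)).
      apply: ler_wpM2l => //; rewrite -[leRHS]lnK; last by rewrite posrE; lra.
      by rewrite ler_expR L_def; have : 0 < ln y by [rewrite ln_gt0//; lra]; lra.
    apply: le_trans sN; apply: le_trans sy; nra.
exists A; split=> //; apply: le_trans (ltW aL') _.
by rewrite ler_nat.
Qed.

(** Below [s] only the logarithmic bound valid in every digraph is used; it is
    still at least [L] as long as [y = g ^ (1/4)] vertices remain. *)
Lemma ranked_small s y L (W : {set V}) : colour_scale s y L -> y <= #|W|%:R ->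
  exists A : {set V}, [/\ A \subset W, ranked D A & L <= #|A|%:R].
Proof.
move=> sc; have [s_def y_def L_def y8] := sc.
have [y4 s2 sy L0 Ly] := colour_scale_facts sc.
move=> yN; have N0 : (0 < #|W|)%N.
  by rewrite -(ltr_nat R); apply: lt_le_trans yN; lra.
have [A [AW rA cA]] := ranked_log oD (trunc_logP (isT : 1 < 2)%N N0).
exists A; split=> //; rewrite cA.
have : y < 2 ^+ (trunc_log 2 #|W|).+1.
  by apply: le_lt_trans yN _; rewrite -natrX ltr_nat trunc_log_ltn.
move: (trunc_log 2 #|W|).+1 => t yt.
have : ln y <= t%:R * ln 2.
  have y0 : 0 < y by lra.
  rewrite mulrC mulr_natr -lnXn// ler_ln ?posrE ?exprn_gt0 ?(ltW yt)//.
have : ln (2 : R) <= 1 by have := ln_le_subr1 (x := 2 : R); lra.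
have : 0 <= t%:R :> R by [].
have : 0 < ln y by rewrite ln_gt0//; lra.
rewrite L_def; nra.
Qed.

(** Each round removes [L] vertices, and the last [y] vertices get a colour
    each. *)
Lemma colouring_below s y L (W : {set V}) k : colour_scale s y L ->
  y + 1 + #|W|%:R / L <= k%:R -> ranked_colouring D W k.
Proof.
move=> sc; have [s_def y_def L_def y8] := sc.
have [y4 s2 sy L0 Ly] := colour_scale_facts sc.
have [n] := ubnP #|W|; elim: n W k => // n IH W k Wn.
have [Wy kb|yW] := leP #|W|%:R y.
  apply: ranked_colouring_mono (ranked_colouring_card _ _); last first.
    by move=> v; have := oD v v; rewrite andbb.
  rewrite -(ler_nat R); apply: le_trans Wy (le_trans _ kb).
  by have : 0 <= #|W|%:R / L by [rewrite divr_ge0// ltW]; lra.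
have [A [AW rA LA]] := ranked_small sc (ltW yW).
have cW := cardsID A W; rewrite (finset.setIidPr AW) in cW.
have A0 : (0 < #|A|)%N by rewrite -(ltr_nat R); apply: lt_le_trans LA.
case: k => [|k kb].
  have : 0 <= #|W|%:R / L by [rewrite divr_ge0// ltW].
  by lra.
apply: (ranked_colouring_extract rA); apply: IH; first by lia.
have : #|W|%:R / L = #|A|%:R / L + #|W :\: A|%:R / L by rewrite -mulrDl -natrD cW.
have : 1 <= #|A|%:R / L by rewrite ler_pdivlMr// mul1r.
by move: kb; rewrite -natr1; lra.
Qed.

(** The number of rounds is controlled by the potential
    [- 2 * s / L * sqrt (s / N)]: removing [L * u ^ 3] vertices decreases it by at
    least one, since [N = s * u ^ 2] turns the removal into a decrease of [u] by at
    least [L * u ^ 2 / (2 * s)]. *)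
Lemma colouring_above s y L (W : {set V}) k : colour_scale s y L -> s <= #|W|%:R -> (#|W| <= g)%N ->
  y + 2 + s / L + 2 * s / L * (1 - Num.sqrt (s / #|W|%:R)) <= k%:R ->
  ranked_colouring D W k.
Proof.
move=> sc; have [s_def y_def L_def y8] := sc.
have [y4 s2 sy L0 Ly] := colour_scale_facts sc.
have s0 : 0 < s by apply: lt_le_trans sy; rewrite exprn_gt0//; lra.
have sL : 0 < s / L by rewrite divr_gt0.
have [n] := ubnP #|W|; elim: n W k => // n IH W k Wn sW Wg kb.
have W0 : (0 : R) < #|W|%:R by apply: lt_le_trans sW.
have [A [AW rA LA]] := ranked_dense sc sW Wg.
have cW := cardsID A W; rewrite (finset.setIidPr AW) in cW.
pose u := Num.sqrt (#|W|%:R / s); rewrite -/u in LA.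
have u1 : 1 <= u.
  by rewrite -sqrtr1 ler_sqrt ?divr_ge0 ?(ltW s0)// ler_pdivlMr ?mul1r.
have iu : Num.sqrt (s / #|W|%:R) = u^-1.
  by rewrite /u -[s / _]invf_div sqrtrV// divr_ge0// ltW.
have u0 : 0 < u by lra.
have iu1 : u^-1 <= 1 by rewrite invf_le1.
have A0 : (0 < #|A|)%N.
  by rewrite -(ltr_nat R); apply: lt_le_trans LA; rewrite mulr_gt0// exprn_gt0.
rewrite iu in kb.
have u2 : s * u ^+ 2 = #|W|%:R.
  by rewrite sqr_sqrtr ?divr_ge0 ?(ltW s0)// mulrC divfK ?gt_eqF.
clearbody u.
case: k kb => [|k] kb.
  have : 0 <= 2 * s / L * (1 - u^-1).
    by rewrite mulr_ge0//; [rewrite -mulrA mulr_ge0// ltW | lra].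
  by lra.
apply: (ranked_colouring_extract rA).
have [W's|sW'] := ltP #|W :\: A|%:R s.
  apply: (colouring_below sc).
  have : #|W :\: A|%:R / L <= s / L by rewrite ler_pM2r ?invr_gt0// ltW.
  have : 0 <= 2 * s / L * (1 - u^-1).
    by rewrite mulr_ge0//; [rewrite -mulrA mulr_ge0// ltW | lra].
  by move: kb; rewrite -natr1; lra.
apply: IH => //; first by move: Wn A0; rewrite -cW; clear; lia.
  by apply: leq_trans Wg; rewrite -cW leq_addl.
pose v := Num.sqrt (#|W :\: A|%:R / s).
have v1 : 1 <= v.
  by rewrite -sqrtr1 ler_sqrt ?divr_ge0 ?(ltW s0)// ler_pdivlMr ?mul1r.
have v0 : 0 < v by lra.
have -> : Num.sqrt (s / #|W :\: A|%:R) = v^-1.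
  by rewrite /v -[s / _]invf_div sqrtrV// divr_ge0// ltW.
have v2 : s * v ^+ 2 = #|W :\: A|%:R.
  by rewrite sqr_sqrtr ?divr_ge0 ?(ltW s0)// mulrC divfK ?gt_eqF.
clearbody v.
have uv : L * u ^+ 3 <= s * (u ^+ 2 - v ^+ 2).
  by rewrite mulrBr u2 v2 -cW natrD addrK.
have key : 1 <= 2 * s / L * (v^-1 - u^-1).
  have vu : v <= u.
    rewrite -(ler_pXn2r (ltn0Sn 1)) ?nnegrE ?(ltW u0) ?(ltW v0)//.
    by rewrite -(ler_pM2l s0) u2 v2 ler_nat -cW leq_addl.
  rewrite (_ : v^-1 - u^-1 = (u - v) / (v * u)); last first.
    by field; rewrite !gt_eqF.
  rewrite mulrA ler_pdivlMr ?mul1r; last exact: mulr_gt0.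
  rewrite [_ / L * _]mulrAC ler_pdivlMr//.
  have h1 : u ^+ 2 - v ^+ 2 <= 2 * u * (u - v).
    by rewrite !expr2; nra.
  have h2 : L * u ^+ 3 <= s * (2 * u * (u - v)).
    by apply: le_trans uv _; rewrite ler_pM2l.
  have h3 : L * u ^+ 2 <= 2 * s * (u - v).
    rewrite -(ler_pM2r u0); apply: le_trans (le_trans h2 _); rewrite le_eqVlt.
      by apply/orP; left; apply/eqP; rewrite ?rE; ring.
    by apply/orP; left; apply/eqP; rewrite ?rE; ring.
  apply: le_trans h3; rewrite mulrC ler_pM2l//.
  by rewrite expr2 ler_wpM2r// ltW.
by move: kb; rewrite -natr1; nra.
Qed.

(** In a set of more than [g] vertices the average degree is at most [2 * C], so a
    vertex of degree below [2 * k] can be set aside; the rest is coloured by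
    extraction. *)
Lemma colouring_count s y L k : colour_scale s y L -> (C < k)%N ->
  y + 2 + 3 * (s / L) <= k%:R -> dicolourable D k.
Proof.
move=> sc; have [s_def y_def L_def y8] := sc.
have [y4 s2 sy L0 Ly] := colour_scale_facts sc.
have s0 : 0 < s by apply: lt_le_trans sy; rewrite exprn_gt0//; lra.
have sL : 0 < s / L by rewrite divr_gt0.
move=> Ck kb; apply: ranked_colouring_dicolourable.
apply: (@ranked_colouring_degenerate _ _ k g) => // U.
  move=> gU; apply: ex_low_degree; first exact: leq_ltn_trans gU.
  apply: leq_ltn_trans (sparse U) _.
  have : (C * (#|U| + g) <= C * (2 * #|U|))%N by rewrite leq_mul2l; lia.
  move/leq_ltn_trans; apply; rewrite mulnCA -mulnA ltn_mul2l /= ltn_mul2r Ck andbT.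
  exact: leq_ltn_trans gU.
move=> Ug; have [Us|sU] := leP #|U|%:R s.
  apply: (colouring_below sc).
  have : #|U|%:R / L <= s / L by rewrite ler_pM2r ?invr_gt0.
  by lra.
apply: (colouring_above sc) => //; first exact: ltW.
have : 0 <= Num.sqrt (s / #|U|%:R) by [].
by nra.
Qed.

End ColourCount.

(** * The dichromatic number of uniformly sparse digraphs *)

Section DichromaticUpperBound.
Local Open Scope ring_scope.
Variable R : realType.

Lemma sqrt_div_ln (g : nat) : (2 <= g)%N -> let y : R := Num.sqrt (Num.sqrt g%:R) in
  [/\ 1 < y, 0 < ln y, y ^+ 4 = g%:R &
      Num.sqrt g%:R / ln g%:R = y ^+ 2 / (4 * ln y) ].
Proof.
move=> g2 y.
have y4 : y ^+ 4 = g%:R by rewrite (exprM _ 2 2) !sqr_sqrtr ?sqrtr_ge0.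
have y1 : 1 < y.
  have g1 : 1 < g%:R :> R by rewrite ltr1n.
  by rewrite /y -[ltLHS]sqrtr1 ltr_sqrt ?sqrtr_gt0 -?[ltLHS]sqrtr1 ?ltr_sqrt; lra.
split=> //; first by rewrite ln_gt0.
rewrite -[X in ln X]y4 lnXn; last by rewrite (lt_trans _ y1).
by rewrite -[ln y *+ 4]mulr_natl sqr_sqrtr// sqrtr_ge0.
Qed.

(** With [y = g ^ (1/4)], the [y + O(s / L)] colours of [colouring_count] are
    [O(sqrt g / ln g)].  For [y < 8] the parameter [g] is bounded, and degeneracy alone
    gives a bounded number of colours. *)
Theorem dichromatic_sparse_bound (C : nat) : (0 < C)%N ->
  exists2 a : R, 0 < a & forall g : nat, (2 <= g)%N ->
    exists2 k : nat, k%:R <= a * (Num.sqrt g%:R / ln g%:R) &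
      forall (V : finType) (D : rel V), oriented D ->
        (forall W : {set V},
          (\sum_(x in W) #|[set y in W | underlying D x y]%SET| <= C * (#|W| + g))%N) ->
        dicolourable D k.
Proof.
move=> C0; pose q : R := Num.sqrt (2 * C%:R).
have q0 : 0 <= q by rewrite sqrtr_ge0.
have [T T0 TE] : exists2 T : R, 0 <= T & T = 8 ^+ 4.
  by exists (8 ^+ 4) => //; rewrite exprn_ge0.
exists (4 * ((1 + T) * C%:R + 1) + 600 * q + 16 + 4 * C%:R).
  have C1 : 0 <= C%:R :> R by [].
  have := mulr_ge0 T0 C1; lra.
move=> g g2; have [y1 l0 y4 ->] := sqrt_div_ln g2.
pose y : R := Num.sqrt (Num.sqrt g%:R).
rewrite -/y in y1 l0 y4 *.
have ly : ln y <= y - 1 by apply: ln_le_subr1; lra.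
set B := y ^+ 2 / (4 * ln y).
have B0 : 0 < B by rewrite divr_gt0 ?exprn_gt0 ?mulr_gt0//; lra.
have yB : y <= 4 * B.
  rewrite /B; rewrite (_ : 4 * _ = y ^+ 2 / ln y); last by field; rewrite gt_eqF.
  by rewrite ler_pdivlMr// expr2 ler_wpM2l//; lra.
have B1 : 1 <= 4 * B by apply: le_trans yB; exact: ltW.
have CR : 0 <= C%:R :> R by [].
have [y8|y8] := leP 8 y; last first.
  exists (C * (1 + g)).+1; last first.
    move=> V D oD sp; apply: ranked_colouring_dicolourable.
    apply: (@ranked_colouring_degenerate _ _ _ 0) => // [U U0|U]; last first.
      rewrite leqn0 => /eqP U0; apply: (@ranked_colouring_mono _ _ _ #|U|).
        by rewrite U0.
      by apply: ranked_colouring_card => v; have := oD v v; rewrite andbb.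
    have [||v vU dv] := @ex_low_degree _ D U (C * (1 + g)).+1; first exact: U0.
      apply: leq_ltn_trans (sp U) _.
      by rewrite mulSn; move: U0; clear; nia.
    by exists v => //; apply: ltn_trans dv _; rewrite mul2n -addnn -[ltnLHS]addn0 ltn_add2l.
  have gR : g%:R <= T.
    by rewrite -y4 TE lerXn2r ?nnegrE//; lra.
  rewrite -natr1 natrM natrD; clearbody q; clearbody B.
  have : C%:R * g%:R <= C%:R * T by rewrite ler_wpM2l.
  have := mulr_ge0 CR (ltW B0); have := mulr_ge0 q0 (ltW B0).
  have : (1 + T) * C%:R + 1 <= ((1 + T) * C%:R + 1) * (4 * B).
    by rewrite ler_peMr// addr_ge0// mulr_ge0// addr_ge0.
  have := mulr_ge0 T0 (mulr_ge0 CR (ltW B0)).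
  lra.
pose s : R := Num.sqrt (2 * C%:R * g%:R); pose L := ln y / 50.
have sq : s = q * y ^+ 2.
  by rewrite /s sqrtrM ?mulr_ge0// /y sqr_sqrtr ?sqrtr_ge0.
have sL : s / L = 200 * q * B.
  by rewrite sq /L /B; field; rewrite gt_eqF.
exists (Num.truncn (y + 2 + 3 * (s / L)) + C).+1; last first.
  move=> V D oD sp; apply: (@colouring_count R V D C g oD C0 sp s y L).
  - by split.
  - by rewrite ltnS leq_addl.
  - rewrite -addSn natrD; apply: ltW.
    by apply: lt_le_trans (truncnS_gt _) _; rewrite lerDl.
rewrite -natr1 natrD.
have : (Num.truncn (y + 2 + 3 * (s / L)))%:R <= y + 2 + 3 * (s / L).
  by rewrite truncn_le// sL; have := mulr_ge0 q0 (ltW B0); lra.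
have := mulr_ge0 T0 (mulr_ge0 CR (ltW B0)).
rewrite sL; have := mulr_ge0 CR (ltW B0); have := mulr_ge0 q0 (ltW B0).
clearbody q; clearbody B.
have : (3 + C%:R) <= (3 + C%:R) * (4 * B).
  by rewrite ler_peMr// addr_ge0.
move: (Num.truncn _) => t.
lra.
Qed.

End DichromaticUpperBound.

(** * Minors of a complex over the field with two elements *)

Section CellComplexes.
Import mathcomp.boot.fintype mathcomp.boot.finset.
Local Open Scope ring_scope.

Lemma addF2 (x : 'F_2) : x + x = 0.
Proof. exact: (addrr_pchar2 (pchar_Fp (isT : prime 2))). Qed.

Lemma eqF2 (x y : 'F_2) : x + y = 0 -> x = y.
Proof. by move=> xy; rewrite -[x]addr0 -(addF2 y) addrA xy add0r. Qed.

Lemma addKF2 (x y : 'F_2) : x + (x + y) = y.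
Proof. by rewrite addrA addF2 add0r. Qed.

(** The nonzero rows span the row space. *)
Lemma mxrank_nonzero_rows (K : fieldType) m n (A : 'M[K]_(m, n)) :
  (\rank A <= #|[set i | row i A != 0%R]|)%N.
Proof.
set S := [set i | _].
pose B := rowsub (enum_val : 'I_#|S| -> 'I_m) A.
suff AB : (A <= B)%MS by apply: leq_trans (mxrankS AB) (rank_leq_row _).
apply/row_subP => i; have [->|Ai] := eqVneq (row i A) 0; first exact: sub0mx.
have iS : i \in S by rewrite inE.
suff -> : row i A = row (enum_rank_in iS i) B by exact: row_sub.
by apply/rowP => j; rewrite !mxE enum_rankK_in.
Qed.

Section Complex.
Variables (V E F : finType) (s t : E -> V) (l r : E -> F).

Definition incidence (e : E) (x : V) : 'F_2 := (s e == x)%:R + (t e == x)%:R.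
(** Chains over the field with two elements, on a complex given only by the two
    ends and the two sides of each edge; the boundary of a chain of faces is written
    on an edge as the sum over its two sides. *)
Definition boundary1 (z : E -> 'F_2) (x : V) : 'F_2 := \sum_e incidence e x * z e.
Definition boundary2 (c : F -> 'F_2) (e : E) : 'F_2 := c (l e) + c (r e).

Lemma boundary1D z1 z2 x :
  boundary1 (fun e => z1 e + z2 e) x = boundary1 z1 x + boundary1 z2 x.
Proof. by rewrite /boundary1 -big_split; apply: eq_bigr => e _; rewrite mulrDr. Qed.

Lemma boundary1_sum (J : finType) (a : J -> 'F_2) (z : J -> E -> 'F_2) x :
  boundary1 (fun e => \sum_j a j * z j e) x = \sum_j a j * boundary1 (z j) x.
Proof.
rewrite /boundary1; under eq_bigr do rewrite mulr_sumr.
rewrite exchange_big; apply: eq_bigr => j _; rewrite mulr_sumr.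
by apply: eq_bigr => e _; rewrite mulrCA.
Qed.

Lemma boundary1_delta e0 x : boundary1 (fun e => (e == e0)%:R) x = incidence e0 x.
Proof.
rewrite /boundary1 (bigD1 e0) //= eqxx mulr1 big1 ?addr0 // => e /negbTE ->.
by rewrite mulr0.
Qed.

(** Connectedness is recorded homologically: the two points are together the
    boundary of a chain supported in [P].  Such chains add up without any care for
    repeated edges. *)
Definition linked (P : pred E) (x y : V) : Prop :=
  exists p : E -> 'F_2, (forall e, p e != 0 -> P e) /\
    forall z, boundary1 p z = (x == z)%:R + (y == z)%:R.

Lemma linked_refl P x : linked P x x.
Proof.
exists (fun=> 0); split=> [e|z]; first by rewrite eqxx.
by rewrite addF2 /boundary1 big1 // => e _; rewrite mulr0.
Qed.

Lemma linked_sym P x y : linked P x y -> linked P y x.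
Proof. by case=> p [Pp bp]; exists p; split=> // z; rewrite addrC. Qed.

Lemma linked_trans P y x z : linked P x y -> linked P y z -> linked P x z.
Proof.
move=> [p [Pp bp]] [q [Pq bq]]; exists (fun e => p e + q e); split=> [e|w].
  by have [->|/Pp //] := eqVneq (p e) 0; rewrite add0r; exact: Pq.
by rewrite boundary1D bp bq -addrA addKF2.
Qed.

Lemma linked_edge (P : pred E) e : P e -> linked P (s e) (t e).
Proof.
move=> Pe; exists (fun e' => (e' == e)%:R); split=> [e'|z].
  by case: (eqVneq e' e) => [->|]; rewrite ?eqxx.
exact: boundary1_delta.
Qed.

End Complex.

Section SimpleCycles.
Variables (J I : finType) (u v : J -> I).
Hypothesis loopless : forall j, u j != v j.
Hypothesis simple : forall j k,
  (u j = u k /\ v j = v k) \/ (u j = v k /\ v j = u k) -> j = k.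

(** In a graph without loops and multiple edges a nonzero cycle has at least three
    edges: an edge of the cycle is continued at both its ends, by two different
    edges. *)
Lemma simple_cycle_weight (p : J -> 'F_2) :
  (forall w, \sum_j incidence u v j w * p j = 0) -> (exists j, p j != 0) ->
  (3 <= #|[set j | p j != 0%R]|)%N.
Proof.
move=> cyc [j0 pj0].
have next w j : p j != 0 -> incidence u v j w != 0 ->
    exists k, [/\ k != j, p k != 0 & incidence u v k w != 0].
  move=> pj ij; apply: contrapT => no; have := cyc w.
  rewrite (bigD1 j) //= big1 ?addr0 => [/eqP|k kj].
    by rewrite mulf_eq0 (negbTE ij) (negbTE pj).
  have [->|pk] := eqVneq (p k) 0; first by rewrite mulr0.
  have [->|ik] := eqVneq (incidence u v k w) 0; first by rewrite mul0r.
  by case: no; exists k.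
have inc_end k w : incidence u v k w != 0 -> w = u k \/ w = v k.
  rewrite /incidence; case: (eqVneq (u k) w) => [->|_]; first by left.
  by case: (eqVneq (v k) w) => [->|_]; [right | rewrite addr0 eqxx].
have i0u : incidence u v j0 (u j0) != 0.
  by rewrite /incidence eqxx [v j0 == _]eq_sym (negbTE (loopless j0)) addr0 oner_eq0.
have i0v : incidence u v j0 (v j0) != 0.
  by rewrite /incidence eqxx (negbTE (loopless _)) add0r oner_eq0.
have [j1 [j10 pj1 /inc_end i1]] := next _ _ pj0 i0u.
have [j2 [j20 pj2 /inc_end i2]] := next _ _ pj0 i0v.
have j12 : j1 != j2.
  apply: contraNneq j10 => j12; rewrite -j12 in i2; apply/eqP/esym/simple.
  have := loopless j0.
  case: i1 => ->; case: i2 => ->; rewrite ?eqxx //; first by left.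
  by right.
apply: leq_trans (subset_leq_card (A := [set j0; j1; j2]) _).
  by rewrite -setUA cardsU1 cards2 !inE negb_or ![j0 == _]eq_sym j10 j20 j12.
by apply/subsetP => j; rewrite !inE => /orP[/orP[]|] /eqP ->.
Qed.

End SimpleCycles.

Section MinorBound.
Variables (V E F : finType) (s t : E -> V) (l r : E -> F) (q1 q2 : nat).
Variables (Q : 'I_q1 -> E -> 'F_2) (b : 'I_q2 -> E -> 'F_2).
Hypothesis boundary_boundary : forall c x, boundary1 s t (boundary2 l r c) x = 0.
Hypothesis homology : forall z, (forall x, boundary1 s t z x = 0) ->
  (forall i, \sum_e Q i e * z e = 0) ->
  exists c a, forall e, z e = boundary2 l r c e + \sum_i a i * b i e.
Variables (J I : finType) (u v : J -> I).
Hypothesis loopless : forall j, u j != v j.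
Hypothesis simple : forall j k,
  (u j = u k /\ v j = v k) \/ (u j = v k /\ v j = u k) -> j = k.
Variables (branch : V -> option I) (root : I -> V) (h : J -> E).
Hypothesis branch_connected : forall x w, branch x = Some w ->
  exists p : E -> 'F_2,
    (forall e, p e != 0 -> branch (s e) = Some w /\ branch (t e) = Some w) /\
    forall y, boundary1 s t p y = (x == y)%:R + (root w == y)%:R.
Hypothesis branch_edge : forall j,
  (branch (s (h j)) = Some (u j) /\ branch (t (h j)) = Some (v j)) \/
  (branch (s (h j)) = Some (v j) /\ branch (t (h j)) = Some (u j)).

Let internal e := (branch (s e) == branch (t e)) && (branch (s e) != None).
Let used e := internal e || (e \in codom h).

Let h_inj : injective h.
Proof.
move=> j k hjk; apply: simple.
have := branch_edge j; have := branch_edge k; rewrite hjk.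
case=> [] [-> ->] [] [[<-] [<-]]; by [left | right].
Qed.

Let h_external j : internal (h j) = false.
Proof.
rewrite /internal; case: (branch_edge j) => -[-> ->].
  by rewrite (inj_eq Some_inj) (negbTE (loopless j)).
by rewrite (inj_eq Some_inj) eq_sym (negbTE (loopless j)).
Qed.

Let walkP j : exists w : E -> 'F_2,
  [/\ forall e, w e != 0 -> used e, forall k, w (h k) = (k == j)%:R &
      forall y, boundary1 s t w y = (root (u j) == y)%:R + (root (v j) == y)%:R].
Proof.
suff [x [y [bx yx H]]] : exists x y, [/\ branch (s (h j)) = Some x,
    branch (t (h j)) = Some y & forall z,
    (root x == z)%:R + (root y == z)%:R = (root (u j) == z)%:R + (root (v j) == z)%:R :> 'F_2].
  have [p [ps pd]] := branch_connected bx.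
  have [p' [ps' pd']] := branch_connected yx.
  exists (fun e => (e == h j)%:R + (p e + p' e)).
  have nint e w : branch (s e) = Some w /\ branch (t e) = Some w -> internal e.
    by rewrite /internal => -[-> ->]; rewrite eqxx.
  split.
  - move=> e; rewrite /used; case: (eqVneq e (h j)) => [-> _|_].
      by rewrite codom_f orbT.
    rewrite add0r; have [->|/ps/nint -> //] := eqVneq (p e) 0.
    by rewrite add0r => /ps'/nint ->.
  - move=> k; have pz : p (h k) = 0.
      by apply/eqP; apply: contraT => /ps/nint; rewrite h_external.
    have pz' : p' (h k) = 0.
      by apply/eqP; apply: contraT => /ps'/nint; rewrite h_external.
    by rewrite pz pz' !addr0 (inj_eq h_inj).
  - move=> z; rewrite !boundary1D boundary1_delta pd pd' /incidence.
    by rewrite -H addrACA !addKF2.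
case: (branch_edge j) => -[sj tj].
  by exists (u j), (v j).
by exists (v j), (u j); split=> // z; rewrite addrC.
Qed.

Let face_adj (f f' : F) := [exists e, ~~ used e &&
  ((l e == f) && (r e == f') || (l e == f') && (r e == f))].
Let face_class := fingraph.root face_adj.

Let face_adj_connect_sym : connect_sym face_adj.
Proof.
by apply: sym_connect_sym => f f'; apply: eq_existsb => e; rewrite orbC.
Qed.

Let face_class_const (c : F -> 'F_2) f :
  (forall e, ~~ used e -> boundary2 l r c e = 0) -> c (face_class f) = c f.
Proof.
move=> cU; have /connectP[p] := connect_root face_adj f.
rewrite -/(face_class f) => pth ->; elim: p f pth => //= f' p IH f /andP[ff' /IH ->].
have [e /andP[/cU]] := existsP ff'; rewrite /boundary2 => /eqF2 ce.
by case/orP => /andP[/eqP <- /eqP <-].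
Qed.

Let boundary1_class (c : E -> 'F_2) w : (forall e, ~~ used e -> c e = 0) ->
  \sum_(x | branch x == Some w) boundary1 s t c x = \sum_j incidence u v j w * c (h j).
Proof.
move=> cU; rewrite /boundary1 exchange_big /=.
have S e (f : E -> V) : \sum_(x | branch x == Some w) (f e == x)%:R = (branch (f e) == Some w)%:R :> 'F_2.
  rewrite big_mkcond (bigD1 (f e)) //= eqxx big1 ?addr0; first by case: ifP.
  by move=> x /negbTE xf; rewrite [f e == x]eq_sym xf; case: ifP.
pose inc e : 'F_2 := (branch (s e) == Some w)%:R + (branch (t e) == Some w)%:R.
transitivity (\sum_e inc e * c e).
  apply: eq_bigr => e _; rewrite -mulr_suml; congr (_ * _).
  by rewrite /incidence big_split /= !S.
rewrite (bigID (mem (codom h))) /= [X in _ + X]big1 ?addr0; last first.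
  move=> e eh; have [ue|/cU ->] := boolP (used e); last by rewrite mulr0.
  move: ue; rewrite /used (negbTE eh) orbF /inc => /andP[/eqP -> _].
  by rewrite addF2 mul0r.
rewrite -big_uniq /=; last by rewrite map_inj_uniq ?enum_uniq.
rewrite big_map big_enum /=; apply: eq_bigr => j _; congr (_ * _).
rewrite /inc /incidence; case: (branch_edge j) => -[-> ->].
  by rewrite !(inj_eq Some_inj).
by rewrite !(inj_eq Some_inj) addrC.
Qed.

Let face_row f j : 'F_2 :=
  (face_class (l (h j)) == f)%:R + (face_class (r (h j)) == f)%:R.

Let face_row_cycle f w : \sum_j incidence u v j w * face_row f j = 0.
Proof.
pose c f' : 'F_2 := (face_class f' == f)%:R.
rewrite -(boundary1_class (c := boundary2 l r c)); first by rewrite big1.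
move=> e ue; rewrite /boundary2 /c (_ : face_class (l e) = face_class (r e)).
  exact: addF2.
apply/(fingraph.rootP face_adj_connect_sym); apply: connect1; apply/existsP; exists e.
by rewrite ue !eqxx.
Qed.

(** Cycles of the minor lift to cycles of the complex; those whose lift is a
    boundary form a space of codimension at most [#|I| + q1 + q2], contained in
    the span of the face rows.  A nonzero row has at least three nonzero entries,
    whereas each edge of the minor meets at most two face classes. *)
Theorem minor_edge_bound : (#|J| <= 3 * (#|I| + q1 + q2))%N.
Proof.
have [W WP] := choice walkP.
pose m := #|J|; pose jv (k : 'I_m) : J := enum_val k.
pose Dm : 'M['F_2]_(m, #|I|) := \matrix_(k, w) incidence u v (jv k) (enum_val w).
pose Qm : 'M['F_2]_(m, q1) := \matrix_(k, i) \sum_e Q i e * W (jv k) e.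
pose lift (z : 'rV['F_2]_m) e := \sum_k z 0 k * W (jv k) e.
move def_Kz : (kermx (row_mx Dm Qm)) => Kz.
have liftP i : exists ca : (F -> 'F_2) * ('I_q2 -> 'F_2), forall e,
    lift (row i Kz) e = boundary2 l r ca.1 e + \sum_k ca.2 k * b k e.
  have /sub_kermxP : (row i Kz <= kermx (row_mx Dm Qm))%MS by rewrite def_Kz row_sub.
  rewrite mul_mx_row -[RHS]row_mx0 => /eq_row_mx[zD zQ].
  have [||c [a ca]] := @homology (lift (row i Kz)); last by exists (c, a).
    move=> x; rewrite boundary1_sum.
    transitivity (\sum_w (row i Kz *m Dm) 0 (enum_rank w) * (root w == x)%:R).
      under [RHS]eq_bigr do rewrite mxE mulr_suml.
      rewrite exchange_big /=; apply: eq_bigr => k _.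
      have [_ _ ->] := WP (jv k); under [RHS]eq_bigr do rewrite [Dm _ _]mxE enum_rankK -mulrA.
      rewrite -mulr_sumr; congr (_ * _); rewrite /incidence.
      under eq_bigr do rewrite mulrDl.
      rewrite big_split /=; congr (_ + _).
        rewrite (bigD1 (u (jv k))) //= eqxx mul1r big1 ?addr0 // => w /negbTE wu.
        by rewrite eq_sym wu mul0r.
      rewrite (bigD1 (v (jv k))) //= eqxx mul1r big1 ?addr0 // => w /negbTE wu.
      by rewrite eq_sym wu mul0r.
    by rewrite big1 // => w _; rewrite zD mxE mul0r.
  move=> j; transitivity ((row i Kz *m Qm) 0 j); last by rewrite zQ mxE.
  rewrite mxE /lift; under eq_bigr do rewrite mulr_sumr.
  rewrite exchange_big /=; apply: eq_bigr => k _; rewrite [Qm _ _]mxE mulr_sumr.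
  by apply: eq_bigr => e _; rewrite mulrCA.
have [CA CAP] := choice liftP.
pose Am : 'M['F_2]_(m, q2) := \matrix_(i, k) (CA i).2 k.
pose Z := kermx Am *m Kz.
pose Psi : 'M['F_2]_(#|F|, m) := \matrix_(f, k) face_row (enum_val f) (jv k).
have ZPsi : (Z <= Psi)%MS.
  apply/row_subP => i; rewrite row_mul.
  have : row i (kermx Am) *m Am = 0 by apply/sub_kermxP; exact: row_sub.
  move: (row i (kermx Am)) => y yA; pose c f := \sum_k y 0 k * (CA k).1 f.
  have zc e : lift (y *m Kz) e = boundary2 l r c e.
    rewrite /lift; under eq_bigr do rewrite mxE mulr_suml.
    rewrite exchange_big /=.
    transitivity (\sum_k y 0 k * lift (row k Kz) e).
      apply: eq_bigr => k _; rewrite /lift mulr_sumr; apply: eq_bigr => k' _.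
      by rewrite [row k Kz _ _]mxE mulrA.
    under eq_bigr do rewrite CAP mulrDr.
    rewrite big_split /= [X in _ + X](_ : _ = 0) ?addr0.
      by rewrite /boundary2 /c -big_split; apply: eq_bigr => k _; rewrite mulrDr.
    under eq_bigr do rewrite mulr_sumr.
    rewrite exchange_big /= big1 // => k' _.
    transitivity ((y *m Am) 0 k' * b k' e); last by rewrite yA mxE mul0r.
    rewrite mxE mulr_suml; apply: eq_bigr => k _; by rewrite !mxE mulrA.
  have cU e : ~~ used e -> boundary2 l r c e = 0.
    move=> ue; rewrite -zc /lift big1 // => k _.
    have [We _ _] := WP (jv k); have [->|/We] := eqVneq (W (jv k) e) 0.
      by rewrite mulr0.
    by rewrite (negbTE ue).
  apply/submxP; exists (\row_f c (enum_val f)); apply/rowP => k.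
  transitivity (lift (y *m Kz) (h (jv k))).
    rewrite /lift (bigD1 k) //= big1 ?addr0.
      by have [_ -> _] := WP (jv k); rewrite eqxx mulr1.
    move=> k' k'k; have [_ -> _] := WP (jv k').
    by rewrite (inj_eq enum_val_inj) eq_sym (negbTE k'k) mulr0.
  rewrite zc [RHS]mxE.
  transitivity (\sum_f c f * face_row f (jv k)); last first.
    rewrite (reindex (enum_val : 'I_#|F| -> F)) /=; last first.
      by apply: onW_bij; exact: enum_val_bij.
    by apply: eq_bigr => f _; rewrite !mxE.
  have S f0 : \sum_f c f * (face_class f0 == f)%:R = c f0.
    rewrite (bigD1 (face_class f0)) //= eqxx mulr1 big1 ?addr0.
      exact: face_class_const.
    by move=> f /negbTE ff; rewrite eq_sym ff mulr0.
  rewrite /face_row; under eq_bigr do rewrite mulrDr.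
  by rewrite big_split /= !S.
set T := [set f | row f Psi != 0%R].
have rT : (m <= #|T| + (#|I| + q1 + q2))%N.
  have := leq_trans (mxrankS ZPsi) (mxrank_nonzero_rows Psi); rewrite -/T.
  have := mxrank_mul_min (kermx Am) Kz.
  rewrite -/Z -{1}def_Kz !mxrank_ker; have := rank_leq_col Am.
  have := rank_leq_col (row_mx Dm Qm); lia.
have T3 : (3 * #|T| <= \sum_(f in T) #|[set j | face_row (enum_val f) j != 0%R]|)%N.
  rewrite mulnC -sum_nat_const; apply: leq_sum => f; rewrite inE => /rV0Pn[k].
  rewrite !mxE => fk; apply: (simple_cycle_weight loopless simple).
    exact: face_row_cycle.
  by exists (jv k).
have T2 : (\sum_(f in T) #|[set j | face_row (enum_val f) j != 0%R]| <= 2 * m)%N.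
  apply: (@leq_trans (\sum_(f < #|F|) \sum_j (face_row (enum_val f) j != 0%R))).
    rewrite big_mkcond; apply: leq_sum => f _; case: ifP => // _.
    rewrite -sum1_card big_mkcond; apply: leq_sum => j _; rewrite inE.
    by case: (_ != _).
  rewrite exchange_big /= mulnC -sum_nat_const; apply: leq_sum => j _.
  apply: (@leq_trans (\sum_f ((face_class (l (h j)) == f) + (face_class (r (h j)) == f)))).
    rewrite [X in (_ <= X)%N](reindex (enum_val : 'I_#|F| -> F)) /=; last first.
      by apply: onW_bij; exact: enum_val_bij.
    apply: leq_sum => f _; rewrite /face_row.
    case: (face_class (l (h j)) =P _) => _; case: (face_class (r (h j)) =P _) => _;
      last by rewrite addF2 eqxx.
    1-3: by apply: (leq_trans (leq_b1 _)).
  have S f0 : (\sum_f (f0 == f))%N = 1%N.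
    by rewrite (bigD1 f0) //= eqxx big1 // => f /negbTE ff; rewrite eq_sym ff.
  by rewrite big_split /= !S.
rewrite -/m; lia.
Qed.

End MinorBound.
End CellComplexes.

(** * Gluing along the rims of holes *)

Section Gluing.
Import mathcomp.boot.fintype mathcomp.boot.finset.
Local Open Scope ring_scope.

Variables (V E F : finType) (s t : E -> V) (l r : E -> F) (q0 m : nat).
Variables (Q0 : 'I_q0 -> E -> 'F_2) (hole : F -> option 'I_m).
Variables (sV : V -> V) (sE : E -> E) (ring : V -> 'I_m) (base : 'I_m -> V).

(** A complex is glued along the rims of holes: [hole] marks the faces to be
    removed, a rim edge has a removed face on exactly one side, and the involutions
    [sE] and [sV] identify rim edges and rim vertices.  Of two identified cells the
    one of smaller rank is retained, and edges between two removed faces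
    disappear. *)
Definition rim e := (hole (l e) == None) != (hole (r e) == None).
Definition inner e := (hole (l e) != None) && (hole (r e) != None).
Definition rim_vertex x := [exists e, rim e && ((s e == x) || (t e == x))].
Definition outer_face e := if hole (l e) == None then l e else r e.
Definition inner_face e := if hole (l e) == None then r e else l e.
Definition avail : {pred E} :=
  [pred e | ~~ inner e && (rim e ==> (enum_rank e < enum_rank (sE e))%N)].
Definition kept x := (enum_rank x <= enum_rank (sV x))%N.
(** The retained representative of a vertex. *)
Definition kappa x := if kept x then x else sV x.

Definition glued_edge := {e : E | e \in avail}.
Definition glued_s (e : glued_edge) := kappa (s (val e)).
Definition glued_t (e : glued_edge) := kappa (t (val e)).
Definition glued_l (e : glued_edge) :=
  if rim (val e) then outer_face (val e) else l (val e).
Definition glued_r (e : glued_edge) :=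
  if rim (val e) then outer_face (sE (val e)) else r (val e).

Hypothesis boundary_boundary : forall c x, boundary1 s t (boundary2 l r c) x = 0.
Hypothesis homology : forall z, (forall x, boundary1 s t z x = 0) ->
  (forall i, \sum_e Q0 i e * z e = 0) -> exists c, forall e, z e = boundary2 l r c e.
Hypothesis Q0_rim : forall i e, rim e -> Q0 i e = 0.
Hypothesis sEK : forall e, rim e -> sE (sE e) = e.
Hypothesis sE_rim : forall e, rim e -> rim (sE e).
Hypothesis sE_neq : forall e, rim e -> sE e != e.
Hypothesis sVK : involutive sV.
Hypothesis sV_neq : forall x, rim_vertex x -> sV x != x.
Hypothesis sV_id : forall x, ~~ rim_vertex x -> sV x = x.
Hypothesis sV_ends : forall e, rim e ->
  (s (sE e) = sV (s e) /\ t (sE e) = sV (t e)) \/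
  (s (sE e) = sV (t e) /\ t (sE e) = sV (s e)).
Hypothesis rim_connected : forall x, rim_vertex x ->
  exists x' (p : E -> 'F_2), [/\ x' = x \/ x' = sV x, forall e, p e != 0 -> rim e &
    forall y, boundary1 s t p y = (x' == y)%:R + (base (ring x) == y)%:R].
Hypothesis hole_connected : forall c, (forall e, inner e -> boundary2 l r c e = 0) ->
  forall f f', hole f != None -> hole f = hole f' -> c f = c f'.

Let rimNinner e : rim e -> ~~ inner e.
Proof. by rewrite /rim /inner; case: (hole (l e)); case: (hole (r e)). Qed.

Let sV_inj : injective sV.
Proof. exact: inv_inj sVK. Qed.

Let incidence_sV e x : rim e -> incidence s t (sE e) x = incidence s t e (sV x).
Proof.
move=> re; rewrite /incidence.
have H a : (sV a == x) = (a == sV x) by rewrite -{1}[x]sVK (inj_eq sV_inj).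
by case: (sV_ends re) => -[-> ->]; rewrite !H // addrC.
Qed.

Let rank_sE e : rim e -> (enum_rank (sE e) < enum_rank e)%N = ~~ (enum_rank e < enum_rank (sE e))%N.
Proof.
move=> re; rewrite -leqNgt ltn_neqAle (_ : _ != _) //.
by rewrite (inj_eq val_inj) (inj_eq enum_rank_inj) sE_neq.
Qed.

(** Of the two copies of a glued edge exactly one is retained, and it accounts for
    both. *)
Lemma sum_glued_edge (w : E -> 'F_2) :
  \sum_(e : glued_edge) (if rim (val e) then w (val e) + w (sE (val e)) else w (val e)) =
  \sum_(e | ~~ inner e) w e.
Proof.
rewrite -(big_sub avail (fun e => if rim e then w e + w (sE e) else w e)).
rewrite (bigID rim) [RHS](bigID rim) /=; congr (_ + _); last first.
  apply: eq_big => [e|e /andP[_ /negbTE ->] //].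
  by rewrite inE /=; case: (rim e); rewrite ?andbF //= ?andbT.
transitivity (\sum_(e | rim e && (enum_rank e < enum_rank (sE e))%N) w e +
   \sum_(e | rim e && (enum_rank e < enum_rank (sE e))%N) w (sE e)).
  rewrite -big_split; apply: eq_big => [e|e /andP[_ ->] //].
  rewrite inE /=; case re : (rim e); rewrite ?andbF //= andbT.
  by rewrite (rimNinner re).
rewrite [RHS](bigID (fun e => enum_rank e < enum_rank (sE e))%N) /=; congr (_ + _).
  apply: eq_bigl => e; case re : (rim e); rewrite ?andbF //= andbT.
  by rewrite (rimNinner re).
rewrite [RHS](reindex_onto sE sE) /=; last by move=> e /andP[/andP[_ re] _]; exact: sEK.
apply: eq_bigl => e; case re : (rim e) => /=.
  rewrite (sEK re) eqxx (sE_rim re) (rimNinner (sE_rim re)) /= andbT.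
  by rewrite (rank_sE re) negbK.
apply/esym/negbTE; apply/negP => /andP[/andP[/andP[_ rs] _] /eqP see].
by have := sE_rim rs; rewrite see re.
Qed.

Let kappa_kept x y : (kappa x == y) = kept y && ((x == y) || (x == sV y)).
Proof.
rewrite /kappa; case: ifPn => [kx|kx].
  case: (eqVneq x y) => [<-|xy] /=; first by rewrite kx.
  apply/esym/negbTE/negP => /andP[ky /eqP xs]; move: kx ky xy.
  rewrite xs /kept sVK => le1 le2; rewrite -(inj_eq enum_rank_inj).
  by rewrite -val_eqE eqn_leq le1 le2.
have -> : (sV x == y) = (x == sV y) by rewrite -{1}[y]sVK (inj_eq sV_inj).
case: (eqVneq x (sV y)) => [xs|xs]; rewrite ?orbT ?orbF ?andbT.
  by move: kx; rewrite xs /kept sVK -ltnNge => /ltnW ->.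
by case: (eqVneq x y) => [xy|]; rewrite ?andbF // -xy (negbTE kx).
Qed.

Let fold_inc e x : 'F_2 :=
  if sV x == x then incidence s t e x else incidence s t e x + incidence s t e (sV x).

Let glued_incidence (e : glued_edge) x :
  incidence glued_s glued_t e x = (kept x)%:R * fold_inc (val e) x.
Proof.
rewrite /incidence /glued_s /glued_t !kappa_kept /fold_inc.
case: (kept x) => /=; last by rewrite mul0r addr0.
rewrite mul1r; case: (eqVneq (sV x) x) => [->|sx]; first by rewrite !orbb.
rewrite /incidence addrACA.
have H y : ((y == x) || (y == sV x))%:R = (y == x)%:R + (y == sV x)%:R :> 'F_2.
  case: (eqVneq y x) => [->|_]; last by rewrite add0r.
  by rewrite eq_sym (negbTE sx) addr0.
by rewrite !H.
Qed.

Let fold_inc_sE e x : rim e -> fold_inc (sE e) x = fold_inc e x.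
Proof.
move=> re; rewrite /fold_inc !incidence_sV // sVK.
by case: eqVneq => [->|_] //; rewrite addrC.
Qed.

Let rim_faces e : rim e -> hole (outer_face e) = None /\ hole (inner_face e) != None.
Proof.
rewrite /rim /outer_face /inner_face.
by case hl : (hole (l e)); case hr : (hole (r e)) => //= _; rewrite ?hl ?hr.
Qed.

Let rim_boundary c e : boundary2 l r c e = c (outer_face e) + c (inner_face e).
Proof. by rewrite /boundary2 /outer_face /inner_face; case: ifP => // _; rewrite addrC. Qed.

Let outside e : rim e = false -> ~~ inner e -> hole (l e) = None /\ hole (r e) = None.
Proof. by rewrite /rim /inner; case: (hole (l e)); case: (hole (r e)). Qed.

Let glued_edgeP (e : glued_edge) : ~~ inner (val e).
Proof. by have := valP e; rewrite inE => /andP[]. Qed.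

(** A chain of outer faces, extended by zero into the holes, has the same boundary
    in the original complex once the two copies of each rim edge are added. *)
Lemma glued_boundary_boundary c x :
  boundary1 glued_s glued_t (boundary2 glued_l glued_r c) x = 0.
Proof.
pose ch f := if hole f == None then c f else 0.
rewrite /boundary1; under eq_bigr do rewrite glued_incidence -mulrA.
rewrite -mulr_sumr; suff -> : \sum_(e : glued_edge)
    fold_inc (val e) x * boundary2 glued_l glued_r c e = 0 by rewrite mulr0.
transitivity (\sum_e fold_inc e x * boundary2 l r ch e).
  rewrite [RHS](bigID inner) /= [X in _ = X + _]big1 ?add0r.
    rewrite -sum_glued_edge; apply: eq_bigr => e _.
    rewrite /boundary2 /glued_l /glued_r; case re : (rim (val e)); last first.
      have [hl hr] := outside re (glued_edgeP e).
      by rewrite /ch hl hr.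
    rewrite (fold_inc_sE _ re) -mulrDr; congr (_ * _).
    rewrite -![ch (l _) + _]/(boundary2 l r ch _) !rim_boundary /ch.
    have [-> /negbTE ->] := rim_faces re.
    by have [-> /negbTE ->] := rim_faces (sE_rim re); rewrite !addr0.
  by move=> e /andP[/negbTE hl /negbTE hr]; rewrite /boundary2 /ch hl hr addr0 mulr0.
rewrite /fold_inc; case: eqP => _; first exact: boundary_boundary.
under eq_bigr do rewrite mulrDl.
rewrite big_split /= -[X in X + _]/(boundary1 _ _ _ _) -[X in _ + X]/(boundary1 _ _ _ _).
by rewrite !boundary_boundary addr0.
Qed.

Let kept_sV x : sV x != x -> kept (sV x) = ~~ kept x.
Proof.
move=> sx; rewrite /kept sVK -ltnNge ltn_neqAle andbC; case: leqP => //= _.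
by apply/esym; rewrite (inj_eq val_inj) (inj_eq enum_rank_inj).
Qed.

Let rim_vertex_sV x : rim_vertex (sV x) = rim_vertex x.
Proof.
have [rx|nr] := boolP (rim_vertex x); last by rewrite sV_id ?(negbTE nr).
apply: contraT => /sV_id; rewrite sVK => xx.
by have := sV_neq rx; rewrite -xx eqxx.
Qed.

Lemma kappa_sV x : kappa (sV x) = kappa x.
Proof.
have [rx|nr] := boolP (rim_vertex x); last by rewrite sV_id.
by rewrite /kappa kept_sV ?sV_neq // sVK; case: (kept x).
Qed.

Lemma glued_edge_ends e : ~~ inner e -> exists e' : glued_edge,
  (glued_s e' = kappa (s e) /\ glued_t e' = kappa (t e)) \/
  (glued_s e' = kappa (t e) /\ glued_t e' = kappa (s e)).
Proof.
move=> ne; have [eA|eA] := boolP (e \in avail); first by exists (exist _ e eA); left.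
have [re lt] : rim e /\ ~~ (enum_rank e < enum_rank (sE e))%N.
  by move: eA; rewrite inE ne /= negb_imply => /andP.
have sA : sE e \in avail.
  by rewrite inE (rimNinner (sE_rim re)) (sE_rim re) sEK //= rank_sE.
exists (exist _ (sE e) sA); rewrite /glued_s /glued_t /=.
by case: (sV_ends re) => -[-> ->]; rewrite !kappa_sV; [left | right].
Qed.

(** Reads off the total boundary left at the rim vertices of the [i]-th ring
    when a chain of the glued complex is lifted. *)
Definition ring_functional (i : 'I_m) (e : glued_edge) : 'F_2 :=
  \sum_(x | [&& rim_vertex x, kept x & ring x == i]) incidence s t (val e) x.

Definition rim_chain (i : 'I_m) (e : glued_edge) : 'F_2 :=
  if rim (val e) then (hole (inner_face (val e)) == Some i)%:R +
    (hole (inner_face (sE (val e))) == Some i)%:R else 0.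

Let extend (z : glued_edge -> 'F_2) e := if insub e is Some e' then z e' else 0.

Let extend_val z e : extend z (val e) = z e.
Proof. by rewrite /extend valK. Qed.

Let extend_navail z e : e \notin avail -> extend z e = 0.
Proof. by move=> eA; rewrite /extend insubN. Qed.

Let sum_extend z (w : E -> 'F_2) : \sum_e w e * extend z e = \sum_(e : glued_edge) w (val e) * z e.
Proof.
rewrite (bigID (mem avail)) /= [X in _ + X]big1 ?addr0; last first.
  by move=> e /extend_navail ->; rewrite mulr0.
rewrite (big_sub avail (fun e => w e * extend z e)).
by apply: eq_bigr => e _; rewrite extend_val.
Qed.

Let fold_boundary z x : boundary1 glued_s glued_t z x =
  (kept x)%:R * (if sV x == x then boundary1 s t (extend z) x
    else boundary1 s t (extend z) x + boundary1 s t (extend z) (sV x)).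
Proof.
rewrite /boundary1 !sum_extend; under eq_bigr do rewrite glued_incidence -mulrA.
rewrite -mulr_sumr; congr (_ * _); rewrite /fold_inc; case: ifP => // _.
by rewrite -big_split; apply: eq_bigr => e _; rewrite mulrDl.
Qed.

Let symmetrize (p : E -> 'F_2) e := if rim e then p e + p (sE e) else 0.

Let boundary1_symmetrize p y : (forall e, p e != 0 -> rim e) ->
  boundary1 s t (symmetrize p) y = boundary1 s t p y + boundary1 s t p (sV y).
Proof.
move=> pr; have p0 e : ~~ rim e -> p e = 0.
  by move=> nr; apply/eqP; apply: contraT => /pr; rewrite (negbTE nr).
have R z : boundary1 s t p z = \sum_(e | rim e) incidence s t e z * p e.
  rewrite /boundary1 (bigID rim) /= [X in _ + X]big1 ?addr0 // => e /p0 ->.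
  by rewrite mulr0.
rewrite !R /boundary1 (bigID rim) /= [X in _ + X]big1 ?addr0; last first.
  by move=> e /negbTE nr; rewrite /symmetrize nr mulr0.
under eq_bigr => e re do rewrite /symmetrize re mulrDr.
rewrite big_split /=; congr (_ + _).
rewrite (reindex_onto sE sE) /=; last by move=> e; exact: sEK.
apply: eq_big => [e|e].
  case re : (rim e); first by rewrite (sE_rim re) (sEK re) eqxx.
  apply/negbTE/negP => /andP[rs /eqP see].
  by have := sE_rim rs; rewrite see re.
move=> /andP[rs /eqP see]; rewrite see; have := sE_rim rs; rewrite see => re.
by rewrite incidence_sV.
Qed.

(** A cycle of the glued complex, lifted to the original one, has a boundary that is
    symmetric under [sV]; if it has total zero on each ring, it is cancelled by a
    symmetric chain of rim edges, and the original homology applies to the sum.  The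
    resulting chain of faces is constant on each hole, and its values there are the
    coefficients of the [rim_chain]. *)
Theorem glued_homology z : (forall x, boundary1 glued_s glued_t z x = 0) ->
  (forall i, \sum_(e : glued_edge) Q0 i (val e) * z e = 0) ->
  (forall i, \sum_e ring_functional i e * z e = 0) ->
  exists c (a : 'I_m -> 'F_2), forall e,
    z e = boundary2 glued_l glued_r c e + \sum_i a i * rim_chain i e.
Proof.
move=> zc zQ zR; pose w := boundary1 s t (extend z).
have w_id x : ~~ rim_vertex x -> w x = 0.
  move=> nr; have := zc x; rewrite fold_boundary sV_id // eqxx /kept sV_id // leqnn.
  by rewrite mul1r.
have w_sV x : w (sV x) = w x.
  have [rx|nr] := boolP (rim_vertex x); last by rewrite sV_id.
  wlog kx : x rx / kept x.
    move=> H; case kx : (kept x); first exact: H.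
    rewrite -{2}[x]sVK (H (sV x)) ?rim_vertex_sV ?kept_sV ?sV_neq ?kx //.
  have := zc x; rewrite fold_boundary kx mul1r (negbTE (sV_neq rx)) => /eqF2.
  by rewrite -/(w x) -/(w (sV x)).
have choose_chain x : exists p : E -> 'F_2, rim_vertex x ->
    (forall e, p e != 0 -> rim e) /\ forall y, boundary1 s t p y + boundary1 s t p (sV y) =
    ((x == y)%:R + (sV x == y)%:R) + ((base (ring x) == y)%:R + (base (ring x) == sV y)%:R).
  case: (boolP (rim_vertex x)) => [rx|_]; last by exists (fun=> 0).
  have [x' [p [xx' pr pb]]] := rim_connected rx.
  exists p => _; split=> // y; rewrite !pb addrACA; congr (_ + _).
  have H a b : (sV a == b) = (a == sV b) by rewrite -{1}[b]sVK (inj_eq sV_inj).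
  case: xx' => ->; first by rewrite H.
  by rewrite -H sVK addrC.
have [p pP] := choice choose_chain.
pose Y e := \sum_(x | rim_vertex x && kept x) w x * symmetrize (p x) e.
have Y_nrim e : rim e = false -> Y e = 0.
  by move=> nr; rewrite /Y big1 // => x _; rewrite /symmetrize nr mulr0.
have Y_sE e : rim e -> Y (sE e) = Y e.
  move=> re; apply: eq_bigr => x _; congr (_ * _).
  by rewrite /symmetrize re (sE_rim re) (sEK re) addrC.
have Yb y : boundary1 s t Y y = w y.
  have -> : boundary1 s t Y y =
      \sum_(x | rim_vertex x && kept x) w x * boundary1 s t (symmetrize (p x)) y.
    rewrite /boundary1; under eq_bigr do rewrite mulr_sumr.
    rewrite exchange_big; apply: eq_bigr => x _; rewrite mulr_sumr.
    by apply: eq_bigr => e _; rewrite mulrCA.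
  transitivity (\sum_(x | rim_vertex x && kept x)
      (w x * ((x == y)%:R + (sV x == y)%:R) +
       w x * ((base (ring x) == y)%:R + (base (ring x) == sV y)%:R))).
    apply: eq_bigr => x /andP[rx _]; have [pr pb] := pP x rx.
    by rewrite boundary1_symmetrize // pb mulrDr.
  rewrite big_split /= [X in _ + X](_ : _ = 0) ?addr0; last first.
    rewrite (partition_big ring xpredT) //= big1 // => i _.
    transitivity ((\sum_(x | [&& rim_vertex x, kept x & ring x == i]) w x) *
        ((base i == y)%:R + (base i == sV y)%:R)).
      rewrite mulr_suml; apply: eq_big => [x|x /andP[_ /eqP -> //]].
      by rewrite andbA.
    have := zR i; rewrite /ring_functional /w /boundary1.
    under [X in _ -> X * _ = _]eq_bigr do rewrite sum_extend.
    rewrite exchange_big /=; under eq_bigr do rewrite mulr_suml.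
    by move=> ->; rewrite mul0r.
  have [ry|nry] := boolP (rim_vertex y); last first.
    rewrite w_id // big1 // => x /andP[rx _].
    have -> : (x == y) = false by apply: contraNF nry => /eqP <-.
    have -> : (sV x == y) = false.
      by apply: contraNF nry => /eqP <-; rewrite rim_vertex_sV.
    by rewrite addr0 mulr0.
  under eq_bigr do rewrite mulrDr.
  pose y0 := if kept y then y else sV y.
  have ky0 : rim_vertex y0 && kept y0.
    rewrite /y0; case: ifPn => ky; first by rewrite ry ky.
    by rewrite rim_vertex_sV ry kept_sV ?sV_neq.
  have wy0 : w y0 = w y by rewrite /y0; case: ifP.
  rewrite (bigD1 y0) //= big1 ?addr0.
    rewrite -mulrDr wy0 /y0; case: ifPn => ky.
      by rewrite eqxx (negbTE (sV_neq ry)) addr0 mulr1.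
    by rewrite sVK eqxx (negbTE (sV_neq ry)) add0r mulr1.
  move=> x /andP[/andP[rx kx] xy0]; rewrite -mulrDr.
  have xy : x != y.
    by apply: contraNneq xy0 => xy; rewrite /y0 -xy kx.
  have sxy : sV x != y.
    apply: contraNneq xy0 => sxy; rewrite /y0 -sxy kept_sV ?sV_neq // kx /= sVK.
    by [].
  by rewrite (negbTE xy) (negbTE sxy) addr0 mulr0.
have [||c cP] := @homology (fun e => extend z e + Y e).
- by move=> x; rewrite boundary1D Yb addF2.
- move=> i; under eq_bigr do rewrite mulrDr.
  rewrite big_split /= sum_extend zQ add0r big1 // => e _.
  by case re : (rim e); [rewrite Q0_rim ?re // mul0r | rewrite Y_nrim // mulr0].
have inner0 e : inner e -> boundary2 l r c e = 0.
  move=> ie; rewrite -cP extend_navail ?inE ?ie // add0r Y_nrim //.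
  by apply: contraTF ie => /rimNinner.
pose a i := if [pick f | hole f == Some i] is Some f then c f else 0.
have aP f i : hole f = Some i -> c f = a i.
  move=> hf; rewrite /a; case: pickP => [f' /eqP hf'|/(_ f)]; last by rewrite hf eqxx.
  by apply: (hole_connected inner0); rewrite hf // hf'.
exists c, a => e; rewrite /boundary2 /glued_l /glued_r /rim_chain.
case re : (rim (val e)); last first.
  rewrite big1 ?addr0; last by move=> i _; rewrite mulr0.
  by rewrite -[RHS]/(boundary2 l r c (val e)) -cP extend_val Y_nrim ?addr0.
have S f : hole f != None -> \sum_i a i * (hole f == Some i)%:R = c f.
  case hf : (hole f) => [i|//] _; rewrite (bigD1 i) //= eqxx mulr1 big1 ?addr0.
    by rewrite (aP _ _ hf).
  by move=> j ji; rewrite (inj_eq Some_inj) eq_sym (negbTE ji) mulr0.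
under eq_bigr do rewrite mulrDr.
rewrite big_split /= !S ?(proj2 (rim_faces _)) ?sE_rim //.
rewrite addrACA -!rim_boundary -!cP Y_sE // extend_val.
have nav : sE (val e) \notin avail.
  have := valP e; rewrite !inE re (sE_rim re) (sEK re) /= => /andP[_ lt].
  by rewrite negb_and negbK -leqNgt (ltnW lt) orbT.
rewrite (_ : extend z (sE (val e)) = 0) ?add0r; last exact: extend_navail.
by rewrite -addrA addF2 addr0.
Qed.

End Gluing.

(** * The torus grid *)

Section Torus.
Import mathcomp.boot.fintype mathcomp.boot.finset.
Local Open Scope ring_scope.
Variable n : nat.

Definition grid : finType := ('I_n.+1 * 'I_n.+1)%type.
Definition grid_edge : finType := (bool * grid)%type.
(** [(false, v)] is the horizontal edge starting at [v], [(true, v)] the vertical one;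
   the cell [v] is the unit square whose lower left corner is [v]. *)
Definition grid_s (e : grid_edge) : grid := e.2.
Definition grid_t (e : grid_edge) : grid :=
  if e.1 then (e.2.1, ordS e.2.2) else (ordS e.2.1, e.2.2).
Definition grid_l (e : grid_edge) : grid := e.2.
Definition grid_r (e : grid_edge) : grid :=
  if e.1 then (ord_pred e.2.1, e.2.2) else (e.2.1, ord_pred e.2.2).

Let ordS_eq (i j : 'I_n.+1) : (ordS i == j) = (i == ord_pred j).
Proof. by apply/eqP/eqP => [<-|->]; rewrite ?ordSK ?ord_predK. Qed.

Lemma grid_boundary1 z (x : grid) : boundary1 grid_s grid_t z x =
  (z (false, x) + z (false, (ord_pred x.1, x.2))) +
  (z (true, x) + z (true, (x.1, ord_pred x.2))).
Proof.
have S (w : grid -> 'F_2) y : \sum_v (v == y)%:R * w v = w y.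
  rewrite (bigD1 y) //= eqxx mul1r big1 ?addr0 // => v /negbTE ->.
  by rewrite mul0r.
rewrite /boundary1 /incidence (eq_bigr (fun e : grid_edge =>
  (fun b v => ((v == x)%:R + (grid_t (b, v) == x)%:R) * z (b, v)) e.1 e.2)); last by case.
rewrite -(pair_bigA _ (fun b v => ((v == x)%:R + (grid_t (b, v) == x)%:R) * z (b, v))).
rewrite big_bool /= addrC; congr (_ + _).
  rewrite -(S (fun v => z (false, v))) -(S (fun v => z (false, v)) (ord_pred x.1, x.2)).
  rewrite -big_split; apply: eq_bigr => -[i j] _ /=; rewrite mulrDl; congr (_ + _ * _).
  by case: x => a b; rewrite /grid_t /= !xpair_eqE ordS_eq.
rewrite -(S (fun v => z (true, v))) -(S (fun v => z (true, v)) (x.1, ord_pred x.2)).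
rewrite -big_split; apply: eq_bigr => -[i j] _ /=; rewrite mulrDl; congr (_ + _ * _).
by case: x => a b; rewrite /grid_t /= !xpair_eqE ordS_eq.
Qed.

Lemma grid_boundary_boundary c x :
  boundary1 grid_s grid_t (boundary2 grid_l grid_r c) x = 0.
Proof.
rewrite grid_boundary1 /boundary2 /=; case: x => i j /=.
by rewrite [X in _ + X]addrACA addF2.
Qed.

(** Partial sums give a primitive; the total is the only obstruction to closing up. *)
Lemma cyclic_primitive (f : 'I_n.+1 -> 'F_2) : \sum_i f i = 0 ->
  exists g, g ord0 = 0 /\ forall i, g i + g (ord_pred i) = f i.
Proof.
move=> f0; pose g (i : 'I_n.+1) := \sum_(k < n.+1 | (k <= i)%N) f k.
have gS i : g i + g (ord_pred i) = f i.
  have [i0|ipos] := posnP i.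
    have -> : ord_pred i = ord_max by apply/val_inj; rewrite /= i0 add0n modn_small.
    rewrite /g [X in _ + X](eq_bigl xpredT) => [|k]; last by rewrite -ltnS ltn_ord.
    rewrite f0 addr0 (big_pred1 i) // => k /=.
    by rewrite i0 leqn0 -i0.
  have pv : val (ord_pred i) = i.-1.
    rewrite /= -subn1 -addnBAC // subn1 modnDr modn_small //.
    by apply: leq_ltn_trans (leq_pred _) _.
  rewrite /g (bigD1 i) //= -addrA (eq_bigl (fun k : 'I_n.+1 => k <= ord_pred i)%N); last first.
    by move=> k; rewrite pv -val_eqE /=; move: ipos; clear; lia.
  by rewrite addF2 addr0.
exists (fun i => g i + g ord0); rewrite addF2; split=> // i.
by rewrite addrACA addF2 addr0.
Qed.

Lemma sum_grid_edge (G : grid_edge -> 'F_2) : \sum_e G e =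
  \sum_i \sum_j G (true, (i, j)) + \sum_i \sum_j G (false, (i, j)).
Proof.
have S (w : grid -> 'F_2) : \sum_v w v = \sum_i \sum_j w (i, j).
  by rewrite (pair_bigA _ (fun i j => w (i, j))); apply: eq_bigr; case.
rewrite -!(S (fun v => G (_, v))).
rewrite -[RHS](big_bool _ (fun b => \sum_v G (b, v))).
by rewrite (pair_bigA _ (fun b v => G (b, v))); apply: eq_bigr; case.
Qed.

Definition grid_functional (i : 'I_2) (e : grid_edge) : 'F_2 :=
  if val i == 0%N then (~~ e.1 && (e.2.1 == ord0))%:R else (e.1 && (e.2.2 == ord0))%:R.

(** The total of a cycle over the horizontal edges leaving a column does not depend
    on the column.  If it vanishes, each column has a primitive, and these primitives
    are adjusted to one another along the bottom row, which has a primitive as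
    well. *)
Lemma grid_homology z : (forall x, boundary1 grid_s grid_t z x = 0) ->
  (forall i, \sum_e grid_functional i e * z e = 0) ->
  exists c, forall e, z e = boundary2 grid_l grid_r c e.
Proof.
move=> zc zQ.
have cyc i j : z (false, (i, j)) + z (false, (ord_pred i, j)) =
    z (true, (i, j)) + z (true, (i, ord_pred j)).
  by apply: eqF2; rewrite -[RHS](zc (i, j)) grid_boundary1.
have col0 : \sum_j z (false, (ord0, j)) = 0.
  rewrite -[RHS](zQ ord0) sum_grid_edge /grid_functional /=.
  rewrite [X in _ = X + _]big1; last by move=> i _; rewrite big1 // => j _; rewrite mul0r.
  rewrite add0r [RHS](eq_bigr (fun i => if i == ord0 then \sum_j z (false, (i, j)) else 0)).
    by rewrite -big_mkcond big_pred1_eq.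
  move=> i _; case: ifP => _; first by apply: eq_bigr => j _; rewrite mul1r.
  by rewrite big1 // => j _; rewrite mul0r.
have row0 : \sum_i z (true, (i, ord0)) = 0.
  rewrite -[RHS](zQ ord_max) sum_grid_edge /grid_functional /=.
  rewrite [X in _ = _ + X]big1; last by move=> i _; rewrite big1 // => j _; rewrite mul0r.
  rewrite addr0; apply: eq_bigr => i _.
  rewrite [RHS](eq_bigr (fun j => if j == ord0 then z (true, (i, j)) else 0)).
    by rewrite -big_mkcond big_pred1_eq.
  by move=> j _; case: ifP => _; rewrite ?mul1r ?mul0r.
have colP i : \sum_j z (false, (ord_pred i, j)) = \sum_j z (false, (i, j)).
  apply/eqF2; rewrite -big_split /=.
  under eq_bigr do rewrite addrC cyc.
  rewrite big_split /= [X in X + _](reindex_inj (can_inj (@ord_predK n.+1))) /=.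
  exact: addF2.
have col i : \sum_j z (false, (i, j)) = 0.
  case: i => i; elim: i => [|i IH] il; first by have -> : Ordinal il = ord0 by apply/val_inj.
  rewrite -colP -[RHS](IH (ltnW il)); apply: eq_bigr => j _.
  congr (z (_, (_, _))); apply/val_inj.
  by rewrite /= modnDr modn_small // ltnW.
have [alpha [_ aP]] := cyclic_primitive row0.
have [g gP] := choice (fun i => cyclic_primitive (col i)).
exists (fun v => alpha v.1 + g v.1 v.2) => -[[] [i j]]; rewrite /boundary2 /=; last first.
  by rewrite addrACA addF2 add0r (proj2 (gP i)).
case: j => j; elim: j => [|j IH] jl.
  have -> : Ordinal jl = ord0 by apply/val_inj.
  by rewrite (proj1 (gP i)) (proj1 (gP _)) !addr0 aP.
set k := Ordinal jl; have pk : ord_pred k = Ordinal (ltnW jl).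
  by apply/val_inj; rewrite /= modnDr modn_small // ltnW.
have H a : g a k = g a (ord_pred k) + z (false, (a, k)).
  by rewrite -(proj2 (gP a) k) addrC -addrA addF2 addr0.
rewrite !H [alpha i + _]addrA [alpha (ord_pred i) + _]addrA addrACA.
have := IH (ltnW jl); rewrite -pk => <-; rewrite cyc addrC -addrA.
by rewrite addF2 addr0.
Qed.

End Torus.

(** * Holes in the grid *)

Section Holes.
Import mathcomp.boot.fintype mathcomp.boot.finset.
Local Open Scope nat_scope.
Variables (n m N O : nat) (ctr : 'I_m -> nat) (tau : 'I_m -> 'I_m) (flip : bool).

(** Hole [a] is the square of side [2 * N] centred at [(ctr a, O)].  Positions are
    natural numbers, so [ctr a - N <= i] is written [ctr a <= i + N].  A rim edge or
    a rim vertex of hole [a] goes to hole [tau a] by the reflection exchanging the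
    two centres, combined with the reflection in the line of the centres when [flip]
    holds; on lower left corners of edges this shifts one coordinate by one. *)
Definition in_hole a i j := [&& ctr a <= i + N, i < ctr a + N, O <= j + N & j < O + N].
Definition on_rim a (b : bool) i j :=
  if b then [&& (i + N == ctr a) || (i == ctr a + N), O <= j + N & j < O + N]
  else [&& ctr a <= i + N, i < ctr a + N & (j + N == O) || (j == O + N)].
Definition on_frame a i j :=
  [&& ctr a <= i + N, i <= ctr a + N, O <= j + N, j <= O + N &
    [|| i + N == ctr a, i == ctr a + N, j + N == O | j == O + N]].

Definition mirror_x a i := ctr a + ctr (tau a) - i.
Definition mirror_y j := if flip then 2 * O - j else j.

Definition grid_hole (v : grid n) : option 'I_m := [pick a | in_hole a v.1 v.2].
Definition frame_of (v : grid n) : option 'I_m := [pick a | on_frame a v.1 v.2].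
Definition rim_of (e : grid_edge n) : option 'I_m := [pick a | on_rim a e.1 e.2.1 e.2.2].

Definition grid_sV (v : grid n) : grid n :=
  if frame_of v is Some a then (inord (mirror_x a v.1), inord (mirror_y v.2)) else v.
Definition grid_sE (e : grid_edge n) : grid_edge n :=
  if rim_of e is Some a then
    (e.1, (inord (mirror_x a e.2.1 - ~~ e.1), inord (mirror_y e.2.2 - (flip && e.1))))
  else e.
(** Both holes of a pair are assigned the smaller index, so that each pair of
    identified rims has a single base point. *)
Definition grid_ring (a0 : 'I_m) (v : grid n) : 'I_m :=
  if frame_of v is Some a then (if a <= tau a then a else tau a) else a0.
Definition hole_corner (a : 'I_m) : grid n := (inord (ctr a - N), inord (O - N)).

Hypothesis tauK : involutive tau.
Hypothesis tau_flip : forall a, flip || (tau a != a).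
Hypothesis N_gt0 : 0 < N.
Hypothesis N_lt_O : N < O.
Hypothesis O_lt_n : O + N < n.
Hypothesis N_lt_ctr : forall a, N < ctr a.
Hypothesis ctr_lt_n : forall a, ctr a + N < n.
Hypothesis ctr_sep : forall a b, a != b ->
  ctr a + 4 * N <= ctr b \/ ctr b + 4 * N <= ctr a.

Let pick_Some (P : pred 'I_m) a : P a -> (forall b, P b -> b = a) -> [pick a | P a] = Some a.
Proof. by move=> Pa U; case: pickP => [b /U -> //|/(_ a)]; rewrite Pa. Qed.

Let strip_uniq a b i j : ctr a <= i + N -> i <= ctr a + N ->
  ctr b <= j + N -> j <= ctr b + N -> i <= j.+1 -> j <= i.+1 -> a = b.
Proof.
move=> h1 h2 h3 h4 h5 h6; apply/eqP; apply: contraT => /ctr_sep.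
move: N_gt0; lia.
Qed.

Let grid_holeP v a : reflect (grid_hole v = Some a) (in_hole a v.1 v.2).
Proof.
apply: (iffP idP) => [h|]; last by rewrite /grid_hole; case: pickP => // b h [<-].
apply: pick_Some => // b; move: h; rewrite /in_hole => h h'.
by apply: (@strip_uniq b a v.1 v.1); lia.
Qed.

Lemma frame_ofP v a : reflect (frame_of v = Some a) (on_frame a v.1 v.2).
Proof.
apply: (iffP idP) => [h|]; last by rewrite /frame_of; case: pickP => // b h [<-].
apply: pick_Some => // b; move: h; rewrite /on_frame => h h'.
by apply: (@strip_uniq b a v.1 v.1); lia.
Qed.

Let rim_ofP e a : reflect (rim_of e = Some a) (on_rim a e.1 e.2.1 e.2.2).
Proof.
apply: (iffP idP) => [h|]; last by rewrite /rim_of; case: pickP => // b h [<-].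
apply: pick_Some => // b; move: h; rewrite /on_rim => h h'.
by apply: (@strip_uniq b a e.2.1 e.2.1); move: h h'; case: (e.1); lia.
Qed.

Let val_ord_pred (i : 'I_n.+1) : 0 < i -> ord_pred i = i.-1 :> nat.
Proof.
case: i => i /= il i0; rewrite /= (_ : (i + n.+1).-1 = i.-1 + n.+1); last lia.
by rewrite modnDr modn_small //; lia.
Qed.

Let val_ord_pred0 (i : 'I_n.+1) : i = 0 :> nat -> ord_pred i = n :> nat.
Proof. by case: i => i /= il ->; rewrite add0n /= modn_small. Qed.

Let val_ordS (i : 'I_n.+1) : i < n -> ordS i = i.+1 :> nat.
Proof. by case: i => i /= il i0; rewrite modn_small. Qed.

Local Arguments ord_pred : simpl never.
Local Arguments ordS : simpl never.

Let gs := @grid_s n.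
Let gt := @grid_t n.
Let gl := @grid_l n.
Let gr := @grid_r n.

Let not_in_hole (v : grid n) : (forall a, ~~ in_hole a v.1 v.2) -> grid_hole v = None.
Proof. by move=> H; rewrite /grid_hole; case: pickP => // a; rewrite (negbTE (H a)). Qed.

Let in_hole_bound a i j : in_hole a i j -> 0 < i < n /\ 0 < j < n.
Proof. by rewrite /in_hole; have := N_lt_ctr a; have := ctr_lt_n a; lia. Qed.

Let rim_of_rim e a : rim_of e = Some a -> rim gl gr grid_hole e.
Proof.
move/rim_ofP; case: e => b [i j] /=; rewrite /rim /gl /gr /grid_l /grid_r /= => h.
have Na := N_lt_ctr a; have an := ctr_lt_n a.
have other c i' j' : in_hole c i' j' -> i' <= i.+1 -> i <= i'.+1 ->
    ctr a <= i' + N -> i' <= ctr a + N -> c = a.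
  by move=> hc ? ? ? ?; apply: (@strip_uniq c a i' i'); move: hc; rewrite /in_hole; lia.
case: b h => /= h.
  have i0 : 0 < i by lia.
  have pi := val_ord_pred i0; have pi' : (i + n.+1).-1 %% n.+1 = i.-1 := pi.
  have [e1|e1] : i + N = ctr a \/ i = ctr a + N :> nat by lia.
    have -> : grid_hole (i, j) = Some a by apply/grid_holeP; rewrite /= /in_hole; lia.
    rewrite not_in_hole // => c /=; apply/negP => hc.
    have ca : c = a.
      by apply: (@strip_uniq c a (ord_pred i) i); move: hc; rewrite /in_hole; lia.
    by move: hc; rewrite ca /in_hole; lia.
  have -> : grid_hole (ord_pred i, j) = Some a by apply/grid_holeP; rewrite /= /in_hole; lia.
  rewrite not_in_hole // => c /=; apply/negP => hc.
  have ca : c = a by apply: (@strip_uniq c a i i); move: hc; rewrite /in_hole; lia.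
  by move: hc; rewrite ca /in_hole; lia.
have j0 : 0 < j by lia.
have pj := val_ord_pred j0; have pj' : (j + n.+1).-1 %% n.+1 = j.-1 := pj.
have [e1|e1] : j + N = O \/ j = O + N :> nat by lia.
  have -> : grid_hole (i, j) = Some a by apply/grid_holeP; rewrite /= /in_hole; lia.
  by rewrite not_in_hole // => c /=; apply/negP; rewrite /in_hole; lia.
have -> : grid_hole (i, ord_pred j) = Some a by apply/grid_holeP; rewrite /= /in_hole; lia.
by rewrite not_in_hole // => c /=; apply/negP; rewrite /in_hole; lia.
Qed.

Let rim_rim_of e : rim gl gr grid_hole e -> exists a, rim_of e = Some a.
Proof.
case: e => b [i j]; rewrite /rim /gl /gr /grid_l /grid_r /=.
case hl : (grid_hole (i, j)) => [a|].
  move/grid_holeP: hl => /= hl; have [/andP[i0 _] /andP[j0 _]] := in_hole_bound hl.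
  have pj := val_ord_pred j0; have pi := val_ord_pred i0.
  have pi' : (i + n.+1).-1 %% n.+1 = i.-1 := pi.
  have pj' : (j + n.+1).-1 %% n.+1 = j.-1 := pj.
  case hr : (grid_hole _) => // _; exists a; apply/rim_ofP => /=.
  have : ~~ in_hole a (if b then (ord_pred i, j) else (i, ord_pred j)).1
      (if b then (ord_pred i, j) else (i, ord_pred j)).2.
    by apply/negP => /grid_holeP; rewrite hr.
  by move: hl; case: b {hr} => /=; rewrite /in_hole; lia.
case hr : (grid_hole _) => [a|] // _; exists a; apply/rim_ofP => /=.
move/grid_holeP: hr => /= hr.
have nl : ~~ in_hole a i j by apply/negP => h; move: hl; rewrite (elimT (grid_holeP (i, j) a) h).
have := in_hole_bound hr; case: b hr => /= hr [/andP[h1 h2] /andP[h3 h4]].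
  have [i0|i0] := posnP i; first by have p0 := val_ord_pred0 i0; have p0' : (i + n.+1).-1 %% n.+1 = n := p0; lia.
  have pi := val_ord_pred i0; have pi' : (i + n.+1).-1 %% n.+1 = i.-1 := pi.
  by move: hr nl; rewrite /in_hole; lia.
have [j0|j0] := posnP j; first by have p0 := val_ord_pred0 j0; have p0' : (j + n.+1).-1 %% n.+1 = n := p0; lia.
have pj := val_ord_pred j0; have pj' : (j + n.+1).-1 %% n.+1 = j.-1 := pj.
by move: hr nl; rewrite /in_hole; lia.
Qed.

Let frame_mirror a i j : on_frame a i j ->
  on_frame (tau a) (mirror_x a i) (mirror_y j) /\ mirror_x a i <= n /\ mirror_y j <= n.
Proof.
have := N_lt_ctr (tau a); have := ctr_lt_n (tau a); have := N_lt_ctr a; have := ctr_lt_n a.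
rewrite /on_frame /mirror_x /mirror_y; case: flip; lia.
Qed.

Let rim_mirror a (b : bool) i j : on_rim a b i j ->
  on_rim (tau a) b (mirror_x a i - ~~ b) (mirror_y j - (flip && b)) /\
  mirror_x a i - ~~ b <= n /\ mirror_y j - (flip && b) <= n.
Proof.
have := N_lt_ctr (tau a); have := ctr_lt_n (tau a); have := N_lt_ctr a; have := ctr_lt_n a.
by rewrite /on_rim /mirror_x /mirror_y; case: b; case: flip => /=; lia.
Qed.

Lemma grid_sV_frame v a : frame_of v = Some a -> [/\ frame_of (grid_sV v) = Some (tau a),
  (grid_sV v).1 = mirror_x a v.1 :> nat & (grid_sV v).2 = mirror_y v.2 :> nat].
Proof.
move=> hv; have /frame_ofP/frame_mirror[hf [b1 b2]] := hv.
rewrite /grid_sV hv /= !inordK ?ltnS //; split=> //.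
by apply/frame_ofP; rewrite /= !inordK ?ltnS.
Qed.

Let sE_rim_of e a : rim_of e = Some a -> [/\ rim_of (grid_sE e) = Some (tau a),
  (grid_sE e).1 = e.1, (grid_sE e).2.1 = mirror_x a e.2.1 - ~~ e.1 :> nat &
  (grid_sE e).2.2 = mirror_y e.2.2 - (flip && e.1) :> nat].
Proof.
move=> he; have /rim_ofP/rim_mirror[hf [b1 b2]] := he.
rewrite /grid_sE he /= !inordK ?ltnS //; split=> //.
by apply/rim_ofP; rewrite /= !inordK ?ltnS.
Qed.

Lemma grid_sEK e : rim gl gr grid_hole e -> grid_sE (grid_sE e) = e.
Proof.
move=> /rim_rim_of[a ha]; have [hs s1 s2 s3] := sE_rim_of ha.
have [_ t1 t2 t3] := sE_rim_of hs; clear hs.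
have := N_lt_ctr (tau a); have := ctr_lt_n (tau a); have := N_lt_ctr a; have := ctr_lt_n a.
move/rim_ofP: ha; move: s1 s2 s3 t1 t2 t3; rewrite /on_rim.
case: (grid_sE (grid_sE e)) => b2 [i2 j2]; case: (grid_sE e) => b1 [i1 j1].
case: e => b [i j] /= -> e1 e2 -> e3 e4 h *; congr (_, (_, _)); apply: val_inj => /=.
  by rewrite e3 e1 /mirror_x tauK; case: b {e1 e2 e3 e4} h; lia.
by rewrite e4 e2 /mirror_y; case: b {e1 e2 e3 e4} h; case: flip; lia.
Qed.

Lemma grid_sE_rim e : rim gl gr grid_hole e -> rim gl gr grid_hole (grid_sE e).
Proof. by move=> /rim_rim_of[a /sE_rim_of[h _ _ _]]; exact: rim_of_rim h. Qed.

Lemma grid_sE_neq e : rim gl gr grid_hole e -> grid_sE e != e.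
Proof.
move=> /rim_rim_of[a ha]; apply/negP => /eqP ee; have [] := sE_rim_of ha.
rewrite ee ha => -[aa] _; move: ha => /rim_ofP; case: e ee => b [i j] ee /=.
have := tau_flip a; rewrite -aa eqxx orbF => fl.
by rewrite /on_rim /mirror_x /mirror_y fl -aa /=; case: b {ee} => /=; lia.
Qed.

Let rim_vertexE v : rim_vertex gs gt gl gr grid_hole v = (frame_of v != None).
Proof.
apply/existsP/idP => [[e /andP[/rim_rim_of[a /rim_ofP he]]]|].
  suff h : (gs e == v) || (gt e == v) -> on_frame a v.1 v.2.
    by move/h/frame_ofP => ->.
  have Na := N_lt_ctr a; have an := ctr_lt_n a.
  move: he; case: e => b [i j] /= he; rewrite /gs /gt /grid_s /grid_t /=.
  case/orP => /eqP <- /=.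
    by move: he; rewrite /on_rim /on_frame; case: b => /=; lia.
  by move: he; rewrite /on_rim /on_frame; case: b => /= he; rewrite modn_small; lia.
case hv : (frame_of v) => [a|//] _; move/frame_ofP: hv.
have Na := N_lt_ctr a; have an := ctr_lt_n a.
case: v => i j /=; rewrite /on_frame => h.
suff [e [he ev]] : exists e : grid_edge n, on_rim a e.1 e.2.1 e.2.2 /\ ((gs e == (i, j)) || (gt e == (i, j))).
  by exists e; rewrite ev andbT; apply: (@rim_of_rim e a); apply/rim_ofP.
have [c1|c1] := boolP (((j + N == O) || (nat_of_ord j == O + N)) && (i < ctr a + N)).
  by exists (false, (i, j)); rewrite /= /gs /grid_s eqxx; split=> //; lia.
have [c2|c2] := boolP ((j + N == O) || (nat_of_ord j == O + N)).
  have i0 : 0 < i by lia.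
  exists (false, (ord_pred i, j)); rewrite /= /gt /grid_t /= ord_predK eqxx orbT.
  have pi := val_ord_pred i0; have pi' : (i + n.+1).-1 %% n.+1 = i.-1 := pi.
  by split=> //; lia.
by exists (true, (i, j)); rewrite /= /gs /grid_s eqxx; split=> //; lia.
Qed.

Lemma grid_sVK : involutive grid_sV.
Proof.
move=> v; case hv : (frame_of v) => [a|]; last by rewrite /grid_sV hv hv.
have [hs s1 s2] := grid_sV_frame hv; have [_ t1 t2] := grid_sV_frame hs; clear hs.
have := N_lt_ctr (tau a); have := ctr_lt_n (tau a); have := N_lt_ctr a; have := ctr_lt_n a.
move/frame_ofP: hv; move: s1 s2 t1 t2; rewrite /on_frame.
case: (grid_sV (grid_sV v)) => i2 j2; case: (grid_sV v) => i1 j1.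
case: v => i j /= e1 e2 e3 e4 h *; congr (_, _); apply: val_inj => /=.
  by rewrite e3 e1 /mirror_x tauK; lia.
by rewrite e4 e2 /mirror_y; case: flip; lia.
Qed.

Lemma grid_sV_neq v : rim_vertex gs gt gl gr grid_hole v -> grid_sV v != v.
Proof.
rewrite rim_vertexE; case ha : (frame_of v) => [a|//] _.
apply/negP => /eqP ee; have [] := grid_sV_frame ha.
rewrite ee ha => -[aa]; move: ha => /frame_ofP; case: v ee => i j ee /=.
have := tau_flip a; rewrite -aa eqxx orbF => fl.
by rewrite /on_frame /mirror_x /mirror_y fl -aa /=; lia.
Qed.

Lemma grid_sV_id v : ~~ rim_vertex gs gt gl gr grid_hole v -> grid_sV v = v.
Proof. by rewrite rim_vertexE negbK /grid_sV => /eqP ->. Qed.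

Lemma grid_sV_ends e : rim gl gr grid_hole e ->
  (gs (grid_sE e) = grid_sV (gs e) /\ gt (grid_sE e) = grid_sV (gt e)) \/
  (gs (grid_sE e) = grid_sV (gt e) /\ gt (grid_sE e) = grid_sV (gs e)).
Proof.
move=> /rim_rim_of[a ha].
have [hs s1 s2 s3] := sE_rim_of ha.
have Na := N_lt_ctr a; have an := ctr_lt_n a.
have Nta := N_lt_ctr (tau a); have tan := ctr_lt_n (tau a).
have he := ha; move/rim_ofP in he.
have fs : frame_of (gs e) = Some a.
  apply/frame_ofP; move: he; case: (e) => b [i j]; rewrite /gs /grid_s /=.
  by rewrite /on_rim /on_frame; case: b => /=; lia.
have ft : frame_of (gt e) = Some a.
  apply/frame_ofP; move: he; case: (e) => b [i j]; rewrite /gt /grid_t /=.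
  by rewrite /on_rim /on_frame; case: b => /= h; rewrite modn_small; lia.
have [_ p1 p2] := grid_sV_frame fs; have [_ p3 p4] := grid_sV_frame ft.
have eqg (u v : grid n) : u.1 = v.1 :> nat -> u.2 = v.2 :> nat -> u = v.
  by case: u v => ? ? [? ?] /= h1 h2; congr (_, _); exact: val_inj.
move: s1 s2 s3 p1 p2 p3 p4 he.
move: (grid_sV (gs e)) (grid_sV (gt e)) (grid_sE e).
case: e {ha hs fs ft} => b [i j] u v [b' [i' j']] /=; rewrite /gs /gt /grid_s /grid_t /=.
move=> ->; rewrite /on_rim /mirror_x /mirror_y => e1 e2.
case: b e1 e2 => /= e1 e2 p1 p2 p3 p4 h.
  have ej : j < n by lia.
  have jf : ordS j = j.+1 :> nat by exact: val_ordS.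
  have jf' : j.+1 %% n.+1 = j.+1 := jf.
  have ej' : j' < n by rewrite e2; case: flip {e2 p2 p4}; lia.
  have jg : ordS j' = j'.+1 :> nat by exact: val_ordS.
  have jg' : j'.+1 %% n.+1 = j'.+1 := jg.
  by case: flip e2 p2 p4 => /= e2 p2 p4; [right | left]; split; apply: eqg => /=; lia.
have ei : i < n by lia.
have jf : ordS i = i.+1 :> nat by exact: val_ordS.
have jf' : i.+1 %% n.+1 = i.+1 := jf.
have ei' : i' < n by rewrite e1; lia.
have jg : ordS i' = i'.+1 :> nat by exact: val_ordS.
have jg' : i'.+1 %% n.+1 = i'.+1 := jg.
by case: flip e2 p2 p4 => /= e2 p2 p4; right; split; apply: eqg => /=; lia.
Qed.

Let pt i j : grid n := (inord i, inord j).

Let pt_val i j : i <= n -> j <= n -> (pt i j).1 = i :> nat /\ (pt i j).2 = j :> nat.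
Proof. by move=> hi hj; rewrite /= !inordK. Qed.

Let ptE (v : grid n) : v = pt v.1 v.2.
Proof. by case: v => i j; rewrite /pt /= !inord_val. Qed.

Let ordS_inord i : i < n -> ordS (inord i : 'I_n.+1) = inord i.+1.
Proof. by move=> hi; have hi' := ltnW hi; apply: ord_inj; rewrite val_ordS !inordK. Qed.

Let link_rim_h a i j : i < n -> j <= n -> on_rim a false i j ->
  linked gs gt (rim gl gr grid_hole) (pt i j) (pt i.+1 j).
Proof.
move=> hi hj h; have [v1 v2] := pt_val (ltnW hi) hj.
have -> : pt i.+1 j = gt (false, pt i j) by rewrite /gt /grid_t /= ordS_inord.
apply: (@linked_edge _ _ gs gt _ (false, pt i j)); apply: (@rim_of_rim _ a).
by apply/rim_ofP; move: v1 v2 => /= -> ->.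
Qed.

Let link_rim_v a i j : i <= n -> j < n -> on_rim a true i j ->
  linked gs gt (rim gl gr grid_hole) (pt i j) (pt i j.+1).
Proof.
move=> hi hj h; have [v1 v2] := pt_val hi (ltnW hj).
have -> : pt i j.+1 = gt (true, pt i j) by rewrite /gt /grid_t /= ordS_inord.
apply: (@linked_edge _ _ gs gt _ (true, pt i j)); apply: (@rim_of_rim _ a).
by apply/rim_ofP; move: v1 v2 => /= -> ->.
Qed.

Let frame_linked v a : frame_of v = Some a ->
  linked gs gt (rim gl gr grid_hole) v (hole_corner a).
Proof.
move/frame_ofP; rewrite (ptE v); have Na := N_lt_ctr a; have an := ctr_lt_n a.
move: (nat_of_ord v.1) (nat_of_ord v.2) (ltn_ord v.1) (ltn_ord v.2) => i j hi hj.
have [-> ->] := @pt_val i j hi hj.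
set lk := linked gs gt _; have row j' k : (j' + N == O) || (j' == O + N) -> k <= 2 * N ->
    lk (pt (ctr a - N + k) j') (pt (ctr a - N) j').
  move=> hj'; elim: k => [|k IH] hk; first by rewrite addn0; exact: linked_refl.
  apply: linked_trans (IH (ltnW hk)); apply: linked_sym; rewrite addnS.
  by apply: (link_rim_h (a := a)); rewrite /on_rim; lia.
have column i' k : (i' + N == ctr a) || (i' == ctr a + N) -> k <= 2 * N ->
    lk (pt i' (O - N + k)) (pt i' (O - N)).
  move=> hi'; elim: k => [|k IH] hk; first by rewrite addn0; exact: linked_refl.
  apply: linked_trans (IH (ltnW hk)); apply: linked_sym; rewrite addnS.
  by apply: (link_rim_v (a := a)); rewrite /on_rim; lia.
rewrite /on_frame => h; have [c1|c1] := boolP ((j + N == O) || (j == O + N)).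
  have -> : i = ctr a - N + (i + N - ctr a) by lia.
  apply: linked_trans (row j _ c1 _) _; first by lia.
  have -> : j = O - N + (j + N - O) by lia.
  by apply: column; lia.
have -> : j = O - N + (j + N - O) by lia.
apply: linked_trans (column i _ _ _) _; [by lia | by lia | ].
have -> : i = ctr a - N + (i + N - ctr a) by lia.
by apply: row; lia.
Qed.

(** A frame is traversed along its sides down to its lower left corner. *)
Lemma grid_rim_connected a0 x : rim_vertex gs gt gl gr grid_hole x ->
  exists x' (p : grid_edge n -> 'F_2), [/\ x' = x \/ x' = grid_sV x,
    forall e, p e != 0%R -> rim gl gr grid_hole e &
    forall y, boundary1 gs gt p y =
      ((x' == y)%:R + (hole_corner (grid_ring a0 x) == y)%:R)%R].
Proof.
rewrite rim_vertexE; case hx : (frame_of x) => [a|//] _; rewrite /grid_ring hx.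
case: ifP => _.
  by have [p [p1 p2]] := frame_linked hx; exists x, p; split=> //; left.
have [hs _ _] := grid_sV_frame hx; have [p [p1 p2]] := frame_linked hs.
by exists (grid_sV x), p; split=> //; right.
Qed.

(** Neighbouring cells of a hole are separated by an inner edge, where the boundary
    vanishes: walk along a row and then down the first column. *)
Lemma grid_hole_connected (c : grid n -> 'F_2) :
  (forall e, inner gl gr grid_hole e -> boundary2 gl gr c e = 0%R) ->
  forall f f', grid_hole f != None -> grid_hole f = grid_hole f' -> c f = c f'.
Proof.
move=> c0 f f'; case hf : (grid_hole f) => [a|//] _ /esym hf'.
have Na := N_lt_ctr a; have an := ctr_lt_n a.
suff H i j : i <= n -> j <= n -> in_hole a i j ->
    c (pt i j) = c (pt (ctr a - N) (O - N)).
  have Hg g : grid_hole g = Some a -> c g = c (pt (ctr a - N) (O - N)).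
    move/grid_holeP => h; rewrite {1}(ptE g).
    by rewrite H // -ltnS.
  by rewrite (Hg _ hf) (Hg _ hf').
move=> hi hj {f f' hf hf'}.
have inP i' j' : i' <= n -> j' <= n -> in_hole a i' j' -> grid_hole (pt i' j') != None.
  move=> hi' hj' h; have [v1 v2] := pt_val hi' hj'.
  by rewrite (_ : grid_hole _ = Some a) //; apply/grid_holeP; rewrite v1 v2.
have pred_inord k : k < n -> ord_pred (inord k.+1 : 'I_n.+1) = inord k.
  move=> hk; have h1 : (inord k.+1 : 'I_n.+1) = k.+1 :> nat by rewrite inordK.
  by apply: ord_inj; rewrite val_ord_pred h1 // inordK // ltnS ltnW.
have row k : k < 2 * N -> in_hole a (ctr a - N + k) j ->
    c (pt (ctr a - N + k) j) = c (pt (ctr a - N) j).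
  elim: k => [|k IH] hk h; first by rewrite addn0.
  rewrite -IH; [|by lia|by move: h; rewrite /in_hole; lia].
  apply: eqF2; rewrite addnS; have h' : ctr a - N + k < n by lia.
  have := c0 (true, pt (ctr a - N + k).+1 j); rewrite /boundary2 /gl /gr /grid_l /grid_r /=.
  rewrite pred_inord //; apply; rewrite /inner /gl /gr /grid_l /grid_r /= pred_inord //.
  apply/andP; split; apply: inP => //; move: h; rewrite /in_hole; lia.
have column k : k < 2 * N -> c (pt (ctr a - N) (O - N + k)) = c (pt (ctr a - N) (O - N)).
  elim: k => [|k IH] hk; first by rewrite addn0.
  rewrite -IH; last by lia.
  apply: eqF2; rewrite addnS; have h' : O - N + k < n by lia.
  have := c0 (false, pt (ctr a - N) (O - N + k).+1); rewrite /boundary2 /gl /gr /grid_l /grid_r /=.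
  rewrite pred_inord //; apply; rewrite /inner /gl /gr /grid_l /grid_r /= pred_inord //.
  by apply/andP; split; apply: inP => //; rewrite ?/in_hole; lia.
move=> h; have ei : i = ctr a - N + (i + N - ctr a) by move: h; rewrite /in_hole; lia.
have ej : j = O - N + (j + N - O) by move: h; rewrite /in_hole; lia.
rewrite {1}ei row; [|by move: h; rewrite /in_hole; lia|by rewrite -ei].
by rewrite ej column //; move: h; rewrite /in_hole; lia.
Qed.

Lemma grid_functional_rim i e : rim gl gr grid_hole e -> grid_functional i e = 0%R.
Proof.
move=> /rim_rim_of[a /rim_ofP]; case: e => b [x y] /=; rewrite /grid_functional /=.
have Na := N_lt_ctr a; have NO := N_lt_O.
rewrite -!val_eqE /= /on_rim => h.
case: ifP => _; case: b h => h //=.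
  by have -> : (x == 0 :> nat) = false by lia.
by have -> : (y == 0 :> nat) = false by lia.
Qed.

End Holes.

(** * Hulls as branch sets *)

Section Hulls.
Import mathcomp.boot.fintype mathcomp.boot.finset.
Local Open Scope ring_scope.
Variables (V E : finType) (s t : E -> V).

Definition adjacent x y := [exists e, ((s e == x) && (t e == y)) || ((s e == y) && (t e == x))].
Definition adjacent_in (A : {set V}) : rel V := fun x y => [&& x \in A, y \in A & adjacent x y].
Definition connected_set (A : {set V}) := {in A &, forall x y, connect (adjacent_in A) x y}.

Lemma adjacentC x y : adjacent x y = adjacent y x.
Proof. by apply: eq_existsb => e; rewrite orbC. Qed.

Lemma adjacent_in_sym A : connect_sym (adjacent_in A).
Proof. by apply: sym_connect_sym => x y; rewrite /adjacent_in andbCA adjacentC. Qed.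

Lemma connect_linked (P : pred E) (r : rel V) x y :
  (forall a b, r a b -> exists2 e, P e & (s e = a /\ t e = b) \/ (s e = b /\ t e = a)) ->
  connect r x y -> linked s t P x y.
Proof.
move=> rP /connectP[p]; elim: p x => [|a p IH] x /=; first by move=> _ ->; exact: linked_refl.
move=> /andP[/rP[e Pe ends] /IH{}IH] /IH; apply: linked_trans.
by case: ends => -[<- <-]; [|apply: linked_sym]; exact: linked_edge.
Qed.

(** The last step before the first entrance into [P] of a path leading there. *)
Lemma connect_exit (A P : {set V}) b a : b \in A -> connect (adjacent_in A) b a ->
  b \notin P -> a \in P -> exists x y, [/\ connect (adjacent_in (A :\: P)) b x,
    x \in A :\: P, y \in A :&: P & adjacent x y].
Proof.
move=> bA /connectP[p]; elim: p b bA => [|c p IH] b bA /=.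
  by move=> _ -> /negbTE ->.
move=> /andP[/and3P[_ cA bc] pth] last bP aP.
have bAP : b \in A :\: P by rewrite inE bP bA.
have [cP|cP] := boolP (c \in P).
  by exists b, c; split; rewrite ?connect0 // inE cA.
have [x [y [cx xA yA xy]]] := IH c cA pth last cP aP.
exists x, y; split=> //; apply: connect_trans cx; apply: connect1.
by rewrite /adjacent_in bAP bc inE cP cA.
Qed.

Variables (J I : finType) (u v : J -> I) (X : I -> {set V}) (Y : J -> {set V}).
Hypothesis loopless : forall j, u j != v j.
Hypothesis X_conn : forall w, connected_set (X w).
Hypothesis X_neq0 : forall w, X w != set0.
Hypothesis Y_conn : forall j, connected_set (Y j).
Hypothesis XX : forall w w', w != w' -> X w :&: X w' = set0.
Hypothesis YY : forall j j', j != j' -> Y j :&: Y j' = set0.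
Hypothesis XY : forall j w, w != u j -> w != v j -> Y j :&: X w = set0.
Hypothesis Yu : forall j, Y j :&: X (u j) != set0.
Hypothesis Yv : forall j, Y j :&: X (v j) != set0.

Let disj (A B : {set V}) x : A :&: B = set0 -> x \in A -> x \in B -> false.
Proof. by move/setP/(_ x); rewrite !inE => h xA xB; rewrite xA xB in h. Qed.

Let K j := [set x in Y j :\: X (u j) |
  [exists b in Y j :&: X (v j), connect (adjacent_in (Y j :\: X (u j))) b x]].

(** The part of [Y j] that is reached from [X (v j)] without meeting [X (u j)] is
    added to the branch set of [v j]; a step leaving it into [X (u j)] is the edge
    of the minor. *)
Lemma hull_minor : exists (branch : V -> option I) (root : I -> V) (h : J -> E),
  [/\ forall x w, branch x = Some w ->
        linked s t (fun e => (branch (s e) == Some w) && (branch (t e) == Some w)) x (root w)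
    & forall j,
      (branch (s (h j)) = Some (u j) /\ branch (t (h j)) = Some (v j)) \/
      (branch (s (h j)) = Some (v j) /\ branch (t (h j)) = Some (u j))].
Proof.
have [root rootX] := choice (fun w => set0Pn _ (X_neq0 w)).
pose branch x := if [pick w | x \in X w] is Some w then Some w
  else if [pick j | x \in K j] is Some j then Some (v j) else None.
have bX x w : x \in X w -> branch x = Some w.
  move=> xw; rewrite /branch; case: pickP => [w' xw'|/(_ w)]; last by rewrite xw.
  by congr Some; apply/eqP; apply: contraT => /XX/disj/(_ xw')/(_ xw).
have bK x j : x \in K j -> branch x = Some (v j).
  move=> xK; have := xK; rewrite inE => /andP[]; rewrite inE => /andP[xu xY _].
  rewrite /branch; case: pickP => [w xw|_].
    congr Some; apply/eqP; apply: contraT => wv.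
    have [wu|wu] := eqVneq w (u j); first by rewrite -wu xw in xu.
    by have := disj (XY wu wv) xY xw.
  case: pickP => [j' |/(_ j)]; last by rewrite xK.
  rewrite inE => /andP[]; rewrite inE => /andP[_ xY'] _.
  by congr (Some (v _)); apply/eqP; apply: contraT => /YY/disj/(_ xY')/(_ xY).
exists branch, root.
have conn x w : branch x = Some w ->
    linked s t (fun e => (branch (s e) == Some w) && (branch (t e) == Some w)) x (root w).
  have XL y : y \in X w ->
      linked s t (fun e => (branch (s e) == Some w) && (branch (t e) == Some w)) y (root w).
    move=> yX; apply: connect_linked (X_conn yX (rootX w)) => a b.
    move=> /and3P[aX bX' /existsP[e he]]; exists e.
      by case/orP: he => /andP[/eqP -> /eqP ->]; rewrite (bX _ _ aX) (bX _ _ bX') eqxx.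
    by case/orP: he => /andP[/eqP -> /eqP ->]; [left|right].
  rewrite {1}/branch; case: pickP => [w' xw [ww]|_]; first by subst w'; exact: XL.
  case: pickP => // j xK [vw]; have := xK; rewrite inE => /andP[_ /existsP[b /andP[]]].
  rewrite inE vw => /andP[bY bXw] cb; apply: linked_trans (XL b bXw).
  apply: linked_sym; move/connectP: cb => [p]; elim/last_ind: p x xK => [|p y IH] x xK.
    by move=> _ ->; exact: linked_refl.
  rewrite rcons_path last_rcons => /andP[pth /and3P[lA yA /existsP[e he]]] xy; subst x.
  have lK : last b p \in K j.
    rewrite inE lA; apply/existsP; exists b; rewrite inE bY vw bXw /=.
    by apply/connectP; exists p.
  apply: linked_trans (IH _ lK pth erefl) _.
  have Pe : (branch (s e) == Some w) && (branch (t e) == Some w).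
    by case/orP: he => /andP[/eqP -> /eqP ->]; rewrite (bK _ _ lK) (bK _ _ xK) vw eqxx.
  by case/orP: he => /andP[/eqP <- /eqP <-]; [|apply: linked_sym];
    exact: (@linked_edge _ _ s t
      (fun e => (branch (s e) == Some w) && (branch (t e) == Some w)) e Pe).
suff edge j : exists e,
    (branch (s e) = Some (u j) /\ branch (t e) = Some (v j)) \/
    (branch (s e) = Some (v j) /\ branch (t e) = Some (u j)).
  by have [h hP] := choice edge; exists h.
have /set0Pn[a] := Yu j; rewrite inE => /andP[aY au].
have /set0Pn[b] := Yv j; rewrite inE => /andP[bY bv].
have bu : b \notin X (u j).
  by apply/negP => bu; have := disj (XX (loopless j)) bu bv.
have [x [y [bx xA]]] := connect_exit bY (Y_conn bY aY) bu au.
rewrite inE => /andP[yY yu] /existsP[e he]; exists e.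
have xK : x \in K j.
  by rewrite inE xA; apply/existsP; exists b; rewrite inE bY bv.
by case/orP: he => /andP[/eqP -> /eqP ->]; rewrite (bK _ _ xK) (bX _ _ yu); [right|left].
Qed.

End Hulls.

Section GluedGrid.
Import mathcomp.boot.fintype mathcomp.boot.finset.
Local Open Scope nat_scope.
Variables (n m N O : nat) (ctr : 'I_m -> nat) (tau : 'I_m -> 'I_m) (flip : bool).
Hypothesis tauK : involutive tau.
Hypothesis tau_flip : forall a, flip || (tau a != a).
Hypothesis N_gt0 : 0 < N.
Hypothesis N_lt_O : N < O.
Hypothesis O_lt_n : O + N < n.
Hypothesis N_lt_ctr : forall a, N < ctr a.
Hypothesis ctr_lt_n : forall a, ctr a + N < n.
Hypothesis ctr_sep : forall a b, a != b ->
  ctr a + 4 * N <= ctr b \/ ctr b + 4 * N <= ctr a.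

Let hole := @grid_hole n m N O ctr.
Let sV := @grid_sV n m N O ctr tau flip.
Let sE := @grid_sE n m N O ctr tau flip.
Definition surface_edge := glued_edge (@grid_l n) (@grid_r n) hole sE.
Definition surface_s : surface_edge -> grid n := @glued_s _ _ _ (@grid_s n) _ _ _ _ sV _.
Definition surface_t : surface_edge -> grid n := @glued_t _ _ _ (@grid_t n) _ _ _ _ sV _.

(** The mesh of a surface with [m] glued holes has at most [2 + m] functionals and
    [m] exceptional chains in its homology, two functionals coming from the torus. *)
Theorem surface_minor_bound (J I : finType) (u v : J -> I) (a0 : 'I_m)
    (X : I -> {set grid n}) (Y : J -> {set grid n}) :
  (forall j, u j != v j) ->
  (forall j k, (u j = u k /\ v j = v k) \/ (u j = v k /\ v j = u k) -> j = k) ->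
  (forall w, connected_set surface_s surface_t (X w)) ->
  (forall w, X w != set0) ->
  (forall j, connected_set surface_s surface_t (Y j)) ->
  (forall w w', w != w' -> X w :&: X w' = set0) ->
  (forall j j', j != j' -> Y j :&: Y j' = set0) ->
  (forall j w, w != u j -> w != v j -> Y j :&: X w = set0) ->
  (forall j, Y j :&: X (u j) != set0) ->
  (forall j, Y j :&: X (v j) != set0) ->
  #|J| <= 3 * (#|I| + (2 + m) + m).
Proof.
move=> loopless simple Xc X0 Yc XX YY XY Yu Yv.
have [branch [root [h [bc be]]]] := hull_minor loopless Xc X0 Yc XX YY XY Yu Yv.
pose Q (i : 'I_(2 + m)) (e : surface_edge) : 'F_2 :=
  match split i with
  | inl i => grid_functional i (val e)
  | inr i => ring_functional (@grid_s n) (@grid_t n) sV (@grid_ring n m N O ctr tau a0) i e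
  end.
apply: (@minor_edge_bound _ _ _ surface_s surface_t (@glued_l _ _ _ _ _ _ _) (@glued_r _ _ _ _ _ _ _)
   (2 + m) m Q (@rim_chain _ _ _ _ _ _ _ ) _ _ J I u v loopless simple branch root h _ be).
- apply: glued_boundary_boundary.
  + exact: grid_boundary_boundary.
  + exact: grid_sEK.
  + exact: grid_sE_rim.
  + exact: grid_sE_neq.
  + exact: grid_sVK.
  + exact: grid_sV_ends.
- move=> z zc zQ.
  refine (@glued_homology (grid n) (grid_edge n) (grid n) (@grid_s n) (@grid_t n)
    (@grid_l n) (@grid_r n) 2 m (@grid_functional n) hole sV sE
    (@grid_ring n m N O ctr tau a0) (@hole_corner n m N O ctr) _ _ _ _ _ _ _ _ _ _ z _ _ _).
  + exact: grid_homology.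
  + by move=> i e; apply: grid_functional_rim.
  + by move=> e; apply: grid_sEK.
  + by move=> e; apply: grid_sE_rim.
  + exact: grid_sVK.
  + by move=> x; apply: grid_sV_neq.
  + by move=> x; apply: grid_sV_id.
  + by move=> e; apply: grid_sV_ends.
  + by move=> x; apply: grid_rim_connected.
  + by move=> c; apply: grid_hole_connected.
  + exact: zc.
  + by move=> i; have := zQ (lshift m i); rewrite /Q (unsplitK (inl i)).
  + by move=> i; have := zQ (rshift 2 i); rewrite /Q (unsplitK (inr i)).
- move=> x w /bc[p [p1 p2]]; exists p; split=> [e /p1/andP[/eqP ? /eqP ?] //|y].
  exact: p2.
Qed.

Definition surface_vertex : grid n -> grid n := @kappa _ sV.
Definition corners (f : grid n) : {set grid n} :=
  [set v | ((v.1 == f.1) || (v.1 == ordS f.1)) && ((v.2 == f.2) || (v.2 == ordS f.2))].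
Definition cell_hull (T : {set grid n}) : {set grid n} :=
  \bigcup_(f in T) surface_vertex @: corners f.
Definition touching (T : {set grid n}) : rel (grid n) := fun f f' =>
  [&& f \in T, f' \in T & (surface_vertex @: corners f) :&: (surface_vertex @: corners f') != set0].

Let inner_edge_adjacent (T : {set grid n}) e : hole (grid_l e) = None \/ hole (grid_r e) = None ->
  surface_vertex (grid_s e) \in cell_hull T -> surface_vertex (grid_t e) \in cell_hull T ->
  connect (adjacent_in surface_s surface_t (cell_hull T)) (surface_vertex (grid_s e)) (surface_vertex (grid_t e)).
Proof.
move=> out sT tT; apply: connect1; rewrite /adjacent_in sT tT; apply/existsP.
have ne : ~~ inner (@grid_l n) (@grid_r n) hole e.
  by rewrite /inner; case: out => ->; rewrite ?andbF.
have [|||||||e' he'] := @glued_edge_ends _ _ _ (@grid_s n) (@grid_t n) (@grid_l n) (@grid_r n) m hole sV sE _ _ _ _ _ _ _ e ne.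
- by move=> e1; apply: grid_sEK.
- by move=> e1; apply: grid_sE_rim.
- by move=> e1; apply: grid_sE_neq.
- exact: grid_sVK.
- by move=> x; apply: grid_sV_neq.
- by move=> x; apply: grid_sV_id.
- by move=> e1; apply: grid_sV_ends.
exists e'; rewrite /surface_s /surface_t.
by case: he' => -[-> ->]; rewrite !eqxx ?orbT.
Qed.

(** The four corners of a cell outside the holes are joined by its sides, whose
    glued images remain edges of the mesh. *)
Lemma cell_hull_connected (T : {set grid n}) :
  {in T, forall f, hole f = None} -> {in T &, forall f f', connect (touching T) f f'} ->
  connected_set surface_s surface_t (cell_hull T).
Proof.
move=> nh Tc; have hullP f v : f \in T -> v \in corners f -> surface_vertex v \in cell_hull T.
  by move=> fT vf; apply/bigcupP; exists f => //; exact: imset_f.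
set W := adjacent_in surface_s surface_t (cell_hull T).
have cornerE f v : v \in corners f = ((v.1 == f.1) || (v.1 == ordS f.1)) && ((v.2 == f.2) || (v.2 == ordS f.2)).
  by rewrite inE.
have cellc f v : f \in T -> v \in corners f -> connect W (surface_vertex f) (surface_vertex v).
  move=> fT vf; have hf := nh _ fT.
  have c2 : connect W (surface_vertex f) (surface_vertex (f.1, ordS f.2)).
    apply: (@inner_edge_adjacent T (true, f)); first by left.
      by apply: (hullP f) => //; rewrite cornerE /grid_s /= !eqxx.
    by apply: (hullP f) => //; rewrite cornerE /grid_t /= !eqxx orbT.
  have c1 : connect W (surface_vertex f) (surface_vertex (ordS f.1, f.2)).
    apply: (@inner_edge_adjacent T (false, f)); first by left.
      by apply: (hullP f) => //; rewrite cornerE /grid_s /= !eqxx.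
    by apply: (hullP f) => //; rewrite cornerE /grid_t /= !eqxx orbT.
  have c12 : connect W (surface_vertex f) (surface_vertex (ordS f.1, ordS f.2)).
    apply: connect_trans c2 _.
    apply: (@inner_edge_adjacent T (false, (f.1, ordS f.2))).
      by right; rewrite /grid_r /= ordSK -surjective_pairing.
      by apply: (hullP f) => //; rewrite cornerE /grid_s /= !eqxx orbT.
    by apply: (hullP f) => //; rewrite cornerE /grid_t /= !eqxx !orbT.
  move: vf; rewrite cornerE; case: v => a b /= /andP[/orP[] /eqP -> /orP[] /eqP ->] //.
  by rewrite -surjective_pairing connect0.
move=> x y /bigcupP[f fT /imsetP[v vf ->]] /bigcupP[g gT /imsetP[w wg ->]].
have Wsym : connect_sym W by exact: adjacent_in_sym.
apply: (@connect_trans _ _ (surface_vertex f)); first by rewrite Wsym; exact: cellc.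
apply: connect_trans (cellc g w gT wg).
have /connectP[p] := Tc _ _ fT gT; elim: p f fT {v vf} => [|h p IH] f fT /=.
  by move=> _ ->; rewrite connect0.
move=> /andP[/and3P[_ hT /set0Pn[x0]]]; rewrite inE => /andP[/imsetP[a af ->] /imsetP[b bh ab]].
move=> pth lst; apply: connect_trans (IH h hT pth lst).
apply: connect_trans (cellc _ _ fT af) _; rewrite ab Wsym; exact: cellc.
Qed.

End GluedGrid.

(** * The plane with holes *)

Section MirrorGeometry.
Local Open Scope ring_scope.
Variable R : realType.

(** Both kinds of gluing are reflections: of the line of centres in the midpoint of
    two centres, and of the ordinate when [flip] holds.  Handles take for [tau] the
    exchange of [2 * i] and [2 * i + 1] without flip, cross-caps the identity with
    flip. *)
Definition mirror (tau : nat -> nat) (flip : bool) (a : nat) (z : R * R) : R * R :=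
  (4 * a%:R + 4 * (tau a)%:R - z.1, if flip then - z.2 else z.2).

Lemma norm_pair (z : R * R) : `|z| = Num.max `|z.1| `|z.2|.
Proof. by []. Qed.

Lemma mirrorK tau flip a : involutive (mirror tau flip a).
Proof.
by case=> x y; rewrite /mirror /= subKr; case: flip; rewrite ?opprK.
Qed.

Lemma mirror_dist tau flip a z w :
  `|mirror tau flip a z - mirror tau flip a w| = `|z - w|.
Proof.
case: z w => x y [x' y']; rewrite !norm_pair /mirror /=; congr Num.max.
  by rewrite opprB addrC addrA addrNK distrC.
by case: flip => //; rewrite opprK addrC distrC.
Qed.

(** Distinct centres are at distance at least 4. *)
Lemma hole_centers_far a b (z : R * R) : `|z - hole_center R a| <= 1 ->
  `|z - hole_center R b| < 3 -> a = b.
Proof.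
case: z => x y; rewrite !norm_pair /= !ge_max !gt_max /hole_center /=.
move=> /andP[+ _] /andP[+ _]; rewrite ler_norml ltr_norml => /andP[h1 h2] /andP[h3 h4].
have h5 : (a%:R : R) < b%:R + 1 by lra.
have h6 : (b%:R : R) < a%:R + 1 by lra.
by move: h5 h6; rewrite !natr1 !ltr_nat !ltnS => h5 h6; apply/eqP; rewrite eqn_leq h5.
Qed.

Variables (m : nat) (tau : nat -> nat) (flip : bool).
Hypothesis tauK : forall a, tau (tau a) = a.
Hypothesis tau_m : forall a, (a < m)%N -> (tau a < m)%N.

Definition holed_plane : set (R * R) :=
  [set z | forall a, (a < m)%N -> 1 <= `|z - hole_center R a|]%classic.

Definition glued (z w : R * R) : Prop :=
  exists a, [/\ (a < m)%N, `|z - hole_center R a| = 1 & w = mirror tau flip a z].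

Lemma mirror_tau a z : mirror tau flip (tau a) z = mirror tau flip a z.
Proof. by rewrite /mirror tauK [4 * _ + _]addrC. Qed.

Lemma mirror_center a z :
  `|mirror tau flip a z - hole_center R (tau a)| = `|z - hole_center R a|.
Proof.
rewrite -(mirror_dist tau flip a z); congr (`|_ - _|).
by rewrite /mirror /hole_center /= oppr0 addrAC subrr add0r; case: flip.
Qed.

Lemma glued_sym z w : glued z w -> glued w z.
Proof.
case=> a [am za ->]; exists (tau a).
by rewrite mirror_center mirror_tau mirrorK; split=> //; exact: tau_m.
Qed.

(** A rim point has only one rim, so that gluing classes have at most two
    points. *)
Lemma glued_trans z w v : glued z w -> glued w v -> v = z.
Proof.
case=> a [am za ->] [b [bm + ->]] => wb.
have -> : b = tau a.
  by apply: (@hole_centers_far _ _ (mirror tau flip a z)); rewrite ?wb ?mirror_center ?za //; lra.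
by rewrite mirror_tau mirrorK.
Qed.

Lemma rim_holed a z : `|z - hole_center R a| = 1 -> holed_plane z.
Proof.
move=> za b bm; rewrite leNgt; apply/negP => zb.
suff ab : a = b by rewrite -ab za ltxx in zb.
by apply: (@hole_centers_far _ _ z); [rewrite za | lra].
Qed.

Lemma glued_holed z w : glued z w -> holed_plane z /\ holed_plane w.
Proof.
move=> g; split; last case: (glued_sym g) => a [_ h _]; last exact: rim_holed h.
by case: g => a [_ h _]; exact: rim_holed h.
Qed.

End MirrorGeometry.

Section Model.
Local Open Scope classical_set_scope.
Local Open Scope ring_scope.
Local Open Scope quotient_scope.
Variable R : realType.
Variables (m : nat) (tau : nat -> nat) (flip : bool).
Variable r : @holed_sphere R m -> @holed_sphere R m -> Prop.

(** What the two gluing relations have in common, and all that is used of them. *)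
Definition gluing_scheme : Prop :=
  [/\ forall a, tau (tau a) = a, forall a, (a < m)%N -> (tau a < m)%N,
    forall p q, r p q -> exists z w : R * R,
      [/\ glued m tau flip z w, set_val p = Some z & set_val q = Some w] &
    forall p q (z w : R * R), glued m tau flip z w -> set_val p = Some z -> set_val q = Some w ->
      clos_refl_sym_trans _ r p q].

Hypothesis scheme : gluing_scheme.

Let Q := {eq_quot (generated_equiv r)}.
Let S := glued_space r.
Let proj (p : @holed_sphere R m) : S := \pi_(quotient_topology Q) p.

Let same (p q : @holed_sphere R m) : Prop := p = q \/
  exists z w : R * R, [/\ glued m tau flip z w, set_val p = Some z & set_val q = Some w].

Let same_sym p q : same p q -> same q p.
Proof.
case: scheme => tauK tau_m _ _ [->|[z [w [g pz qw]]]]; first by left.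
by right; exists w, z; split=> //; exact: glued_sym.
Qed.

Let set_val_inj : injective (@set_val _ (@holed_sphere R m)).
Proof. by move=> [x hx] [y hy] xy; exact: val_inj. Qed.

Let same_trans p q s : same p q -> same q s -> same p s.
Proof.
case: scheme => tauK tau_m _ _ [->//|[z [w [g pz qw]]]] [<-|[w' [v [g' qw' sv]]]].
  by right; exists z, w.
left; apply: set_val_inj; rewrite pz sv; congr Some.
by move: qw'; rewrite qw => -[ww]; rewrite -ww in g'; rewrite (glued_trans tauK g g').
Qed.

Let proj_eq p q : proj p = proj q <-> same p q.
Proof.
rewrite /proj; split=> [/eqquotP/asboolP|h].
  elim=> {p q} [p q|p|p q _|p q s _ h1 _ h2].
  - by case: scheme => _ _ H _ /H[z [w h]]; right; exists z, w.
  - by left.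
  - exact: same_sym.
  - exact: same_trans h1 h2.
apply/eqquotP/asboolP; case: h => [->|[z [w [g pz qw]]]]; first exact: rst_refl.
by case: scheme => _ _ _ H; exact: H pz qw.
Qed.

Let inf_mem : None \in @holed_sphere R m.
Proof. by apply/mem_set => z j. Qed.

Let some_mem z : holed_plane m z -> Some z \in @holed_sphere R m.
Proof. by move=> hz; apply/mem_set => z' j [<-]; exact: hz. Qed.

Let lift (z : R * R) : @holed_sphere R m :=
  if pselect (holed_plane m z) is left h then exist _ (Some z) (some_mem h)
  else exist _ None inf_mem.

Let lift_val z : holed_plane m z -> set_val (lift z) = Some z.
Proof. by rewrite /lift; case: pselect. Qed.

(** The surface is handled through the plane: every point but the one at infinity
    is the image of a point outside the holes.  Points inside the holes are sent to
    infinity by default. *)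
Definition plane_point (z : R * R) : S := proj (lift z).
Definition infinity_point : S := proj (exist _ None inf_mem).

Lemma plane_point_eq z w : holed_plane m z -> holed_plane m w ->
  plane_point z = plane_point w <-> z = w \/ glued m tau flip z w.
Proof.
move=> hz hw; rewrite proj_eq; split.
  case=> [/(congr1 set_val)|[z' [w' [g]]]]; rewrite !lift_val //; first by case; left.
  by move=> -[->] [->]; right.
case=> [->|g]; first by left.
by right; exists z, w; rewrite !lift_val.
Qed.

Lemma plane_point_surj q : q = infinity_point \/
  exists2 z, holed_plane m z & q = plane_point z.
Proof.
rewrite -[q]reprK; move: (repr q) => [[z|] h]; last by left; congr (\pi _); exact: val_inj.
right; have hz : holed_plane m z.
  by move=> a am; apply: (set_mem h) am.
by exists z => //; congr (\pi _); apply: set_val_inj; rewrite lift_val.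
Qed.

Lemma plane_point_neq_infinity z : holed_plane m z -> plane_point z <> infinity_point.
Proof.
move=> hz /proj_eq[/(congr1 set_val)|[z' [w' [_ _]]]]; last by [].
by rewrite lift_val.
Qed.

Let proj_continuous : continuous proj.
Proof. exact: pi_continuous. Qed.

Lemma plane_point_continuous : {within holed_plane m, continuous plane_point}.
Proof.
have liftc : continuous (lift : subspace (holed_plane m) -> @holed_sphere R m).
  apply: (@continuous_comp_initial _ (subspace (holed_plane m)) _ set_val lift).
  apply: (@subspace_eq_continuous _ _ _ (Some : R * R -> one_point_compactification (R * R))).
    by move=> z /set_mem hz; rewrite /= lift_val.
  by apply: continuous_subspaceT; exact: one_point_compactification_some_continuous.
move=> z; apply: continuous_comp; first exact: liftc.
exact: proj_continuous.
Qed.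

Let far_from_rims z : holed_plane m z ->
  (forall a, (a < m)%N -> `|z - hole_center R a| <> 1) ->
  exists2 e : R, 0 < e & forall a w, (a < m)%N -> `|w - hole_center R a| = 1 -> e <= `|w - z|.
Proof.
move=> hz nz.
suff [e e0 he] : exists2 e : R, 0 < e &
    forall a, (a < m)%N -> e <= `|z - hole_center R a| - 1.
  exists e => // a w am wa; apply: le_trans (he a am) _.
  rewrite -wa lerBlDr; have := ler_distD w z (hole_center R a).
  by rewrite distrC [`|z - w|]distrC => h; apply: le_trans h _; rewrite distrC.
elim: m hz nz => [|k IH] hz nz; first by exists 1.
have [|a am|e e0 he] := IH; first by move=> a am; apply: hz; exact: ltnW.
  by apply: nz; exact: ltnW.
have zk : 0 < `|z - hole_center R k| - 1.
  rewrite subr_gt0 lt_neqAle hz // andbT eq_sym; apply/eqP; exact: nz.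
exists (Num.min e (`|z - hole_center R k| - 1)); first by rewrite lt_min e0.
move=> a; rewrite ltnS leq_eqVlt => /orP[/eqP ->|am]; rewrite ge_min ?lexx ?orbT //.
by rewrite he.
Qed.

(** A continuous function on the sphere that is invariant under the gluing descends
    to the surface; bumps around a point and its mirror image are invariant when
    their radius is small. *)
Let bump (p p' : R * R) (e : R) (z : R * R) : R :=
  Num.max 0 (e - Num.min `|z - p| `|z - p'|).

Let bump_continuous p p' e : continuous (bump p p' e).
Proof.
have dc (q : R * R) : continuous (fun w : R * R => `|w - q|).
  by move=> w; apply: cvg_norm; apply: cvgB; [exact: cvg_id | exact: cvg_cst].
move=> z; have h1 := @continuous_min R _ _ _ z (dc p z) (dc p' z).
have h2 : {for z, continuous (fun w : R * R => e - Num.min `|w - p| `|w - p'|)}.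
  by apply: cvgB; [exact: cvg_cst | exact: h1].
exact: (@continuous_max R _ _ _ z (@cst_continuous _ _ 0 z) h2).
Qed.

Let extended (f : R * R -> R) (x : one_point_compactification (R * R)) : R :=
  if x is Some z then f z else 0.

Let extended_continuous f (M : R) : continuous f -> (forall z, M < `|z| -> f z = 0) ->
  continuous (extended f).
Proof.
move=> cf f0 [z|] U; first by move=> /cf.
move=> /nbhs_singleton U0; exists (`[- M, M] `*` `[- M, M]).
  split; first by apply: compact_setX; exact: segment_compact.
  apply: compact_closed; first exact: norm_hausdorff.
  by apply: compact_setX; exact: segment_compact.
move=> x [[z nz <-]|->] //=; rewrite f0 // ltNge norm_pair ge_max.
apply/negP => /andP[]; rewrite !ler_norml => h1 h2; apply: nz.
by split; rewrite /= in_itv.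
Qed.

Let separate p q : p <> q -> exists2 f : S -> R, continuous f & f p <> f q.
Proof.
case: scheme => tauK tau_m _ _.
wlog [z hz pz] : p q / exists2 z, holed_plane m z & p = plane_point z.
  move=> H pq; have [pi|hp] := plane_point_surj p; last exact: H.
  have [qi|hq] := plane_point_surj q; first by rewrite pi qi in pq.
  by have [f cf fq] := H q p hq (nesym pq); exists f => // /esym.
move=> pq.
have away z' : z' = z \/ glued m tau flip z z' -> exists2 e : R, 0 < e &
    forall w, holed_plane m w -> q = plane_point w -> e <= `|w - z'|.
  move=> zz'; have [->|[w hw qw]] := plane_point_surj q.
    by exists 1 => // w hw /esym; case/(plane_point_neq_infinity hw).
  have hz' : holed_plane m z'.
    by case: zz' => [->//|/(glued_holed tauK tau_m)[]].
  have pz' : p = plane_point z'.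
    rewrite pz; apply/plane_point_eq => //.
    by case: zz' => [->|]; [left|right].
  have [v qv wv] : exists2 v, q = plane_point v &
      forall w', holed_plane m w' -> q = plane_point w' -> w' = w \/ w' = v.
    have [[v wv]|nv] := pselect (exists v, glued m tau flip w v).
      have [_ hv] := glued_holed tauK tau_m wv.
      exists v; first by rewrite qw; apply/plane_point_eq => //; right.
      move=> w' hw'; rewrite qw => /(plane_point_eq hw hw')[->|ww']; first by left.
      by right; have := glued_trans tauK (glued_sym tauK tau_m wv) ww'.
    exists w => // w' hw'; rewrite qw => /(plane_point_eq hw hw')[->|ww']; first by left.
    by case: nv; exists w'.
  have pos u : q = plane_point u -> 0 < `|u - z'|.
    move=> qu; rewrite normr_gt0 subr_eq0; apply/eqP => uz; apply: pq.
    by rewrite pz' qu uz.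
  exists (Num.min `|w - z'| `|v - z'|); first by rewrite lt_min !pos.
  by move=> u hu qu; case: (wv u hu qu) => ->; rewrite ge_min lexx ?orbT.
have bump0 (z' w : R * R) e : e <= `|w - z| -> e <= `|w - z'| -> bump z z' e w = 0.
  by move=> h1 h2; apply/max_idPl; rewrite subr_le0 le_min h1.
have rims_apart a b (u v : R * R) : a <> b -> `|u - hole_center R a| = 1 ->
    `|v - hole_center R b| = 1 -> 1 <= `|v - u|.
  move=> ab ua vb; rewrite leNgt; apply/negP => uv; apply: ab.
  apply: (@hole_centers_far R a b u); first by rewrite ua.
  apply: le_lt_trans (ler_distD v u (hole_center R b)) _.
  by rewrite vb distrC; lra.
have [z' [e [e0 symm dist]]] : exists z' (e : R), [/\ 0 < e,
    forall w w', glued m tau flip w w' -> bump z z' e w' = bump z z' e w &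
    forall w, holed_plane m w -> q = plane_point w -> e <= Num.min `|w - z| `|w - z'|].
  have [e1 e10 he1] := away z (or_introl erefl).
  have [[a [am za]]|nrim] := pselect (exists a, (a < m)%N /\ `|z - hole_center R a| = 1).
    set z' := mirror tau flip a z.
    have gz : glued m tau flip z z' by exists a.
    have [e2 e20 he2] := away z' (or_intror gz).
    exists z', (Num.min 1 (Num.min e1 e2)); split.
    - by rewrite !lt_min ltr01 e10.
    - move=> w w' [b [bm wb ww']].
      have z'a : `|z' - hole_center R (tau a)| = 1 by rewrite mirror_center.
      have w'b : `|w' - hole_center R (tau b)| = 1 by rewrite ww' mirror_center.
      have [ba|ba] := pselect (b = a \/ b = tau a).
        have -> : w' = mirror tau flip a w.
          by rewrite ww'; case: ba => ->; rewrite ?mirror_tau.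
        rewrite /bump; congr (Num.max 0 (_ - _)).
        rewrite -{1}(mirrorK tau flip a z) !mirror_dist -/z' minC.
        by congr Num.min; rewrite -(mirror_dist tau flip a w z) .
      have [ba1 ba2] : b <> a /\ b <> tau a by split=> h; apply: ba; [left|right].
      have [ba3 ba4] : tau b <> a /\ tau b <> tau a.
        split=> [h|/(congr1 tau)]; last by rewrite !tauK.
        by apply: ba2; rewrite -h tauK.
      have far x y : 1 <= `|x - y| -> Num.min 1 (Num.min e1 e2) <= `|x - y|.
        by move=> h; rewrite ge_min h.
      rewrite !bump0 //; apply: far.
      - exact: (rims_apart _ _ _ _ (nesym ba1) za wb).
      - exact: (rims_apart _ _ _ _ (nesym ba2) z'a wb).
      - exact: (rims_apart _ _ _ _ (nesym ba3) za w'b).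
      - exact: (rims_apart _ _ _ _ (nesym ba4) z'a w'b).
    - move=> w hw qw; rewrite le_min !ge_min he1 // he2 //.
      by rewrite !orbT.
  have [a am za|e2 e20 he2] := far_from_rims hz; first by apply: nrim; exists a.
  exists z, (Num.min e1 e2); split; first by rewrite lt_min e10.
  - move=> w w' g; have [b' [bm' wb' _]] := glued_sym tauK tau_m g.
    case: g => b [bm wb _].
    have h1 := he2 b w bm wb; have h2 := he2 b' w' bm' wb'.
    by rewrite !bump0 // ge_min ?h1 ?h2 orbT.
  - by move=> w hw qw; rewrite le_min !ge_min he1.
pose g (x : @holed_sphere R m) := extended (bump z z' e) (set_val x).
have gc : continuous g.
  move=> x; apply: continuous_comp; first exact: initial_continuous.
  apply: (extended_continuous (M := `|z| + `|z'| + e)); first exact: bump_continuous.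
  move=> w Mw; apply: bump0.
    have := ler_normD (w - z) z; rewrite subrK; have := normr_ge0 z'.
    by move: Mw; lra.
  have := ler_normD (w - z') z'; rewrite subrK; have := normr_ge0 z.
  by move: Mw; lra.
have gs : {homo g : a b / \pi_(quotient_topology Q) a == \pi_(quotient_topology Q) b >-> a == b}.
  move=> a b /eqP /proj_eq[->//|[w [w' [gw aw bw]]]].
  by rewrite /g aw bw /= (symm _ _ gw).
exists (g \o repr); first exact: repr_comp_continuous.
have gE x : g (repr (proj x)) = g x.
  by apply/eqP; apply: gs; rewrite reprK.
have -> : (g \o repr) p = e.
  rewrite /= pz /plane_point gE /g lift_val //=.
  by rewrite /bump subrr normr0 min_l// subr0 max_r// ltW.
suff -> : (g \o repr) q = 0 by apply/eqP; rewrite gt_eqF.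
have [->|[w hw qw]] := plane_point_surj q; first by rewrite /= /infinity_point gE.
rewrite /= qw /plane_point gE /g lift_val //= /bump max_l //.
by rewrite subr_le0 dist.
Qed.

Lemma model_hausdorff : hausdorff_space S.
Proof.
move=> p q cl; apply: contrapT => /separate[f cf]; apply.
apply: (@Rhausdorff R) => A B nA nB.
by have [x [Ax Bx]] := cl _ _ (cf _ _ nA) (cf _ _ nB); exists (f x).
Qed.

(** Once [M] exceeds the range of the holes, the points all of whose representatives
    have norm below [M] form an open set; these sets cover the complement of
    infinity. *)
Lemma model_bounded (K : set S) : compact K -> ~ K infinity_point ->
  exists M : R, forall z, holed_plane m z -> K (plane_point z) -> `|z| <= M.
Proof.
move=> /compact_near_coveringP cK Kinf.
pose P (M : R) q := forall z, holed_plane m z -> q = plane_point z -> `|z| <= M.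
have [q Kq|M [_ HM]] := cK R +oo%R P _; last first.
  exists (M + 1) => z hz Kz; apply: (HM (M + 1) _ _ Kz z hz erefl).
  by rewrite ltrDl.
have [qinf|[z0 hz0 qz0]] := plane_point_surj q; first by rewrite qinf in Kq.
pose M0 := Num.max (`|z0| + 1) (4 * m%:R + 2).
have rimM z a : (a < m)%N -> `|z - hole_center R a| = 1 -> `|z| < M0.
  move=> am za; rewrite lt_max; apply/orP; right.
  have := ler_normD (z - hole_center R a) (hole_center R a); rewrite subrK za.
  have -> : `|hole_center R a| = 4 * a%:R.
    by rewrite norm_pair /hole_center /= normr0 ger0_norm ?mulr_ge0// max_l// mulr_ge0.
  have : a%:R < m%:R :> R by rewrite ltr_nat.
  lra.
pose V : set S := [set q' | forall z, holed_plane m z -> q' = plane_point z -> `|z| < M0].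
have oV : open (V `&` ~` [set infinity_point]).
  rewrite /open /= /quotient_open.
  suff -> : (\pi_(quotient_topology Q)) @^-1` (V `&` ~` [set infinity_point]) =
      set_val @^-1` (Some @` [set z : R * R | `|z| < M0]).
    have /continuousP := @initial_continuous (@holed_sphere R m) _ set_val; apply.
    apply: one_point_compactification_open_some.
    apply: (@open_comp _ _ (fun z : R * R => `|z|) [set x | x < M0]).
      by move=> z _; exact: norm_continuous.
    exact: open_lt.
  apply/seteqP; split=> x /=.
    move=> [Vx xinf]; case: x Vx xinf => -[z|] h Vx xinf; last first.
      by case: xinf; congr (\pi _); exact: val_inj.
    have hz : holed_plane m z by move=> a am; apply: (set_mem h) am.
    exists z => //=; apply: Vx => //; congr (\pi _); apply: set_val_inj.
    by rewrite lift_val.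
  move=> [z zM0 zx]; have hz : holed_plane m z.
    case: x zx => x h /= zx; rewrite /= in zx.
    have hm : @holed_sphere R m x by exact: set_mem h.
    by move=> a am; apply: hm am; rewrite zx.
  have -> : x = lift z by apply: set_val_inj; rewrite lift_val.
  split; last exact: plane_point_neq_infinity.
  move=> z' hz' /(plane_point_eq hz hz')[<- //|].
  by case: scheme => tauK tau_m _ _ /(glued_sym tauK tau_m)[a [am za _]]; exact: rimM za.
have nV : nbhs q (V `&` ~` [set infinity_point]).
  apply: open_nbhs_nbhs; split=> //; split=> [z hz|/= qinf]; last by rewrite qinf in Kq.
  rewrite qz0 => /(plane_point_eq hz0 hz)[<-|].
    by rewrite lt_max ltrDl ltr01.
  by case: scheme => tauK tau_m _ _ /(glued_sym tauK tau_m)[a [am za _]]; exact: rimM za.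
exists (V `&` ~` [set infinity_point], [set M | M0 <= M]) => /=.
  by split=> //; exists M0; split; [exact: num_real | move=> M /ltW].
by move=> [q' M] /= [[Vq' _] M0M] z hz qz; apply: ltW; apply: lt_le_trans M0M; exact: Vq'.
Qed.

End Model.

(** * Gluing schemes and separation by a fine mesh *)

Section Schemes.
Local Open Scope ring_scope.
Variable R : realType.

(** The index of the hole at the other end of the same handle. *)
Definition partner (a : nat) : nat := if odd a then a.-1 else a.+1.

Lemma partnerK a : partner (partner a) = a.
Proof.
rewrite /partner; case oa : (odd a); last by rewrite /= oa.
by case: a oa => //= a /negbTE ->.
Qed.

Lemma handle_scheme k : gluing_scheme partner false (@handle_gluing R k).
Proof.
split.
- exact: partnerK.
- move=> a; rewrite /partner; case oa : (odd a) => ak; first by apply: leq_ltn_trans (leq_pred _) ak.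
  by rewrite ltn_neqAle ak andbT; apply/eqP => ek; have := oa; rewrite -[odd a]negbK -oddS ek odd_double.
- move=> p q [i [v [ik v1 pz qz]]]; exists (hole_center R i.*2 + v), (hole_center R i.*2.+1 + (- v.1, v.2)).
  split=> //; exists i.*2; split; first by rewrite ltn_double.
    by rewrite addrC addKr.
  by rewrite /mirror /partner odd_double /hole_center /=; congr (_, _) => /=; ring.
- have sym p q : handle_gluing p q -> Relation_Operators.clos_refl_sym_trans _ (@handle_gluing R k) p q.
    exact: Relation_Operators.rst_step.
  move=> p q z w [a [ak za ->]] pz qz.
  have [oa|ea] := boolP (odd a).
    have ea : a = a./2.*2.+1 by rewrite -[LHS]odd_double_half oa.
    move: (a./2) ea => h ea; subst a.
    apply: Relation_Operators.rst_sym; apply: sym.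
    exists h, (- (z - hole_center R h.*2.+1).1, (z - hole_center R h.*2.+1).2).
    split.
    + by rewrite -ltn_double; apply: ltn_trans ak.
    + by rewrite -za !norm_pair /= normrN.
    + rewrite qz /mirror /partner oa /hole_center /=.
      by congr (Some (_, _)) => /=; ring.
    + rewrite pz /hole_center /=; case: (z) => x y /=.
      by congr (Some (_, _)) => /=; ring.
  have ea' : a = a./2.*2 by rewrite -[LHS]odd_double_half (negbTE ea).
  move: (a./2) ea' => h ea'; subst a.
  apply: sym; exists h, (z - hole_center R h.*2); split=> //.
  + by rewrite -ltn_double.
  + by rewrite pz addrC subrK.
  + rewrite qz /mirror /partner (negbTE ea) /hole_center /=.
    by congr (Some (_, _)) => /=; ring.
Qed.

Lemma crosscap_scheme k : gluing_scheme id true (@crosscap_gluing R k).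
Proof.
split=> //.
- move=> p q [i [v [ik v1 pz qz]]]; exists (hole_center R i + v), (hole_center R i - v).
  split=> //; exists i; split=> //; first by rewrite addrC addKr.
  by rewrite /mirror /hole_center /=; congr (_, _) => /=; ring.
- move=> p q z w [a [ak za ->]] pz qz; apply: Relation_Operators.rst_step.
  exists a, (z - hole_center R a); split=> //; first by rewrite pz addrC subrK.
  by rewrite qz /mirror /hole_center /=; congr (Some (_, _)) => /=; ring.
Qed.

End Schemes.

Section Separation.
Local Open Scope classical_set_scope.
Local Open Scope ring_scope.
Variables (R : realType) (m : nat) (tau : nat -> nat) (flip : bool).
Variable r : @holed_sphere R m -> @holed_sphere R m -> Prop.
Hypothesis scheme : gluing_scheme tau flip r.
Let pp : R * R -> glued_space r := plane_point r.

Definition plane_part (K : set (glued_space r)) : set (R * R) :=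
  [set z | holed_plane m z /\ K (plane_point r z)].

Lemma holed_plane_closed : closed (@holed_plane R m).
Proof.
rewrite (_ : holed_plane m = \bigcap_(a in [set a | (a < m)%N]) [set z | 1 <= `|z - hole_center R a|]); last first.
  by apply/seteqP; split=> z h a; exact: h.
apply: closed_bigI => a _.
apply: (@closed_comp _ _ (fun z : R * R => `|z - hole_center R a|) [set x | 1 <= x]); last exact: closed_ge.
by move=> z _; apply: cvg_norm; apply: cvgB; [exact: cvg_id | exact: cvg_cst].
Qed.

Lemma plane_part_compact K : compact K -> ~ K (infinity_point r) -> compact (plane_part K).
Proof.
move=> cK Kinf; have [M HM] := model_bounded scheme cK Kinf.
have clK : closed K by apply: compact_closed => //; exact: model_hausdorff scheme.
have cB : compact (`[- M, M] `*` `[- M, M] : set (R * R)).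
  by apply: compact_setX; exact: segment_compact.
apply: (subclosed_compact _ cB); last first.
  move=> z [hz Kz]; have := HM z hz Kz; rewrite norm_pair ge_max => /andP[].
  by rewrite !ler_norml => h1 h2; split; rewrite /= in_itv.
have /continuous_closedP/(_ _ clK)/closed_subspaceP[W cW WE] := plane_point_continuous (r := r).
rewrite (_ : plane_part K = W `&` holed_plane m); first exact: closedI holed_plane_closed.
by rewrite WE; apply/seteqP; split=> z [].
Qed.

(** [b] and [b'] play the role of mesh vertices close to [K] and [K'] that are
    identified on the surface; separation at distance [d] says that a mesh of that
    width never confuses the two sets. *)
Definition mesh_separated (K K' : set (glued_space r)) (d : R) : Prop :=
  forall z z' b b', plane_part K z -> plane_part K' z' ->
    holed_plane m b -> holed_plane m b' -> pp b = pp b' ->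
    `|z - b| <= d -> `|z' - b'| <= d -> False.

(** Two distinct points of the surface have disjoint neighbourhoods, and finitely
    many of the corresponding balls cover the compact product of the two sets. *)
Lemma mesh_separated_near K K' : compact K -> compact K' ->
  ~ K (infinity_point r) -> ~ K' (infinity_point r) -> K `&` K' = set0 ->
  \forall N \near \oo, mesh_separated K K' (N.+1%:R^-1).
Proof.
move=> cK cK' Ki K'i KK'.
have cC : compact (plane_part K `*` plane_part K').
  by apply: compact_setX; exact: plane_part_compact.
pose P (N : nat) (c : (R * R) * (R * R)) := forall b b',
    holed_plane m b -> holed_plane m b' -> pp b = pp b' ->
    `|c.1 - b| <= N.+1%:R^-1 -> `|c.2 - b'| <= N.+1%:R^-1 -> False.
move/compact_near_coveringP: cC => /(_ nat \oo P _) cov.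
have H : (forall c, (plane_part K `*` plane_part K') c ->
    \forall c' \near c & N \near \oo, P N c').
  move=> [z z'] [[/= hz Kz] [/= hz' Kz']].
  have neq : pp z != pp z'.
    apply/eqP => e; have : (K `&` K') (pp z) by split=> //; rewrite e.
    by rewrite KK'.
  have := model_hausdorff scheme; rewrite open_hausdorff => /(_ _ _ neq).
  case=> -[A B] /= [/set_mem Az /set_mem Bz'] [oA oB AB].
  have near_pt (U : set (glued_space r)) y : open U -> holed_plane m y -> U (pp y) ->
      exists2 e : R, 0 < e & forall b, `|y - b| < e -> holed_plane m b -> U (pp b).
    move=> oU hy Uy; have /subspace_continuousP/(_ y hy) := plane_point_continuous (r := r).
    move=> /(_ U (open_nbhs_nbhs (conj oU Uy))) /= /nbhs_ballP[e e0 he].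
    by exists e => // b yb hb; apply: he => //; rewrite -ball_normE.
  have [e e0 he] := near_pt A z oA hz Az.
  have [e' e'0 he'] := near_pt B z' oB hz' Bz'.
  exists ((ball z (e / 2) `*` ball z' (e' / 2)), [set N | N.+1%:R^-1 < e / 2 /\ N.+1%:R^-1 < e' / 2]).
    split=> /=.
      by exists (ball z (e / 2), ball z' (e' / 2)) => //=; split; apply: nbhsx_ballx; lra.
    apply: filterS2 (near_infty_natSinv_lt (PosNum (divr_gt0 e0 (ltr0Sn R 1))))
      (near_infty_natSinv_lt (PosNum (divr_gt0 e'0 (ltr0Sn R 1)))) => N /= h1 h2.
    by split.
  move=> [[y y'] N] /= [[zy z'y'] [Ne Ne']] b b' hb hb' bb' /= yb y'b'.
  rewrite -ball_normE /= in zy; rewrite -ball_normE /= in z'y'.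
  have Ab : A (pp b).
    apply: he => //; apply: le_lt_trans (ler_distD y z b) _.
    by rewrite [e]splitr; apply: ltrD => //; apply: le_lt_trans Ne.
  have Bb : B (pp b).
    rewrite bb'; apply: he' => //; apply: le_lt_trans (ler_distD y' z' b') _.
    by rewrite [e']splitr; apply: ltrD => //; apply: le_lt_trans Ne'.
  by have : (A `&` B) (pp b) by []; rewrite (eqP AB).
have [M _ HM] := cov H.
exists M => // N MN z z' b b' Kz K'z' hb hb' e h1 h2.
exact: (HM N MN (z, z') (conj Kz K'z') b b' hb hb' e h1 h2).
Qed.

End Separation.

(** * Cells touched by a compact connected set *)

Lemma frame_corner_nat (x y a b N n : nat) : (0 < N)%N -> (x < n)%N -> (y < n)%N ->
  (x <= a + N)%N -> (a <= x.+1 + N)%N -> (y <= b + N)%N -> (b <= y.+1 + N)%N ->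
  [|| (x + N <= a <= x.+1 + N)%N, (x <= a + N <= x.+1)%N,
    (y + N <= b <= y.+1 + N)%N | (y <= b + N <= y.+1)%N] ->
  exists i j, [/\ (i == x) || (i == x.+1), (j == y) || (j == y.+1), 
    [&& a <= i + N, i <= a + N, b <= j + N, j <= b + N &
    [|| i + N == a, i == a + N, j + N == b | j == b + N]] & (i <= n) && (j <= n)]%N.
Proof.
move=> N0 xn yn h1 h2 h3 h4 h5.
have clamp c d : (0 < N)%N -> (d <= c + N)%N -> (c <= d.+1 + N)%N -> exists i, [/\ (i == d) || (i == d.+1), (c <= i + N)%N, (i <= c + N)%N & 
  (d + N <= c <= d.+1 + N)%N || (d <= c + N <= d.+1)%N -> (i + N == c) || (i == c + N)].
  clear; move=> N0 k1 k2.
  have [e|e] := eqVneq (d + N)%N c; first by exists d; split; lia.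
  have [e'|e'] := eqVneq d (c + N)%N; first by exists d; split; lia.
  have [e2|e2] := ltnP d (c + N); first by exists d.+1; split; lia.
  by exists d; split; lia.
have [i [i1 i2 i3 i4]] := clamp a x N0 h1 h2.
have [j [j1 j2 j3 j4]] := clamp b y N0 h3 h4.
exists i, j; split=> //; last by move: xn yn i1 j1; clear; lia.
rewrite i2 i3 j2 j3 /=; case/or4P: h5 => h.
- by rewrite orbA i4 ?h.
- by rewrite orbA i4 ?h ?orbT.
- by rewrite 2!orbA orbC -orbA; rewrite orbA [X in _ || X]orbC; move: j4; rewrite h; lia.
- by move: j4; rewrite h orbT; lia.
Qed.

Section Cells.
Local Open Scope ring_scope.
Variables (R : realType) (m N B : nat) (tau : nat -> nat) (flip : bool).
Hypothesis tauK : forall a, tau (tau a) = a.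
Hypothesis tau_m : forall a, (a < m)%N -> (tau a < m)%N.
Hypothesis tau_flip : forall a, flip || (tau a != a).
Hypothesis m_gt0 : (0 < m)%N.
Hypothesis N_gt0 : (0 < N)%N.
Hypothesis B_large : (4 * m + 2 <= B)%N.

(** The square of half side [B] around the origin is divided into cells of side
    [1 / N], so that the holes become holes of the grid. *)
Definition mesh_size := (2 * B * N)%N.
Definition mesh_origin := (B * N)%N.
Definition mesh_center (a : 'I_m) := (B * N + 4 * a * N)%N.
Definition mesh_tau (a : 'I_m) : 'I_m := Ordinal (tau_m (ltn_ord a)).

Local Notation n := mesh_size.
Local Notation O := mesh_origin.
Local Notation ctr := mesh_center.
Local Notation tauI := mesh_tau.
Local Notation hole := (grid_hole (n := n) N O ctr).
Local Notation sV := (grid_sV (n := n) N O ctr tauI flip).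

Let tauIK : involutive tauI.
Proof. by move=> a; apply: val_inj; rewrite /= tauK. Qed.

Let tauI_flip a : flip || (tauI a != a).
Proof. exact: tau_flip. Qed.

Let N_lt_O : (N < O)%N.
Proof. by rewrite /O; move: N_gt0 B_large; clear; nia. Qed.

Let O_lt_n : (O + N < n)%N.
Proof. by rewrite /O /n; move: N_gt0 B_large; clear; nia. Qed.

Let N_lt_ctr a : (N < ctr a)%N.
Proof. by rewrite /ctr; move: N_gt0 B_large; clear; nia. Qed.

Let ctr_lt_n a : (ctr a + N < n)%N.
Proof. by rewrite /ctr /n; have := ltn_ord a; move: N_gt0 B_large; clear; nia. Qed.

Let ctr_sep a b : a != b -> (ctr a + 4 * N <= ctr b \/ ctr b + 4 * N <= ctr a)%N.
Proof. by rewrite /ctr -val_eqE neq_ltn => /orP[] /= ab; [left|right]; nia. Qed.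

Definition mesh_point (v : grid n) : R * R :=
  ((v.1%:R - O%:R) / N%:R, (v.2%:R - O%:R) / N%:R).
(** Cells are closed, so that they cover and neighbouring cells meet. *)
Definition in_cell (f : grid n) (z : R * R) : Prop :=
  [/\ f.1%:R <= z.1 * N%:R + O%:R, z.1 * N%:R + O%:R <= f.1%:R + 1,
      f.2%:R <= z.2 * N%:R + O%:R & z.2 * N%:R + O%:R <= f.2%:R + 1].
Definition outer_cell (f : grid n) : Prop := [/\ (f.1 < n)%N, (f.2 < n)%N & hole f = None].

Let NR : 0 < N%:R :> R.
Proof. by rewrite ltr0n. Qed.

Let ctrE (a : 'I_m) : (ctr a)%:R = O%:R + 4 * a%:R * N%:R :> R.
Proof. by rewrite /ctr natrD !natrM. Qed.

Let norm_scale (x : R) : `|x| * N%:R = `|x * N%:R|.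
Proof. by rewrite normrM (ger0_norm (ltW NR)). Qed.

Let scaled_norm (z : R * R) (a : 'I_m) : `|z - hole_center R a| * N%:R =
  Num.max `|z.1 * N%:R + O%:R - (ctr a)%:R| `|z.2 * N%:R + O%:R - O%:R|.
Proof.
rewrite norm_pair (maxr_pMl _ _ (ltW NR)) !norm_scale /hole_center /=.
by congr Num.max; congr (`|_|); rewrite ?ctrE; ring.
Qed.

Let mesh_scaled v : (mesh_point v).1 * N%:R + O%:R = v.1%:R /\ (mesh_point v).2 * N%:R + O%:R = v.2%:R.
Proof. by rewrite /mesh_point /= !divfK ?gt_eqF // !subrK. Qed.

Let outer_not_in f a : outer_cell f -> ~~ in_hole N O ctr a f.1 f.2.
Proof.
case=> _ _; rewrite /grid_hole; case: pickP => // h _; exact: (negbT (h a)).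
Qed.

Let not_in_outer (f : grid n) : (f.1 < n)%N -> (f.2 < n)%N ->
  (forall a, ~~ in_hole N O ctr a f.1 f.2) -> outer_cell f.
Proof.
move=> f1 f2 h; split=> //; rewrite /grid_hole; case: pickP => // a.
by rewrite (negbTE (h a)).
Qed.

Let cornersP (f v : grid n) : (f.1 < n)%N -> (f.2 < n)%N -> v \in corners f =
  (((v.1 == f.1 :> nat) || (v.1 == f.1.+1 :> nat)) && ((v.2 == f.2 :> nat) || (v.2 == f.2.+1 :> nat))).
Proof.
move=> f1 f2; rewrite inE -!val_eqE /= !modn_small //.
Qed.

Let cell_at (i j : nat) : grid n := (inord i, inord j).
Let cell_atE i j : (i <= n)%N -> (j <= n)%N -> (cell_at i j).1 = i :> nat /\ (cell_at i j).2 = j :> nat.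
Proof. by move=> hi hj; rewrite /= !inordK. Qed.

(** A point outside the holes may lie in a cell of a hole when it is on the rim, on
    the left or lower side of that cell; the next cell across the rim contains it as
    well. *)
Lemma cell_exists z : holed_plane m z -> `|z| <= B%:R - 1 ->
  exists2 f, outer_cell f & in_cell f z.
Proof.
move=> hz; rewrite norm_pair ge_max !ler_norml => /andP[/andP[x1 x2] /andP[y1 y2]].
set X := z.1 * N%:R + O%:R; set Y := z.2 * N%:R + O%:R.
have OB : O%:R = B%:R * N%:R :> R by rewrite /O natrM.
have nO : n%:R = O%:R + O%:R :> R by rewrite -natrD /n /O; congr (_%:R); lia.
have N1 : 1 <= N%:R :> R by rewrite ler1n.
have X0 : 1 <= X by rewrite /X OB; nra.
have Y0 : 1 <= Y by rewrite /Y OB; nra.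
have Xn : X < n%:R by rewrite nO /X OB; nra.
have Yn : Y < n%:R by rewrite nO /Y OB; nra.
have /andP[iX Xi] := truncn_itv (le_trans ler01 X0).
have /andP[jY Yj] := truncn_itv (le_trans ler01 Y0).
set i := Num.truncn X in iX Xi; set j := Num.truncn Y in jY Yj.
have ni : (i < n)%N by rewrite -(ltr_nat R); exact: le_lt_trans Xn.
have nj : (j < n)%N by rewrite -(ltr_nat R); exact: le_lt_trans Yn.
have i0 : (0 < i)%N by rewrite -ltnS -(ltr_nat R); apply: le_lt_trans Xi.
have j0 : (0 < j)%N by rewrite -ltnS -(ltr_nat R); apply: le_lt_trans Yj.
rewrite -!natr1 in Xi Yj.
have [e1 e2] := cell_atE (ltnW ni) (ltnW nj).
have [[a ha]|nh] := pselect (exists a, in_hole N O ctr a i j); last first.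
  exists (cell_at i j).
    by apply: not_in_outer; rewrite ?e1 ?e2 // => a; apply/negP => ha; apply: nh; exists a.
  by split; rewrite ?e1 ?e2 // ltW.
have uniq b : in_hole N O ctr b i.-1 j \/ in_hole N O ctr b i j.-1 -> b = a.
  move=> h; apply/eqP; apply: contraT => /ctr_sep; move: ha h.
  by rewrite /in_hole; move: N_gt0 i0 j0; clear; lia.
have := scaled_norm z a; rewrite -/X -/Y => sn.
have : N%:R <= Num.max `|X - (ctr a)%:R| `|Y - O%:R|.
  by rewrite -sn; apply: (ler_peMl (ltW NR)); exact: hz.
have : (ctr a)%:R <= i%:R + N%:R :> R /\ i%:R + 1 <= (ctr a)%:R + N%:R :> R.
  by rewrite -natrD natr1 -natrD !ler_nat; move: ha; rewrite /in_hole; clear; lia.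
have : O%:R <= j%:R + N%:R :> R /\ j%:R + 1 <= O%:R + N%:R :> R.
  by rewrite -natrD natr1 -natrD !ler_nat; move: ha; rewrite /in_hole; clear; lia.
move=> [b1 b2] [b3 b4]; rewrite le_max => /orP[|]; rewrite ler_normr => /orP[] h.
- by exfalso; lra.
- have iE : i%:R + N%:R = (ctr a)%:R :> R by lra.
  have iE' : (i + N = ctr a)%N by apply/eqP; rewrite -(eqr_nat R) natrD iE.
  have [e3 e4] := cell_atE (leq_trans (leq_pred i) (ltnW ni)) (ltnW nj).
  exists (cell_at i.-1 j).
    apply: not_in_outer; rewrite ?e3 ?e4 //; first exact: leq_ltn_trans (leq_pred _) ni.
    move=> b; apply/negP => hb; have ba := uniq b (or_introl hb).
    by move: hb iE' i0; rewrite ba /in_hole; clear; lia.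
  have pi : i.-1%:R = i%:R - 1 :> R by rewrite -[X in _ = X%:R - _](prednK i0) -natr1 addrK.
  by split; rewrite ?e3 ?e4 ?pi -/X -/Y; lra.
- by exfalso; lra.
- have jE : j%:R + N%:R = O%:R :> R by lra.
  have jE' : (j + N = O)%N by apply/eqP; rewrite -(eqr_nat R) natrD jE.
  have [e3 e4] := cell_atE (ltnW ni) (leq_trans (leq_pred j) (ltnW nj)).
  exists (cell_at i j.-1).
    apply: not_in_outer; rewrite ?e3 ?e4 //; first exact: leq_ltn_trans (leq_pred _) nj.
    move=> b; apply/negP => hb; have ba := uniq b (or_intror hb).
    by move: hb jE' j0; rewrite ba /in_hole; clear; lia.
  have pj : j.-1%:R = j%:R - 1 :> R by rewrite -[X in _ = X%:R - _](prednK j0) -natr1 addrK.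
  by split; rewrite ?e3 ?e4 ?pj -/X -/Y; lra.
Qed.

Lemma corner_holed f v : outer_cell f -> v \in corners f -> holed_plane m (mesh_point v).
Proof.
move=> of_; have [f1 f2 _] := of_; rewrite cornersP // => vf a am.
rewrite leNgt; apply/negP => va.
have [s1 s2] := mesh_scaled v.
have := scaled_norm (mesh_point v) (Ordinal am); rewrite s1 s2 => sn.
have : Num.max `|v.1%:R - (ctr (Ordinal am))%:R| `|v.2%:R - O%:R| < N%:R :> R.
  by rewrite -sn gtr_pMl.
rewrite gt_max !ltr_norml => /andP[/andP[a1 a2] /andP[a3 a4]].
have : ((ctr (Ordinal am))%:R < v.1%:R + N%:R :> R) /\ (v.1%:R < (ctr (Ordinal am))%:R + N%:R :> R) by split; lra.
have : (O%:R < v.2%:R + N%:R :> R) /\ (v.2%:R < O%:R + N%:R :> R) by split; lra.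
rewrite -!natrD !ltr_nat => h1 h2; have := outer_not_in (Ordinal am) of_.
by move: vf h1 h2; rewrite /in_hole; clear; lia.
Qed.

Lemma corner_near f z v : outer_cell f -> in_cell f z -> v \in corners f ->
  `|z - mesh_point v| <= N%:R^-1.
Proof.
move=> [f1 f2 _] [c1 c2 c3 c4]; rewrite cornersP // => /andP[v1 v2].
have [s1 s2] := mesh_scaled v.
have h1 : (f.1%:R <= v.1%:R :> R) /\ (v.1%:R <= f.1%:R + 1 :> R).
  by rewrite natr1 !ler_nat; case/orP: v1 => /eqP ->.
have h2 : (f.2%:R <= v.2%:R :> R) /\ (v.2%:R <= f.2%:R + 1 :> R).
  by rewrite natr1 !ler_nat; case/orP: v2 => /eqP ->.
rewrite -(ler_pM2r NR) mulVf ?gt_eqF// norm_pair (maxr_pMl _ _ (ltW NR)).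
rewrite !norm_scale ge_max !mulrBl /=.
case: h1 h2 => [h1 h1'] [h2 h2'].
rewrite /= in s1 s2; apply/andP; split; rewrite ler_norml; lra.
Qed.

Lemma cells_share_corner f f' z : outer_cell f -> outer_cell f' ->
  in_cell f z -> in_cell f' z -> exists2 v, v \in corners f & v \in corners f'.
Proof.
move=> [f1 f2 _] [g1 g2 _] [c1 c2 c3 c4] [d1 d2 d3 d4].
have : (f.1%:R <= f'.1%:R + 1 :> R /\ f'.1%:R <= f.1%:R + 1 :> R) by split; lra.
have : (f.2%:R <= f'.2%:R + 1 :> R /\ f'.2%:R <= f.2%:R + 1 :> R) by split; lra.
rewrite !natr1 !ler_nat => -[h1 h2] [h3 h4].
have [e1 e2] := @cell_atE (maxn f.1 f'.1) (maxn f.2 f'.2)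
  ltac:(by rewrite geq_max !leq_ord) ltac:(by rewrite geq_max !leq_ord).
exists (cell_at (maxn f.1 f'.1) (maxn f.2 f'.2)); rewrite cornersP // e1 e2.
  by move: h1 h2 h3 h4; clear; lia.
by move: h1 h2 h3 h4; clear; lia.
Qed.

Lemma frame_corner f z (a : 'I_m) : outer_cell f -> in_cell f z ->
  `|z - hole_center R a| = 1 ->
  exists2 v, v \in corners f & on_frame N O ctr a v.1 v.2.
Proof.
move=> [f1 f2 _] [c1 c2 c3 c4] za; have := scaled_norm z a; rewrite za mul1r => sn.
move: c1 c2 c3 c4 sn; set X := z.1 * _ + _; set Y := z.2 * _ + _ => c1 c2 c3 c4 sn.
have [p1 p2] : `|X - (ctr a)%:R| <= N%:R /\ `|Y - O%:R| <= N%:R.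
  by rewrite sn !le_max !lexx orbT.
move: p1 p2; rewrite !ler_norml => /andP[p1 p2] /andP[p3 p4].
have q1 : f.1%:R <= (ctr a)%:R + N%:R :> R /\ (ctr a)%:R <= f.1%:R + 1 + N%:R :> R by split; lra.
have q2 : f.2%:R <= O%:R + N%:R :> R /\ O%:R <= f.2%:R + 1 + N%:R :> R by split; lra.
have q3 : [\/ (f.1%:R <= (ctr a)%:R - N%:R :> R) /\ ((ctr a)%:R - N%:R <= f.1%:R + 1 :> R),
    (f.1%:R <= (ctr a)%:R + N%:R :> R) /\ ((ctr a)%:R + N%:R <= f.1%:R + 1 :> R),
    (f.2%:R <= O%:R - N%:R :> R) /\ (O%:R - N%:R <= f.2%:R + 1 :> R) |
    (f.2%:R <= O%:R + N%:R :> R) /\ (O%:R + N%:R <= f.2%:R + 1 :> R)].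
  have : (`|X - (ctr a)%:R| == N%:R) || (`|Y - O%:R| == N%:R).
    by rewrite {1 2}sn; case: (leP `|X - (ctr a)%:R| `|Y - O%:R|) => _; rewrite eqxx ?orbT.
  rewrite !eqr_norml ?(ltW NR) ?andbT => /orP[] /orP[] /eqP e.
  - by constructor 2; split; lra.
  - by constructor 1; split; lra.
  - by constructor 4; split; lra.
  - by constructor 3; split; lra.
have nat_facts : [/\ (f.1 <= ctr a + N)%N, (ctr a <= f.1.+1 + N)%N, (f.2 <= O + N)%N & (O <= f.2.+1 + N)%N].
  case: q1 q2 => [+ +] [+ +]; rewrite !natr1 -!natrD !ler_nat.
  by [].
have nat_q3 : [|| (f.1 + N <= ctr a <= f.1.+1 + N)%N, (f.1 <= ctr a + N <= f.1.+1)%N,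
    (f.2 + N <= O <= f.2.+1 + N)%N | (f.2 <= O + N <= f.2.+1)%N].
  by case: q3 => -[]; rewrite ?lerBrDr ?lerBlDr !natr1 -?natrD !ler_nat => -> ->; rewrite ?orbT.
have fn1 : (f.1.+1 <= n)%N by [].
have [i [j [hi hj ifr /andP[i_n j_n]]]] : exists i j, [/\ (i == f.1 :> nat) || (i == f.1.+1 :> nat),
    (j == f.2 :> nat) || (j == f.2.+1 :> nat), on_frame N O ctr a i j & (i <= n) && (j <= n)]%N.
  by case: nat_facts => u1 u2 u3 u4; exact: frame_corner_nat u1 u2 u3 u4 nat_q3.
have [e1 e2] := cell_atE i_n j_n.
by exists (cell_at i j); rewrite ?cornersP ?e1 ?e2 // hi.
Qed.

Let natR_eq (i j : nat) : i = j -> i%:R = j%:R :> R.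
Proof. by move=> ->. Qed.

Let natR_add (i j k l : nat) : (i + j = k + l)%N -> i%:R + j%:R = k%:R + l%:R :> R.
Proof. by rewrite -!natrD => ->. Qed.

Let natR_double (i j k : nat) : (i + j = 2 * k)%N -> i%:R + j%:R = k%:R * 2 :> R.
Proof. by rewrite -natrD -natrM mulnC => ->. Qed.

Variable r : @holed_sphere R m -> @holed_sphere R m -> Prop.
Hypothesis scheme : gluing_scheme tau flip r.
Local Notation pp := (plane_point r).
Local Notation sv := (@surface_vertex n m N O ctr tauI flip).
Local Notation hull := (@cell_hull n m N O ctr tauI flip).
Local Notation touch := (@touching n m N O ctr tauI flip).

Let frame_real a (v : grid n) : on_frame N O ctr a v.1 v.2 -> `|mesh_point v - hole_center R a| = 1.
Proof.
move=> /and5P[h1 h2 h3 h4 h5]; apply: (mulIf (lt0r_neq0 NR)); rewrite mul1r scaled_norm.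
have [-> ->] := mesh_scaled v.
move: h1 h2 h3 h4 h5; move: (ctr a) O => c o; rewrite -!(ler_nat R) !natrD => h1 h2 h3 h4 h5.
apply/eqP; rewrite eq_le ge_max le_max !ler_norml !ler_normr; apply/andP; split.
  by apply/andP; split; apply/andP; split; lra.
case/or4P: h5 => /eqP e; have := natR_eq e; rewrite natrD => e'.
- by apply/orP; left; apply/orP; right; lra.
- by apply/orP; left; apply/orP; left; lra.
- by apply/orP; right; apply/orP; right; lra.
- by apply/orP; right; apply/orP; left; lra.
Qed.

Let sV_nat v a : frame_of N O ctr v = Some a ->
  [/\ on_frame N O ctr a v.1 v.2, ((sV v).1 + v.1 = ctr a + ctr (tauI a))%N &
    (if flip then (sV v).2 + v.2 = 2 * O else (sV v).2 = v.2 :> nat)%N].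
Proof.
move=> va; have oa := introT (frame_ofP N_gt0 N_lt_O O_lt_n ctr_sep v a) va.
have [_ -> ->] := grid_sV_frame tauI flip N_gt0 N_lt_O O_lt_n N_lt_ctr ctr_lt_n ctr_sep va.
split=> //.
  have := N_lt_ctr (tauI a); rewrite /mirror_x; move: oa; rewrite /on_frame.
  by move: (ctr _) (ctr _) => ? ?; clear; lia.
rewrite /mirror_y; move: oa N_lt_O; rewrite /on_frame; move: O (ctr a) => ? ?.
by case: flip; clear => //; lia.
Qed.

Let sV_glued v a : frame_of N O ctr v = Some a ->
  glued m tau flip (mesh_point v) (mesh_point (sV v)).
Proof.
move=> /sV_nat[/frame_real va e1 e2]; exists a; split=> //.
move/natR_add: e1 => e1.
rewrite /mirror /mesh_point; congr (_, _) => /=.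
  rewrite (_ : (sV v).1%:R = (ctr a)%:R + (ctr (tauI a))%:R - v.1%:R :> R); last by rewrite -e1 addrK.
  by rewrite !ctrE /=; field; rewrite gt_eqF.
move: (sV v) e2 => w; case: flip => [|->//].
move=> /natR_double e2; rewrite (_ : w.2%:R = O%:R * 2 - v.2%:R :> R); last by rewrite -e2 addrK.
by field; rewrite gt_eqF.
Qed.

Lemma surface_vertex_point v : holed_plane m (mesh_point v) ->
  holed_plane m (mesh_point (sv v)) /\ pp (mesh_point (sv v)) = pp (mesh_point v).
Proof.
move=> hv; rewrite /surface_vertex /kappa; case: ifP => // _.
case va : (frame_of N O ctr v) => [a|]; last by rewrite /grid_sV va.
have g := sV_glued va; have [_ hw] := glued_holed tauK tau_m g.
by split=> //; apply/(plane_point_eq scheme) => //; right; exact: glued_sym.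
Qed.

Let sv_sV v : sv (sV v) = sv v.
Proof.
apply: kappa_sV.
- exact: grid_sVK.
- by move=> x; apply: grid_sV_neq.
- by move=> x; apply: grid_sV_id.
Qed.

Let svI f v g w : v \in corners f -> w \in corners g -> sv v = sv w ->
  ((sv @: corners f) :&: (sv @: corners g) != finset.set0)%SET.
Proof.
move=> vf wg e; apply/finset.set0Pn; exists (sv v); rewrite finset.inE imset_f //.
by rewrite e imset_f.
Qed.

(** Crossing a glued rim leads from a cell to a cell with the same corner on the
    surface. *)
Lemma mirror_cell f z (a : 'I_m) : outer_cell f -> in_cell f z -> `|z - hole_center R a| = 1 ->
  exists g, [/\ outer_cell g, in_cell g (mirror tau flip a z) &
    ((sv @: corners f) :&: (sv @: corners g) != finset.set0)%SET].
Proof.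
move=> of_ cz za; have [v vf va] := frame_corner of_ cz za.
have [f1 f2 _] := of_; have [c1 c2 c3 c4] := cz.
have fa := elimT (frame_ofP N_gt0 N_lt_O O_lt_n ctr_sep v a) va.
have [_ s1 s2] := sV_nat fa.
have vf' := vf; rewrite cornersP // in vf'.
pose g1 := (ctr a + ctr (tauI a) - f.1.+1)%N; pose g2 := (if flip then 2 * O - f.2.+1 else f.2)%N.
have G1 : (g1 + f.1.+1 = ctr a + ctr (tauI a))%N.
  rewrite /g1; have := N_lt_ctr (tauI a); move: va vf'; rewrite /on_frame.
  by move: (ctr _) (ctr _) => ? ?; clear; lia.
have G2 : if flip then (g2 + f.2.+1 = 2 * O)%N else g2 = f.2.
  rewrite /g2; move: va vf' N_lt_O; rewrite /on_frame; move: O (ctr a) => ? ?.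
  by case: flip; clear => //; lia.
have g1n : (g1 < n)%N.
  have := ctr_lt_n (tauI a); move: G1 va vf'; rewrite /on_frame.
  by clear; lia.
have g2n : (g2 < n)%N.
  move: G2 O_lt_n va vf' f2; rewrite /on_frame.
  by case: flip; clear; lia.
have [e1 e2] := cell_atE (ltnW g1n) (ltnW g2n).
exists (cell_at g1 g2); split.
- apply: not_in_outer; rewrite ?e1 ?e2 // => b.
  have [->|/ctr_sep sep] := eqVneq b (tauI a).
    apply: contra (outer_not_in a of_); move: G1 G2; rewrite /in_hole; clear.
    by move: O (ctr _) (ctr _) => ? ? ?; case: flip; lia.
  apply/negP; move: sep G1 va vf' N_gt0; rewrite /on_frame /in_hole; clear.
  by move: (ctr _) (ctr _) (ctr _) O => ? ? ? ?; lia.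
- move/natR_add: G1; rewrite -natr1 => G1.
  have X : (mirror tau flip a z).1 * N%:R + O%:R = (ctr a)%:R + (ctr (tauI a))%:R - (z.1 * N%:R + O%:R).
    by rewrite !ctrE /mirror /=; ring.
  rewrite /in_cell X e1 e2; clear X.
  have : g2%:R <= (mirror tau flip a z).2 * N%:R + O%:R /\ (mirror tau flip a z).2 * N%:R + O%:R <= g2%:R + 1.
    move: G2; rewrite /mirror /=; case: flip => [G2|->//].
    move/natR_double: G2; rewrite -natr1 => G2.
    by rewrite mulNr; split; lra.
  by case=> h1 h2; split=> //; lra.
- apply: (svI vf (w := sV v)); last by rewrite sv_sV.
  rewrite cornersP ?e1 ?e2 //; move: vf' G1 G2 s1 s2.
  by move: O (ctr _) (ctr _) => ? ? ?; case: flip; clear; lia.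
Qed.

Definition touched (K : set (glued_space r)) : {set grid n} :=
  [set f | `[< outer_cell f /\ exists2 z, plane_part K z & in_cell f z >]]%SET.

Lemma touchedP K f : reflect (outer_cell f /\ exists2 z, plane_part K z & in_cell f z) (f \in touched K).
Proof. by rewrite finset.inE; exact: asboolP. Qed.

Let touch_share K f g v w : f \in touched K -> g \in touched K ->
  v \in corners f -> w \in corners g -> sv v = sv w -> touch (touched K) f g.
Proof. by move=> fT gT vf wg e; rewrite /touching fT gT (svI vf wg e). Qed.

Lemma touched_connect K f f' z z' : outer_cell f -> outer_cell f' -> plane_part K z -> plane_part K z' ->
  in_cell f z -> in_cell f' z' -> pp z = pp z' -> connect (touch (touched K)) f f'.
Proof.
move=> of_ of' Kz Kz' fz fz'; have [hz _] := Kz; have [hz' _] := Kz'.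
have T g x : outer_cell g -> plane_part K x -> in_cell g x -> g \in touched K.
  by move=> og Kx gx; apply/touchedP; split=> //; exists x.
have same g g' x : outer_cell g -> outer_cell g' -> plane_part K x ->
    in_cell g x -> in_cell g' x -> connect (touch (touched K)) g g'.
  move=> og og' Kx gx gx'; have [v vg vg'] := cells_share_corner og og' gx gx'.
  by apply: connect1; apply: (touch_share (T _ _ og Kx gx) (T _ _ og' Kx gx') vg vg').
move=> /(plane_point_eq scheme hz hz')[zz|[a [am za z'E]]].
  by apply: (same _ _ z) => //; rewrite zz.
have [g [og gz fg]] := mirror_cell (a := Ordinal am) of_ fz za; rewrite /= -z'E in gz.
apply: (connect_trans (y := g)); last exact: (same _ _ z').
by apply: connect1; rewrite /touching (T _ z) // (T _ z').
Qed.

Lemma in_cell_closed f : closed [set z : R * R | in_cell f z]%classic.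
Proof.
have c1 : continuous (fun z : R * R => z.1 * N%:R + O%:R).
  by move=> z; apply: cvgD; [apply: cvgM; [exact: cvg_fst | exact: cvg_cst] | exact: cvg_cst].
have c2 : continuous (fun z : R * R => z.2 * N%:R + O%:R).
  by move=> z; apply: cvgD; [apply: cvgM; [exact: cvg_snd | exact: cvg_cst] | exact: cvg_cst].
rewrite (_ : [set z | _]%classic = 
  ((fun z : R * R => z.1 * N%:R + O%:R) @^-1` [set x | f.1%:R <= x] `&`
  (fun z : R * R => z.1 * N%:R + O%:R) @^-1` [set x | x <= f.1%:R + 1] `&`
  ((fun z : R * R => z.2 * N%:R + O%:R) @^-1` [set x | f.2%:R <= x] `&`
  (fun z : R * R => z.2 * N%:R + O%:R) @^-1` [set x | x <= f.2%:R + 1]))%classic); last first.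
  by apply/seteqP; split=> z; [case | case=> -[? ?] [? ?]].
by apply: closedI; apply: closedI; apply: closed_comp => [z _|]; 
  try exact: c1; try exact: c2; try exact: closed_ge; exact: closed_le.
Qed.

(** A compact connected set touches a connected cluster of cells: the images of
    the touched cells are finitely many closed sets covering it, so they cannot
    split into two groups without a common point. *)
Lemma touched_connected K : compact K -> connected K -> ~ K (infinity_point r) ->
  (forall z, plane_part K z -> `|z| <= B%:R - 1) ->
  {in touched K &, forall f f', connect (touch (touched K)) f f'}.
Proof.
move=> cK conK Kinf KB f0 f1 f0T f1T.
pose A (P : pred (grid n)) : set (glued_space r) :=
  (\bigcup_(f in [set` [pred f | (f \in touched K) && P f]]) (pp @` (plane_part K `&` [set z | in_cell f z])))%classic.
have clA P : closed (A P).
  apply: closed_bigcup => [|f _]; first exact: finite_finset.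
  apply: compact_closed; first exact: model_hausdorff scheme.
  apply: continuous_compact.
    apply: continuous_subspaceW (plane_point_continuous (r := r)).
    by move=> z [[hz _] _].
  apply: compact_closedI; last exact: in_cell_closed.
  exact: (plane_part_compact scheme cK Kinf).
pose P f := connect (touch (touched K)) f0 f.
have cover q : K q -> A P q \/ A (predC P) q.
  move=> Kq; have [qi|[z hz qz]] := plane_point_surj q; first by case: Kinf; rewrite -qi.
  have Kz : plane_part K z by split=> //; rewrite -qz.
  have [f of_ fz] := cell_exists hz (KB _ Kz).
  have fT : f \in touched K by apply/touchedP; split=> //; exists z.
  by case Pf : (P f); [left|right]; (exists f; [apply/andP; split; [exact: fT | rewrite /= ?Pf] | exists z]).
have AK Q q : A Q q -> K q by case=> f _ [z [[_ Kz] _] <-].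
have disj q : A P q -> A (predC P) q -> False.
  case=> f /andP[/= /touchedP[of_ _] Pf] [z [Kz fz] <-].
  case=> g /andP[/= /touchedP[og _] Pg] [z' [Kz' gz] e].
  by case/negP: Pg; apply: connect_trans Pf _; exact: touched_connect Kz Kz' fz gz (esym e).
have /touchedP[of0 [z0 Kz0 fz0]] := f0T; have /touchedP[of1 [z1 Kz1 fz1]] := f1T.
have APK : A P = K.
  apply: conK.
  - by exists (pp z0); exists f0; [apply/andP; split=> //; exact: connect0 | exists z0].
  - exists (~` A (predC P))%classic; first exact: closed_openC.
    apply/seteqP; split=> q.
      by move=> Aq; split; [exact: AK Aq | move=> Aq'; exact: disj Aq Aq'].
    by case=> Kq nA; case: (cover q Kq).
  - by exists (A P) => //; apply/esym/setIidPr => q; exact: AK.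
have : A P (pp z1) by rewrite APK; case: Kz1.
case=> f /andP[/= /touchedP[of_ _] Pf] [z [Kz fz] e].
by apply: connect_trans Pf _; exact: touched_connect Kz Kz1 fz fz1 e.
Qed.

Lemma hull_connected K : compact K -> connected K -> ~ K (infinity_point r) ->
  (forall z, plane_part K z -> `|z| <= B%:R - 1) ->
  connected_set (@surface_s n m N O ctr tauI flip) (@surface_t n m N O ctr tauI flip) (hull (touched K)).
Proof.
move=> cK conK Ki KB; apply: cell_hull_connected => //.
  by move=> f /touchedP[[]].
exact: touched_connected.
Qed.

Let corner_self (f : grid n) : f \in corners f.
Proof. by rewrite finset.inE !eqxx. Qed.

Lemma hull_meet K K' q : ~ K (infinity_point r) ->
  (forall z, plane_part K z -> `|z| <= B%:R - 1) -> K q -> K' q ->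
  (hull (touched K) :&: hull (touched K') != finset.set0)%SET.
Proof.
move=> Ki KB Kq Kq'; have [qi|[z hz qz]] := plane_point_surj q; first by case: Ki; rewrite -qi.
rewrite qz in Kq Kq'; have [f of_ fz] := cell_exists hz (KB _ (conj hz Kq)).
have fT (L : set (glued_space r)) : L (pp z) -> f \in touched L by move=> Lz; apply/touchedP; split=> //; exists z.
apply/finset.set0Pn; exists (sv f); rewrite finset.inE; apply/andP; split; apply/bigcupP; exists f;
  by rewrite ?fT // imset_f.
Qed.

Lemma hull_disjoint K K' : @mesh_separated R m r K K' N%:R^-1 ->
  (hull (touched K) :&: hull (touched K') = finset.set0)%SET.
Proof.
move=> sep; apply/eqP; rewrite -finset.subset0; apply/fintype.subsetP => x.
rewrite finset.inE => /andP[/bigcupP[f /touchedP[of_ [z Kz fz]] /imsetP[v vf xv]]].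
move=> /bigcupP[f' /touchedP[of' [z' Kz' fz']] /imsetP[v' vf' xv']]; exfalso.
have hv := corner_holed of_ vf; have hv' := corner_holed of' vf'.
have [_ e] := surface_vertex_point hv; have [_ e'] := surface_vertex_point hv'.
apply: (sep z z' _ _ Kz Kz' hv hv' _ (corner_near of_ fz vf) (corner_near of' fz' vf')).
by rewrite -e -e' -xv -xv'.
Qed.

(** Compact connected sets that the mesh tells apart may be replaced by their
    hulls, which are the branch sets and the connections of a minor. *)
Lemma mesh_curve_bound (I J : finType) (u v : J -> I) (X : I -> set (glued_space r))
    (Y : J -> set (glued_space r)) :
  (forall j, u j != v j) ->
  (forall j k, (u j = u k /\ v j = v k) \/ (u j = v k /\ v j = u k) -> j = k) ->
  (forall w, [/\ compact (X w), connected (X w), (X w !=set0)%classic & ~ X w (infinity_point r)]) ->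
  (forall j, [/\ compact (Y j), connected (Y j), (Y j !=set0)%classic & ~ Y j (infinity_point r)]) ->
  (forall w z, plane_part (X w) z -> `|z| <= B%:R - 1) ->
  (forall j z, plane_part (Y j) z -> `|z| <= B%:R - 1) ->
  (forall w w', w != w' -> @mesh_separated R m r (X w) (X w') N%:R^-1) ->
  (forall j j', j != j' -> @mesh_separated R m r (Y j) (Y j') N%:R^-1) ->
  (forall j w, w != u j -> w != v j -> @mesh_separated R m r (Y j) (X w) N%:R^-1) ->
  (forall j, Y j `&` X (u j) !=set0)%classic -> (forall j, Y j `&` X (v j) !=set0)%classic ->
  (#|J| <= 3 * (#|I| + (2 + m) + m))%N.
Proof.
move=> loopless simple Xok Yok bX bY XX YY XY Yu Yv.
apply: (@surface_minor_bound n m N O ctr tauI flip tauIK tauI_flip N_gt0 N_lt_O O_lt_n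
   N_lt_ctr ctr_lt_n ctr_sep J I u v (Ordinal m_gt0)
   (fun w => hull (touched (X w))) (fun j => hull (touched (Y j))) loopless simple).
- by move=> w; have [? ? _ ?] := Xok w; apply: hull_connected => //; exact: bX.
- move=> w; have [_ _ [q Xq] Xi] := Xok w.
  by have := hull_meet Xi (bX w) Xq Xq; rewrite finset.setIid.
- by move=> j; have [? ? _ ?] := Yok j; apply: hull_connected => //; exact: bY.
- by move=> w w' /XX; exact: hull_disjoint.
- by move=> j j' /YY; exact: hull_disjoint.
- by move=> j w wu wv; apply: hull_disjoint; exact: XY.
- by move=> j; have [q [Yq Xq]] := Yu j; have [_ _ _ Yi] := Yok j; apply: hull_meet Yi (bY j) Yq Xq.
- by move=> j; have [q [Yq Xq]] := Yv j; have [_ _ _ Yi] := Yok j; apply: hull_meet Yi (bY j) Yq Xq.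
Qed.

End Cells.

(** * Systems of curves on a surface *)

Section PairCounts.
Import mathcomp.boot.fintype mathcomp.boot.finset.
Local Open Scope nat_scope.

Definition edge_pairs (V : finType) (e : rel V) : {set V * V} := [set p | e p.1 p.2].

Lemma edge_pairs_within (V : finType) (e : rel V) (W : {set V}) :
  \sum_(x in W) #|[set y in W | e x y]| <=
  #|edge_pairs (fun x y : {x | x \in W} => e (val x) (val y))|.
Proof.
have -> : \sum_(x in W) #|[set y in W | e x y]| =
    #|[set p : V * V | [&& p.1 \in W, p.2 \in W & e p.1 p.2]]|.
  rewrite -sum1_card (eq_bigl (fun p : V * V => (p.1 \in W) && ((p.2 \in W) && e p.1 p.2))); last first.
    by move=> p; rewrite inE.
  rewrite -(pair_big_dep (mem W) (fun x y => (y \in W) && e x y) (fun _ _ => 1)) /=.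
  by apply: eq_bigr => x _; rewrite sum1_card; apply: eq_card => y; rewrite inE.
apply: leq_trans (leq_imset_card (fun p : {x | x \in W} * {x | x \in W} => (val p.1, val p.2)) _).
apply/subset_leq_card/subsetP => -[x y]; rewrite inE /= => /and3P[xW yW xy].
by apply/imsetP; exists (exist _ x xW, exist _ y yW); rewrite ?inE.
Qed.

Lemma edge_pairs_delete (V : finType) (e : rel V) (x0 : V) :
  #|edge_pairs e| <= #|edge_pairs (fun x y : {x | x != x0} => e (val x) (val y))| + 2 * #|V|.
Proof.
set E' := edge_pairs (fun x y : {x | x != x0} => _).
have sub : edge_pairs e \subset
  ((fun p : {x | x != x0} * {x | x != x0} => (val p.1, val p.2)) @: E') :|:
  (((fun y => (x0, y)) @: [set: V]) :|: ((fun y => (y, x0)) @: [set: V])).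
  apply/subsetP => -[x y]; rewrite !inE /= => xy.
  have [->|xx0] := eqVneq x x0; first by rewrite orbC imset_f ?inE.
  have [->|yx0] := eqVneq y x0; first by rewrite orbA orbC imset_f ?inE.
  by apply/orP; left; apply/imsetP; exists (exist _ x xx0, exist _ y yx0); rewrite ?inE.
apply: leq_trans (subset_leq_card sub) _; apply: leq_trans (leq_card_setU _ _) _.
rewrite leq_add ?leq_imset_card //; apply: leq_trans (leq_card_setU _ _) _.
by rewrite mul2n -addnn -[#|V|]cardsT leq_add ?leq_imset_card.
Qed.

(** An undirected edge is counted once, from its endpoint of smaller rank. *)
Definition upward_pair (V : finType) (e : rel V) : pred (V * V) :=
  fun p => e p.1 p.2 && (enum_rank p.1 < enum_rank p.2).

Lemma edge_pairs_upward (V : finType) (e : rel V) : symmetric e -> irreflexive e ->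
  #|edge_pairs e| <= 2 * #|{: {p : V * V | upward_pair e p}}|.
Proof.
move=> es ei; rewrite card_sig.
have sub : edge_pairs e \subset [set p | upward_pair e p] :|:
   ((fun p : V * V => (p.2, p.1)) @: [set p | upward_pair e p]).
  apply/subsetP => -[x y]; rewrite !inE /upward_pair /= => xy.
  case: (ltngtP (enum_rank x) (enum_rank y)) => h; first by rewrite xy.
    by apply/orP; right; apply/imsetP; exists (y, x); rewrite ?inE //= es xy.
  by move/ord_inj/enum_rank_inj: h => h; rewrite h ei in xy.
apply: leq_trans (subset_leq_card sub) _; apply: leq_trans (leq_card_setU _ _) _.
have c : #|[set p | upward_pair e p]| = #|[pred p | upward_pair e p]|.
  by apply: eq_card => p; rewrite !inE.
rewrite mul2n -addnn -c leq_add //; exact: leq_imset_card.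
Qed.

Lemma upward_pair_inj (V : finType) (e : rel V) (p q : V * V) :
  upward_pair e p -> upward_pair e q -> [set p.1; p.2] = [set q.1; q.2] -> p = q.
Proof.
case: p q => [x y] [x' y'] /andP[/= _ xy] /andP[/= _ xy'] /setP E.
have := E x; have := E y; have := E x'; have := E y'; rewrite !inE !eqxx /= ?orbT.
move=> e1 e2 e3 e4; case/esym/orP: e4 => /eqP e4; case/esym/orP: e3 => /eqP e3; subst.
- by rewrite ltnn in xy.
- by [].
- by have := ltn_trans xy xy'; rewrite ltnn.
- by rewrite ltnn in xy.
Qed.
End PairCounts.

Section CurveBound.
Local Open Scope ring_scope.
Local Open Scope classical_set_scope.
Variables (R : realType) (m : nat) (tau : nat -> nat) (flip : bool).
Hypothesis tau_flip : forall a, flip || (tau a != a).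
Hypothesis m_gt0 : (0 < m)%N.
Variable r : @holed_sphere R m -> @holed_sphere R m -> Prop.
Hypothesis scheme : gluing_scheme tau flip r.
Let S := glued_space r.

Definition away_compact_connected (K : set S) :=
  [/\ compact K, connected K, K !=set0 & ~ K (infinity_point r)].

Let common_bound (I : finType) (X : I -> set S) : (forall w, away_compact_connected (X w)) ->
  exists B : nat, forall w z, plane_part (X w) z -> `|z| <= B%:R - 1.
Proof.
move=> Xok.
have [M HM] := choice (fun w => let: And4 cX _ _ Xi := Xok w in model_bounded scheme cX Xi).
exists (\max_(w : I) (Num.truncn (M w)).+2)%N => w z [hz Xz].
apply: le_trans (HM w z hz Xz) _; rewrite lerBrDr.
apply: (@le_trans _ _ ((Num.truncn (M w)).+2%:R)).
  by rewrite -natr1 lerD2r ltW // truncnS_gt.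
by rewrite ler_nat; exact: (leq_bigmax_cond (F := fun w => (Num.truncn (M w)).+2)).
Qed.

Let eventually_separated (I J : finType) (X : I -> set S) (Y : J -> set S) (P : pred (I * J)) :
  (forall w, away_compact_connected (X w)) -> (forall w, away_compact_connected (Y w)) ->
  (forall w w', P (w, w') -> X w `&` Y w' = set0) ->
  \forall N \near \oo, forall w w', P (w, w') -> @mesh_separated R m r (X w) (Y w') (N.+1%:R^-1).
Proof.
move=> Xok Yok dis; apply: filter_forall => w; apply: filter_forall => w'.
have [Pw|nP] := boolP (P (w, w')); last by near=> N.
have [cX _ _ Xi] := Xok w; have [cY _ _ Yi] := Yok w'.
have := mesh_separated_near scheme cX cY Xi Yi (dis _ _ Pw).
by apply: filterS.
Unshelve. all: by end_near.
Qed.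

(** Fattened to hulls of touched cells of a fine mesh, the curves become branch
    sets of a minor of the 1-skeleton, where the edge bound applies. *)
Theorem curve_system_bound (I J : finType) (u v : J -> I) (X : I -> set S) (Y : J -> set S) :
  (forall j, u j != v j) ->
  (forall j k, (u j = u k /\ v j = v k) \/ (u j = v k /\ v j = u k) -> j = k) ->
  (forall w, away_compact_connected (X w)) -> (forall j, away_compact_connected (Y j)) ->
  (forall w w', w != w' -> X w `&` X w' = set0) ->
  (forall j j', j != j' -> Y j `&` Y j' = set0) ->
  (forall j w, w != u j -> w != v j -> Y j `&` X w = set0) ->
  (forall j, Y j `&` X (u j) !=set0) -> (forall j, Y j `&` X (v j) !=set0) ->
  (#|J| <= 3 * (#|I| + (2 + m) + m))%N.
Proof.
move=> loopless simple Xok Yok XX YY XY Yu Yv.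
have [tauK tau_m _ _] := scheme.
have [B1 HB1] := common_bound Xok; have [B2 HB2] := common_bound Yok.
pose B := (4 * m + 2 + B1 + B2)%N.
have bX w z : plane_part (X w) z -> `|z| <= B%:R - 1.
  by move=> /HB1 h; apply: le_trans h _; rewrite lerD2r ler_nat /B; clear; lia.
have bY w z : plane_part (Y w) z -> `|z| <= B%:R - 1.
  by move=> /HB2 h; apply: le_trans h _; rewrite lerD2r ler_nat /B; clear; lia.
have Bl : (4 * m + 2 <= B)%N by rewrite /B; clear; lia.
have [N [[sXX sYY] sXY]] : exists N : nat, 
    ((forall w w', w != w' -> @mesh_separated R m r (X w) (X w') (N.+1%:R^-1)) /\
    (forall j j', j != j' -> @mesh_separated R m r (Y j) (Y j') (N.+1%:R^-1))) /\
    (forall j w, (w != u j) && (w != v j) -> @mesh_separated R m r (Y j) (X w) (N.+1%:R^-1)).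
  apply: (@filter_ex _ \oo); apply: filterI; first apply: filterI.
  - exact: (eventually_separated (P := fun p => p.1 != p.2) Xok Xok).
  - exact: (eventually_separated (P := fun p => p.1 != p.2) Yok Yok).
  - apply: (eventually_separated (P := fun p => (p.2 != u p.1) && (p.2 != v p.1)) Yok Xok) => j w.
    by case/andP; exact: XY.
apply: (mesh_curve_bound (N := N.+1) (B := B) tauK tau_m tau_flip m_gt0 _ Bl scheme loopless simple Xok Yok bX bY sXX sYY _ Yu Yv) => //.
by move=> j w wu wv; apply: sXY; rewrite wu wv.
Qed.

End CurveBound.

(** * Drawings have few edges *)

Lemma third_bounds (R : realType) (c : R) : (c = 3^-1)%R ->
  [/\ 0 < c, c * 3 = 1, c <= 1, c < 1 - c & 1 - c < 1]%R.
Proof.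
move=> ->; have h : ((3^-1 : R) * 3 = 1)%R by rewrite mulVf // pnatr_eq0.
have h0 : (0 < (3^-1 : R))%R by rewrite invr_gt0 ltr0n.
by move: h h0; move: (3^-1)%R => d h h0; split; lra.
Qed.

Lemma third_flip (R : realType) (c t t' : R) : (c < 1 - c -> c <= 1 ->
  0 < t -> t <= c -> 0 < t' -> t' <= c -> 0 <= 1 - t' <= 1 /\ t <> 1 - t')%R.
Proof. by move=> *; split; [apply/andP; split|]; lra. Qed.

Section Drawings.
Local Open Scope classical_set_scope.
Local Open Scope ring_scope.
Variable R : realType.

(** The data of an embedding, named in order to be restricted to subgraphs and
    transported along injective continuous maps. *)
Definition drawing (S : topologicalType) (V : finType) (e : rel V) (pt : V -> S)
    (arc : V -> V -> R -> S) : Prop :=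
  [/\ injective pt,
      forall x y, e x y ->
        [/\ {within `[0, 1], continuous (arc x y)},
            {in `[0, 1] &, injective (arc x y)},
            arc x y 0 = pt x, arc x y 1 = pt y
          & {in `[0, 1], forall t, arc y x t = arc x y (1 - t)}],
      forall x y z t, e x y -> t \in `]0, 1[ -> arc x y t <> pt z
    & forall x y z w s t, e x y -> e z w ->
        [set x; y]%SET != [set z; w]%SET ->
        s \in `]0, 1[ -> t \in `]0, 1[ -> arc x y s <> arc z w t].

Lemma drawing_map (S S' : topologicalType) (f : S -> S') (V : finType) (e : rel V) pt arc :
  continuous f -> injective f -> @drawing S V e pt arc ->
  drawing e (f \o pt) (fun x y => f \o arc x y).
Proof.
move=> cf fI [ptI axa axp axd]; split=> /=.
- exact: inj_comp.
- move=> x y exy; have [c i a0 a1 ar] := axa x y exy; split=> /=.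
  + by move=> t; apply: (@continuous_comp (subspace (`[0, 1] : set R)) S S' (arc x y) f); [exact: c | exact: cf].
  + by move=> s t s01 t01 /fI /i; apply.
  + by rewrite a0.
  + by rewrite a1.
  + by move=> t /ar ->.
- by move=> x y z t exy t01 /fI; exact: axp.
- by move=> x y z w s t exy ezw ne s01 t01 /fI; exact: axd.
Qed.

Lemma drawing_pre (S : topologicalType) (V V' : finType) (h : V' -> V) (e : rel V) pt arc :
  injective h -> @drawing S V e pt arc ->
  drawing (fun x y => e (h x) (h y)) (pt \o h) (fun x y => arc (h x) (h y)).
Proof.
move=> hI [ptI axa axp axd]; split=> /=.
- exact: inj_comp.
- by move=> x y /axa.
- by move=> x y z t exy; exact: axp.
- move=> x y z w s t exy ezw ne; apply: axd => //.
  apply: contra ne => /eqP E; apply/eqP; apply: (imset_inj hI).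
  by rewrite !imsetU1 !imset_set1.
Qed.

Section Bound.
Variables (m : nat) (tau : nat -> nat) (flip : bool).
Hypothesis tau_flip : forall a, flip || (tau a != a).
Hypothesis m_gt0 : (0 < m)%N.
Variable r : @holed_sphere R m -> @holed_sphere R m -> Prop.
Hypothesis scheme : gluing_scheme tau flip r.
Let S := glued_space r.

Section AwayFromInfinity.
Variables (V : finType) (e : rel V) (pt : V -> S) (arc : V -> V -> R -> S).
Hypothesis e_sym : symmetric e.
Hypothesis e_irr : irreflexive e.
Hypothesis draw : drawing e pt arc.
Hypothesis pt_finite : forall x, pt x <> infinity_point r.
Hypothesis arc_finite : forall x y t, e x y -> t \in `]0, 1[ -> arc x y t <> infinity_point r.

Let third : R := 3^-1.
Let third_gt0 : 0 < third. Proof. by have [] := third_bounds (erefl third). Qed.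

Let arc_ok x y (a b : R) : e x y -> 0 <= a -> a <= b -> b <= 1 ->
  away_compact_connected (arc x y @` `[a, b]).
Proof.
move=> exy a0 ab b1; have [_ axa _ _] := draw; have [c i arc0 arc1 ar] := axa x y exy.
have sub : `[a, b] `<=` `[(0 : R), 1].
  by move=> t /=; rewrite !in_itv /= => /andP[h1 h2]; rewrite (le_trans a0 h1) (le_trans h2 b1).
have cab : {within `[a, b], continuous (arc x y)} by exact: continuous_subspaceW c.
split.
- by apply: continuous_compact => //; exact: segment_compact.
- by apply: connected_continuous_connected => //; exact: segment_connected.
- by exists (arc x y a); exists a => //; rewrite /= in_itv /= lexx.
- move=> [t /sub /=]; rewrite in_itv /= => /andP[]; rewrite le_eqVlt => /orP[/eqP <- _|t0].
    by rewrite arc0; exact: pt_finite.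
  rewrite le_eqVlt => /orP[/eqP ->|t1]; first by rewrite arc1; exact: pt_finite.
  by apply: (arc_finite exy); rewrite in_itv /= t0 t1.
Qed.

(** The first third of every edge at [w] belongs to the star of [w]; the middle
    thirds connect the stars. *)
Let arm w x : set S := if e w x then arc w x @` `[0, third] else [set pt w].
Let star w : set S := \bigcup_(x in [set: V]) arm w x.
Let J := {p : V * V | upward_pair e p}.
Let middle (j : J) : set S := arc (val j).1 (val j).2 @` `[third, 1 - third].

Let third1 : third <= 1 /\ third < 1 - third /\ 1 - third < 1.
Proof. by have [] := third_bounds (erefl third). Qed.

Let arm_ok w x : away_compact_connected (arm w x) /\ arm w x (pt w).
Proof.
rewrite /arm; case: ifP => ewx.
  split; first by apply: arc_ok => //; [exact: ltW | case: third1].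
  have [_ axa _ _] := draw; have [_ _ <- _ _] := axa w x ewx.
  by exists 0 => //; rewrite /= in_itv /= lexx ltW.
split=> //; split; [exact: compact_set1 | exact: connected1 | by exists (pt w) |].
by move=> /= h; exact: (pt_finite (esym h)).
Qed.

Let star_ok w : away_compact_connected (star w).
Proof.
split.
- rewrite /star (_ : [set: V] = [set` predT]); last by apply/seteqP.
  rewrite bigcup_pred; apply: bigsetU_compact => x _; by case: (arm_ok w x) => [[]].
- apply: bigcup_connected => [|x _]; last by case: (arm_ok w x) => [[]].
  by exists (pt w) => x _; case: (arm_ok w x).
- by exists (pt w); exists w => //; case: (arm_ok w w).
- by case=> x _; case: (arm_ok w x) => [[]].
Qed.

Let starP w q : star w q -> q = pt w \/
  exists x t, [/\ e w x, 0 < t, t <= third & q = arc w x t].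
Proof.
case=> x _; rewrite /arm; case: ifP => ewx; last by left.
case=> t; rewrite /= in_itv /= => /andP[+ h2] <-; rewrite le_eqVlt => /orP[/eqP <-|t0].
  by left; have [_ axa _ _] := draw; have [_ _ -> _ _] := axa w x ewx.
by right; exists x, t.
Qed.

Let star_arc w x t : e w x -> 0 <= t -> t <= third -> star w (arc w x t).
Proof. by move=> ewx t0 t1; exists x => //; rewrite /arm ewx; exists t => //; rewrite /= in_itv /= t0. Qed.

Let star_disjoint w w' : w != w' -> star w `&` star w' = set0.
Proof.
have [ptI axa axp axd] := draw; have [t1 [t2 t3]] := third1.
have io t : 0 < t -> t <= third -> t \in `]0, 1[.
  by move=> h1 h2; rewrite in_itv /= h1 /=; apply: le_lt_trans h2 (lt_trans t2 t3).
move=> ww'; apply/seteqP; split=> // q [] /starP[->|[x [t [ewx h1 h2 ->]]]] /starP[].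
- by move/ptI/eqP; rewrite (negbTE ww').
- by case=> x' [t' [ewx' h1' h2' /esym]]; apply: axp => //; exact: io.
- by apply: axp => //; exact: io.
- case=> x' [t' [ewx' h1' h2' eq]].
  have [E|NE] := eqVneq [set w; x]%SET [set w'; x']%SET; last first.
    by apply: (axd _ _ _ _ t t' ewx ewx' NE) => //; exact: io.
  have : w \in [set w'; x']%SET by rewrite -E !inE eqxx.
  have : w' \in [set w; x]%SET by rewrite E !inE eqxx.
  rewrite !inE (negbTE ww') eq_sym (negbTE ww') /= => /eqP e1 /eqP e2.
  rewrite -e1 -e2 in eq ewx'; have [_ inj _ _ ar] := axa w w' ltac:(by rewrite e1).
  have t'01 : t' \in `[0, 1] by rewrite in_itv /= ltW //= (le_trans h2' t1).
  rewrite ar // in eq; move: (inj t (1 - t')).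
  rewrite !in_itv /= ltW //= (le_trans h2 t1) => /(_ isT).
  have [-> ne] := third_flip t2 t1 h1 h2 h1' h2'.
  by move=> /(_ isT eq).
Qed.

Let middleP j q : middle j q -> exists t, [/\ t \in `]0, 1[ & q = arc (val j).1 (val j).2 t].
Proof.
have [t1 [t2 t3]] := third1.
case=> t; rewrite /= in_itv /= => /andP[h1 h2] <-; exists t; split=> //.
by rewrite in_itv /= (lt_le_trans third_gt0 h1) (le_lt_trans h2 t3).
Qed.

Let edgeJ (j : J) : e (val j).1 (val j).2.
Proof. by have /andP[] := valP j. Qed.

(** The stars and the middle thirds form a system of curves to which
    [curve_system_bound] applies; all the intersections excluded there are excluded
    by the drawing. *)
Lemma drawing_away_bound : (#|edge_pairs e| <= 6 * (#|V| + 2 + 2 * m))%N.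
Proof.
apply: leq_trans (edge_pairs_upward e_sym e_irr) _.
suff : (#|{: J}| <= 3 * (#|V| + (2 + m) + m))%N by rewrite /J; clear; lia.
have [ptI axa axp axd] := draw; have [t1 [t2 t3]] := third1.
have Jne (j : J) : (val j).1 != (val j).2.
  by apply/eqP => E; have := edgeJ j; rewrite E e_irr.
have Jinj (j k : J) : [set (val j).1; (val j).2]%SET = [set (val k).1; (val k).2]%SET -> j = k.
  by move=> E; apply: val_inj; exact: upward_pair_inj (valP j) (valP k) E.
apply: (curve_system_bound tau_flip m_gt0 scheme (u := fun j : J => (val j).1)
  (v := fun j : J => (val j).2) (X := star) (Y := middle)).
- exact: Jne.
- move=> j k h; apply: Jinj; case: h => -[-> ->] //; by rewrite finset.setUC.
- exact: star_ok.
- move=> j; apply: arc_ok; rewrite ?edgeJ //; [exact: ltW | exact: ltW | exact: ltW].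
- exact: star_disjoint.
- move=> j k jk; apply/seteqP; split=> // q [] /middleP[t [t01 ->]] /middleP[s [s01]].
  apply: axd => //; by apply: contra jk => /eqP /Jinj ->.
- move=> j w w1 w2; apply/seteqP; split=> // q [] /middleP[t [t01 ->]] /starP[|[x [s [ewx s0 s1]]]].
    exact: axp.
  apply: axd => //; last by rewrite in_itv /= s0 (le_lt_trans s1) // (lt_trans t2).
  apply/eqP => /setP /(_ w); rewrite !inE eqxx /= (negbTE w1) (negbTE w2).
  by [].
- move=> j; exists (arc (val j).1 (val j).2 third); split.
    by exists third => //; rewrite /= in_itv /= lexx ltW.
  by apply: star_arc => //; exact: ltW.
- move=> j; exists (arc (val j).1 (val j).2 (1 - third)); split.
    by exists (1 - third) => //; rewrite /= in_itv /= lexx ltW.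
  have [_ _ _ _ <-] := axa _ _ (edgeJ j); last by rewrite in_itv /= ltW.
  by apply: star_arc => //; [rewrite e_sym; exact: edgeJ | exact: ltW].
Qed.
End AwayFromInfinity.

(** At most one vertex or edge passes through the point at infinity; deleting
    that vertex, or one end of that edge, makes room for the bounded meshes. *)
Lemma drawing_bound (V : finType) (e : rel V) (pt : V -> S) (arc : V -> V -> R -> S) :
  symmetric e -> irreflexive e -> drawing e pt arc ->
  (#|edge_pairs e| <= 8 * #|V| + 12 * (m + 1))%N.
Proof.
move=> e_sym e_irr draw.
have [V0|/card_gt0P[y0 _]] := posnP #|V|.
  apply: leq_trans (max_card _) _; rewrite card_prod V0; exact: leq0n.
have [ptI axa axp axd] := draw.
pose inf := infinity_point r.
have [x0 [pt_fin arc_fin]] : exists x0, (forall x, x != x0 -> pt x <> inf) /\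
    (forall x y t, x != x0 -> y != x0 -> e x y -> t \in `]0, 1[ -> arc x y t <> inf).
  have [[x0 px0]|no_pt] := pselect (exists x, pt x = inf).
    exists x0; split=> [x xx0 px|x y t xx0 yx0 exy t01].
      by move: xx0; rewrite (ptI x x0) ?eqxx // px px0.
    by rewrite -px0; exact: axp.
  have [[x0 [y1 [s [exy s01 ax0]]]]|no_arc] := pselect (exists x y t, [/\ e x y, t \in `]0, 1[ & arc x y t = inf]).
    exists x0; split=> [x _ px|x y t xx0 yx0 exy' t01]; first by apply: no_pt; exists x.
    rewrite -ax0; apply: axd => //; apply/eqP => /setP /(_ x0).
    by rewrite !inE eqxx /= eq_sym (negbTE xx0) eq_sym (negbTE yx0).
  exists y0; split=> [x _ px|x y t _ _ exy t01 axy]; first by apply: no_pt; exists x.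
  by apply: no_arc; exists x, y, t.
apply: leq_trans (edge_pairs_delete e x0) _.
have := @drawing_away_bound {x | x != x0} (fun x y => e (val x) (val y)) _ _ _ _
  (drawing_pre val_inj draw) (fun x => pt_fin (val x) (valP x))
  (fun x y t => arc_fin (val x) (val y) t (valP x) (valP y)).
have le : (#|{: {x | x != x0}}| <= #|V|)%N by rewrite card_sig; exact: max_card.
move: le; move: (#|{: _}|) (#|edge_pairs _|) => a b ab h.
have : (b <= 6 * (a + 2 + 2 * m))%N by apply: h => [x y|x]; [exact: e_sym | exact: e_irr].
by move: ab; clear; lia.
Qed.
End Bound.

(** Restricting a drawing to a set of vertices gives a drawing, so the edge bound
    passes to subgraphs. *)
Theorem embeddable_sparse (T : topologicalType) (m : nat) (tau : nat -> nat) (flip : bool)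
    (r : @holed_sphere R m -> @holed_sphere R m -> Prop) (V : finType) (e : rel V) :
  (forall a, flip || (tau a != a)) -> (0 < m)%N -> gluing_scheme tau flip r ->
  homeomorphic T (glued_space r) -> symmetric e -> irreflexive e -> embeddable R T e ->
  forall W : {set V}, (\sum_(x in W) #|[set y in W | e x y]%SET| <= 8 * #|W| + 12 * (m + 1))%N.
Proof.
move=> tau_flip m0 scheme [f [g [cf cg fK gK]]] e_sym e_irr [pt [arc draw]] W.
apply: leq_trans (edge_pairs_within e W) _.
have fI : injective f := can_inj fK.
have := drawing_bound tau_flip m0 scheme _ _ (drawing_map cf fI (drawing_pre (h := val : {x | x \in W} -> V) val_inj draw)).
rewrite card_sig (_ : #|[pred x in W]| = #|W|) //; apply=> [x y|x]; [exact: e_sym | exact: e_irr].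
Qed.
End Drawings.

(** * Arcs and drawings *)

Section Arcs.
Local Open Scope classical_set_scope.
Local Open Scope ring_scope.
Variable R : realType.

Lemma within_comp (T U W : topologicalType) (A : set T) (B : set U) (f : T -> U) (g : U -> W) :
  {within A, continuous f} -> f @` A `<=` B -> {within B, continuous g} ->
  {within A, continuous (g \o f)}.
Proof.
move=> /subspace_continuousP cf sub /subspace_continuousP cg; apply/subspace_continuousP => x Ax.
have Bx : B (f x) by apply: sub; exists x.
move=> V /(cg (f x) Bx); rewrite /nbhs /= /within /= => VB.
have := cf x Ax _ VB; rewrite /nbhs /= /within /=; apply: filterS => t h At.
by apply: h => //; apply: sub; exists t.
Qed.

(** An arc is handled through its set of points and its ends; this makes
    disjointness statements about unions of sets. *)
Definition is_arc (S : topologicalType) (A : set S) (p q : S) : Prop :=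
  exists f : R -> S, [/\ {within `[0, 1], continuous f}, {in `[0, 1] &, injective f},
    f 0 = p, f 1 = q & f @` `[0, 1] = A].

Lemma is_arc_rev (S : topologicalType) (A : set S) p q : is_arc A p q -> is_arc A q p.
Proof.
move=> [f [cf fi f0 f1 fA]].
have flip01 t : t \in `[(0 : R), 1] -> 1 - t \in `[(0 : R), 1].
  by rewrite !in_itv /= => /andP[h1 h2]; apply/andP; split; lra.
exists (fun t => f (1 - t)); split; rewrite ?subr0 ?subrr //.
- apply: (@within_comp R R S `[0, 1]%classic `[0, 1]%classic (fun t : R => 1 - t) _) => //.
    by apply: continuous_subspaceT => t; apply: cvgB; [exact: cvg_cst | exact: cvg_id].
  by move=> _ [t t01 <-]; exact: flip01.
- by move=> s t /flip01 s01 /flip01 t01 /(fi _ _ s01 t01); lra.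
- rewrite -fA; apply/seteqP; split=> _ [t t01 <-].
    by exists (1 - t) => //; exact: flip01.
  by exists (1 - t); [exact: flip01 | rewrite subKr].
Qed.

(** Run through the two arcs at double speed. *)
Lemma is_arc_cat (S : topologicalType) (A B : set S) p q w :
  is_arc A p q -> is_arc B q w -> (forall x, A x -> B x -> x = q) -> is_arc (A `|` B) p w.
Proof.
move=> [f [cf fi f0 f1 fA]] [g [cg gi g0 g1 gB]] AB.
pose h (t : R) := if t <= 2^-1 then f (2 * t) else g (2 * t - 1).
have half0 : (2 : R)^-1 * 2 = 1 by rewrite mulVf // pnatr_eq0.
have hl t : t <= 2^-1 -> h t = f (2 * t) by rewrite /h => ->.
have hr t : 2^-1 <= t -> h t = g (2 * t - 1).
  rewrite /h le_eqVlt => /orP[/eqP <-|]; last by rewrite ltNge => /negbTE ->.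
  by rewrite lexx mulrC half0 subrr f1 g0.
have inl (t : R) : 0 <= t -> t <= 2^-1 -> 2 * t \in `[0, 1].
  by move=> h1 h2; rewrite in_itv /=; apply/andP; split; lra.
have inr (t : R) : 2^-1 <= t -> t <= 1 -> 2 * t - 1 \in `[0, 1].
  by move=> h1 h2; rewrite in_itv /=; apply/andP; split; lra.
have halves : `[(0 : R), 1]%classic = `[0, 2^-1] `|` `[2^-1, 1].
  apply/seteqP; split=> t; rewrite /= !in_itv /=; last first.
    by case=> /andP[h1 h2]; apply/andP; split; lra.
  by move=> /andP[h1 h2]; have [h3|/ltW h3] := leP t 2^-1; [left|right]; apply/andP.
have fAt t : t \in `[(0 : R), 1] -> A (f t) by move=> t01; rewrite -fA; exists t.
have gBt t : t \in `[(0 : R), 1] -> B (g t) by move=> t01; rewrite -gB; exists t.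
have i0 : (0 : R) \in `[(0 : R), 1] by rewrite in_itv /= lexx ler01.
have i1 : (1 : R) \in `[(0 : R), 1] by rewrite in_itv /= lexx ler01.
exists h; split.
- rewrite halves; apply: withinU_continuous; [exact: interval_closed | exact: interval_closed | |].
  + apply: (@subspace_eq_continuous _ _ _ (f \o (fun t : R => 2 * t))).
      by move=> t; rewrite inE /= in_itv /= => /andP[_ t1]; exact: esym (hl t t1).
    apply: within_comp cf; last by move=> _ [t /= + <-]; rewrite in_itv /= => /andP[h1 h2]; exact: inl.
    by apply: continuous_subspaceT => t; apply: cvgM; [exact: cvg_cst | exact: cvg_id].
  + apply: (@subspace_eq_continuous _ _ _ (g \o (fun t : R => 2 * t - 1))).
      by move=> t; rewrite inE /= in_itv /= => /andP[t1 _]; exact: esym (hr t t1).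
    apply: within_comp cg; last by move=> _ [t /= + <-]; rewrite in_itv /= => /andP[h1 h2]; exact: inr.
    by apply: continuous_subspaceT => t; apply: cvgB; [apply: cvgM; [exact: cvg_cst | exact: cvg_id] | exact: cvg_cst].
- have mixed s t : 0 <= s -> s <= 2^-1 -> 2^-1 <= t -> t <= 1 -> f (2 * s) = g (2 * t - 1) -> s = t.
    move=> s0 s1 t0 t1 e; have is01 := inl _ s0 s1; have it01 := inr _ t0 t1.
    have fq : f (2 * s) = q by apply: AB; [exact: fAt | rewrite e; exact: gBt].
    have := fi _ _ is01 i1; rewrite fq f1 => /(_ erefl) e1.
    have := gi _ _ it01 i0; rewrite -e fq g0 => /(_ erefl) e2; lra.
  move=> s t; rewrite !in_itv /= => /andP[s0 s1] /andP[t0 t1].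
  have [sh|/ltW sh] := leP s 2^-1; have [th|/ltW th] := leP t 2^-1.
  + by rewrite !hl // => /(fi _ _ (inl _ s0 sh) (inl _ t0 th)); lra.
  + by rewrite hl // hr //; exact: mixed.
  + by rewrite hr // hl // => e; apply/esym; exact: mixed.
  + by rewrite !hr // => /(gi _ _ (inr _ sh s1) (inr _ th t1)); lra.
- by rewrite hl ?mulr0 // invr_ge0 ler0n.
- rewrite hr ?mulr1; last by lra.
  by rewrite (_ : 2 - 1 = 1 :> R) //; lra.
- rewrite -fA -gB; apply/seteqP; split=> q'.
    move=> [t /=]; rewrite in_itv /= => /andP[t0 t1] <-.
    have [th|/ltW th] := leP t 2^-1; [left|right].
      by rewrite hl //; exists (2 * t) => //; exact: inl.
    by rewrite hr //; exists (2 * t - 1) => //; exact: inr.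
  case=> -[t /=]; rewrite in_itv /= => /andP[t0 t1] <-.
    exists (t / 2); first by rewrite /= in_itv /=; apply/andP; split; lra.
    by rewrite hl; [congr f; lra | lra].
  exists ((t + 1) / 2); first by rewrite /= in_itv /=; apply/andP; split; lra.
  by rewrite hr; [congr g; lra | lra].
Qed.

(** Only the images of the edges matter: an edge may be parametrized from its
    smaller end, and its reversal is then forced. *)
Lemma embeddable_of_arcs (S : topologicalType) (n : nat) (pt : 'I_n -> S) (A : 'I_n -> 'I_n -> set S) :
  injective pt ->
  (forall x y : 'I_n, (x < y)%N -> is_arc (A x y) (pt x) (pt y)) ->
  (forall x y z : 'I_n, (x < y)%N -> A x y (pt z) -> z = x \/ z = y) ->
  (forall (x y z w : 'I_n) q, (x < y)%N -> (z < w)%N -> (x, y) <> (z, w) ->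
    A x y q -> A z w q -> exists v, q = pt v) ->
  embeddable R S (fun x y : 'I_n => x != y).
Proof.
move=> ptI Aarc Apt AA.
have [F HF] : exists F : 'I_n -> 'I_n -> R -> S, forall x y : 'I_n, (x < y)%N ->
    [/\ {within `[0, 1], continuous (F x y)}, {in `[0, 1] &, injective (F x y)},
    F x y 0 = pt x, F x y 1 = pt y & F x y @` `[0, 1] = A x y].
  pose P (x y : 'I_n) (f : R -> S) := (x < y)%N ->
    [/\ {within `[0, 1], continuous f}, {in `[0, 1] &, injective f},
    f 0 = pt x, f 1 = pt y & f @` `[0, 1] = A x y].
  have ex (xy : 'I_n * 'I_n) : exists f, P xy.1 xy.2 f.
    have [/Aarc[f hf]|lt] := boolP (xy.1 < xy.2)%N; first by exists f.
    by exists (fun=> pt xy.1) => lt'; rewrite lt' in lt.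
  by have [F HF] := choice ex; exists (fun x y => F (x, y)) => x y; exact: (HF (x, y)).
pose arc (x y : 'I_n) (t : R) := if (x < y)%N then F x y t else F y x (1 - t).
have flip01 t : t \in `[(0 : R), 1] -> 1 - t \in `[(0 : R), 1].
  by rewrite !in_itv /= => /andP[h1 h2]; apply/andP; split; lra.
have flip01' t : t \in `](0 : R), 1[ -> 1 - t \in `](0 : R), 1[.
  by rewrite !in_itv /= => /andP[h1 h2]; apply/andP; split; lra.
have open01 t : t \in `](0 : R), 1[ -> t \in `[(0 : R), 1].
  by rewrite !in_itv /= => /andP[h1 h2]; apply/andP; split; lra.
have arcP (x y : 'I_n) t : x != y -> t \in `](0 : R), 1[ ->
    exists (x' y' : 'I_n) s, [/\ (x' < y')%N, [set x; y]%SET = [set x'; y']%SET,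
      s \in `](0 : R), 1[ & arc x y t = F x' y' s].
  rewrite -val_eqE neq_ltn /arc => /orP[] /= xy t01; first by rewrite xy; exists x, y, t.
  by rewrite ltnNge (ltnW xy) /=; exists y, x, (1 - t); rewrite finset.setUC flip01'.
have interior (x y z : 'I_n) s : (x < y)%N -> s \in `](0 : R), 1[ -> F x y s <> pt z.
  move=> xy s01 E; have [_ inj F0 F1 FA] := HF x y xy.
  have i0 : (0 : R) \in `[(0 : R), 1] by rewrite in_itv /= lexx ler01.
  have i1 : (1 : R) \in `[(0 : R), 1] by rewrite in_itv /= lexx ler01.
  have Az : A x y (pt z) by rewrite -FA -E; exists s => //; exact: open01.
  move: E; case: (Apt _ _ _ xy Az) => ->; rewrite -?F0 -?F1 => /inj.
    by move=> /(_ (open01 _ s01) i0) s0; move: s01; rewrite s0 in_itv /= ltxx.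
  by move=> /(_ (open01 _ s01) i1) s0; move: s01; rewrite s0 in_itv /= ltxx andbF.
exists pt, arc; split=> //.
- move=> x y; rewrite -val_eqE neq_ltn => /orP[] /= xy; rewrite /arc xy ltnNge (ltnW xy) /=.
    have [c inj F0 F1 _] := HF x y xy; split=> // t t01.
  have [c inj F0 F1 _] := HF y x xy; split=> //; rewrite ?subr0 ?subrr //.
  + apply: (@within_comp R R S `[0, 1]%classic `[0, 1]%classic (fun t : R => 1 - t) _) => //.
      by apply: continuous_subspaceT => t; apply: cvgB; [exact: cvg_cst | exact: cvg_id].
    by move=> _ [t t01 <-]; exact: flip01.
  + by move=> s t /flip01 s01 /flip01 t01 /(inj _ _ s01 t01); lra.
  + by move=> t t01; rewrite subKr.
- move=> x y z t xy /(arcP _ _ _ xy)[x' [y' [s [xy' _ s01 ->]]]]; exact: interior.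
- move=> x y z w s t xy zw ne /(arcP _ _ _ xy)[x' [y' [s' [xy' e1 s01 ->]]]].
  move=> /(arcP _ _ _ zw)[z' [w' [t' [zw' e2 t01 ->]]]] E.
  have [_ _ _ _ FA] := HF x' y' xy'; have [_ _ _ _ FA'] := HF z' w' zw'.
  have [] := AA x' y' z' w' (F x' y' s') xy' zw'.
  + by case=> e3 e4; move: ne; rewrite e1 e2 e3 e4 eqxx.
  + by rewrite -FA; exists s' => //; exact: open01.
  + by rewrite E -FA'; exists t' => //; exact: open01.
  + by move=> v; exact: interior.
Qed.

End Arcs.

(** * Arcs made of segments *)

Section CleanSegments.
Local Open Scope classical_set_scope.
Local Open Scope ring_scope.
Variables (R : realType) (m : nat) (tau : nat -> nat) (flip : bool).
Variable r : @holed_sphere R m -> @holed_sphere R m -> Prop.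
Hypothesis scheme : gluing_scheme tau flip r.
Local Notation pp := (plane_point r).

(** On every rim only the left side is kept.  A reflection exchanges left and
    right sides, so no two points of this region are glued together. *)
Definition clean (z : R * R) : Prop := forall a : nat,
  1 <= `|z - hole_center R a| /\ (`|z - hole_center R a| = 1 -> z.1 = 4 * a%:R - 1).

Lemma clean_holed z : clean z -> holed_plane m z.
Proof. by move=> h a _; case: (h a). Qed.

Lemma clean_inj z w : clean z -> clean w -> pp z = pp w -> z = w.
Proof.
move=> hz hw; have [tauK tau_m _ _] := scheme.
move=> /(plane_point_eq scheme (clean_holed hz) (clean_holed hw))[//|[a [am za wE]]].
have z1 := (hz a).2 za; have := (hw (tau a)).2.
rewrite {}wE mirror_center // za => /(_ erefl); rewrite /mirror /= z1 => h; exfalso; lra.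
Qed.

Lemma clean_outside z : 1 < `|z.2| -> clean z.
Proof.
move=> h a; have lt1 : 1 < `|z - hole_center R a|.
  by apply: lt_le_trans h _; rewrite norm_pair le_max /= subr0 lexx orbT.
by split=> [|e]; [exact: ltW | rewrite e ltxx in lt1].
Qed.

Lemma clean_between z : (forall a : nat, z.1 <= 4 * a%:R - 1 \/ 4 * a%:R + 1 < z.1) -> clean z.
Proof.
move=> h a; have le1 : `|z.1 - 4 * a%:R| <= `|z - hole_center R a|.
  by rewrite norm_pair le_max /= lexx.
case: (h a) => ha.
  split=> [|e]; first by apply: le_trans le1; rewrite ler_normr; apply/orP; right; lra.
  by move: le1; rewrite e ler_norml => /andP[h1 h2]; lra.
split=> [|e]; first by apply: le_trans le1; rewrite ler_normr; apply/orP; left; lra.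
by move: le1; rewrite e ler_norml => /andP[h1 h2]; lra.
Qed.

Lemma holed_between (z : R * R) : (forall a : nat, z.1 <= 4 * a%:R - 1 \/ 4 * a%:R + 1 <= z.1) -> holed_plane m z.
Proof.
move=> h a _; apply: (@le_trans _ _ `|z.1 - 4 * a%:R|).
  by rewrite ler_normr; apply/orP; case: (h a) => ha; [right|left]; lra.
by rewrite norm_pair le_max /= lexx.
Qed.

Definition on_line (z0 z1 : R * R) (t : R) : R * R :=
  (z0.1 + t * (z1.1 - z0.1), z0.2 + t * (z1.2 - z0.2)).
(** The starting point is left out: it may be a right side point of a rim, outside
    the clean region, or the common point with the preceding segment. *)
Definition segment_from (z0 z1 : R * R) : set (R * R) :=
  [set z | exists t, [/\ 0 < t, t <= 1 & z = on_line z0 z1 t]].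

Let on_line0 z0 z1 : on_line z0 z1 0 = z0.
Proof. by rewrite /on_line !mul0r !addr0; case: z0. Qed.
Let on_line1 z0 z1 : on_line z0 z1 1 = z1.
Proof. by rewrite /on_line !mul1r !subrKC; case: z1. Qed.

Lemma segment_arc z0 z1 : z0 <> z1 -> holed_plane m z0 -> segment_from z0 z1 `<=` clean ->
  (forall z, segment_from z0 z1 z -> pp z <> pp z0) ->
  is_arc R ([set pp z0] `|` pp @` segment_from z0 z1) (pp z0) (pp z1).
Proof.
move=> ne h0 cl away; exists (pp \o on_line z0 z1); split.
- apply: (@within_comp R (R * R)%type _ `[0, 1]%classic (holed_plane m) (on_line z0 z1) pp); last exact: plane_point_continuous.
    have c1 (a b : R) : continuous (fun t : R => a + t * (b - a)).
      by move=> t; apply: cvgD; [exact: cvg_cst | apply: cvgM; [exact: cvg_id | exact: cvg_cst]].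
    by apply: continuous_subspaceT => t; exact: (cvg_pair (c1 z0.1 z1.1 t) (c1 z0.2 z1.2 t)).
  move=> _ [t /= + <-]; rewrite in_itv /= => /andP[]; rewrite le_eqVlt => /orP[/eqP <- _|t0 t1].
    by rewrite on_line0.
  by apply: clean_holed; apply: cl; exists t.
- have seg t : 0 < t -> t <= 1 -> segment_from z0 z1 (on_line z0 z1 t) by move=> ? ?; exists t.
  move=> s t; rewrite !in_itv /= => /andP[]; rewrite le_eqVlt => /orP[/eqP <- _|s0 s1] /andP[];
    rewrite le_eqVlt => /orP[/eqP <- _|t0 t1] //; rewrite ?on_line0.
  + by move=> e; case: (away _ (seg t t0 t1)).
  + by move=> e; case: (away _ (seg s s0 s1)).
  + move=> /(clean_inj (cl _ (seg s s0 s1)) (cl _ (seg t t0 t1))) [e1 e2].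
    apply: contrapT => st; apply: ne; rewrite [z0]surjective_pairing [z1]surjective_pairing.
    have st0 : s - t != 0 by rewrite subr_eq0; apply/eqP.
    have z_eq (x y : R) : x + s * (y - x) = x + t * (y - x) -> x = y.
      move=> /addrI /eqP; rewrite -subr_eq0 -mulrBl mulf_eq0 (negbTE st0) /= subr_eq0 => /eqP //.
    by congr (_, _); exact: z_eq.
- by rewrite /= on_line0.
- by rewrite /= on_line1.
- apply/seteqP; split=> q /=.
    move=> [t + <-]; rewrite /= in_itv /= => /andP[]; rewrite le_eqVlt => /orP[/eqP <- _|t0 t1].
      by left; rewrite on_line0.
    by right; exists (on_line z0 z1 t) => //; exists t.
  case=> [->|[z [t [t0 t1 ->]] <-]].
    by exists 0; rewrite /= ?on_line0 // in_itv /= lexx ler01.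
  by exists t => //; rewrite /= in_itv /= ltW.
Qed.

(** The new segment may start at another representative [z0] of the end of the arc:
    this is how a curve passes through a handle or a cross-cap. *)
Lemma arc_extend (A : set (R * R)) p e z0 z1 : is_arc R (pp @` A) p (pp e) ->
  A `<=` clean -> A e -> pp e = pp z0 -> z0 <> z1 -> holed_plane m z0 ->
  segment_from z0 z1 `<=` clean -> (forall z, A z -> ~ segment_from z0 z1 z) ->
  is_arc R (pp @` (A `|` segment_from z0 z1)) p (pp z1).
Proof.
move=> arcA clA Ae pe ne h0 cl dis.
have away z : segment_from z0 z1 z -> pp z <> pp z0.
  by move=> sz; rewrite -pe => /(clean_inj (cl _ sz) (clA _ Ae)) ze; apply: (dis e) => //; rewrite -ze.
have -> : pp @` (A `|` segment_from z0 z1) = pp @` A `|` ([set pp z0] `|` pp @` segment_from z0 z1).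
  rewrite image_setU; apply/seteqP; split=> q; case; [by left|by right; right|by left|].
  by case=> [->|]; [left; exists e | right].
rewrite pe in arcA; apply: is_arc_cat arcA (segment_arc ne h0 cl away) _.
move=> q [z Az <-] [//|[w sw] /(clean_inj (cl _ sw) (clA _ Az)) wz].
by case: (dis z) => //; rewrite -wz.
Qed.

Lemma segment_fromP (z0 z1 z : R * R) : z0.1 < z1.1 -> segment_from z0 z1 z <->
  [/\ z0.1 < z.1, z.1 <= z1.1 & z.2 = z0.2 + (z.1 - z0.1) / (z1.1 - z0.1) * (z1.2 - z0.2)].
Proof.
rewrite -subr_gt0 => lt; split.
  case=> t [t0 t1 ->] /=; split.
  - by rewrite ltrDl mulr_gt0.
  - by rewrite -lerBrDl ger_pMl.
  - by rewrite [_ + _ * _ - _]addrAC subrr add0r mulfK // gt_eqF.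
case=> h1 h2 h3; exists ((z.1 - z0.1) / (z1.1 - z0.1)); split.
- by rewrite divr_gt0 // subr_gt0.
- by rewrite ler_pdivrMr // mul1r lerD2r.
- by rewrite /on_line divfK ?gt_eqF // -h3 subrKC; case: (z).
Qed.

Lemma vertical_segmentP (x y0 y1 : R) z : y0 < y1 -> segment_from (x, y0) (x, y1) z <->
  [/\ z.1 = x, y0 < z.2 & z.2 <= y1].
Proof.
rewrite -subr_gt0 => lt; split.
  case=> t [t0 t1 ->] /=; rewrite subrr mulr0 addr0; split=> //.
  - by rewrite ltrDl mulr_gt0.
  - by rewrite -lerBrDl ger_pMl.
case=> h1 h2 h3; exists ((z.2 - y0) / (y1 - y0)); split.
- by rewrite divr_gt0 // subr_gt0.
- by rewrite ler_pdivrMr // mul1r lerD2r.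
- by rewrite /on_line /= divfK ?gt_eqF // subrKC subrr mulr0 addr0 -h1; case: (z).
Qed.

End CleanSegments.

(** * Drawing complete graphs *)

Section Levels.
Local Open Scope ring_scope.
Variables (R : realType) (n : nat) (flip : bool).
Hypothesis n_gt0 : (0 < n)%N.

(** The half-edge from [u] towards [v] is numbered [u * n + v]; its reversal is the
    half-edge from [v] towards [u]. *)
Definition reversal (s : nat) : nat := (s %% n * n + s %/ n)%N.

Lemma reversalE u v : (v < n)%N -> reversal (u * n + v) = (v * n + u)%N.
Proof. by move=> vn; rewrite /reversal modnMDl modn_small // divnMDl // divn_small // addn0. Qed.

Lemma reversal_lt s : (s < n * n)%N -> (reversal s < n * n)%N.
Proof.
move=> sn; have h1 : (s %% n < n)%N by rewrite ltn_pmod.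
have h2 : (s %/ n < n)%N by rewrite ltn_divLR.
rewrite /reversal; move: h1 h2; move: (s %% n)%N (s %/ n)%N => a b; clear; nia.
Qed.

(** Each half-edge [s] is drawn as a strand running to the right, and slot [j]
    consists of the holes [2 * j] and [2 * j + 1].  If [j] is the smaller half of an
    edge, that edge is closed in slot [j], when all strands below [j] have ended.
    The strands between the two halves pass through the holes, at heights in
    [(0, 1)]; the upper half and the strands beyond it pass above, at heights at least
    2.  With handles, the lower half passes below the holes; with cross-caps it enters
    the first hole at height 0. *)
Definition level (j s : nat) : R :=
  if (s < reversal j)%N then
    if ~~ flip && (s == j) then - 2 else (s%:R - j%:R) / (n * n)%:R
  else 2 + (s%:R - (reversal j)%:R).

Let nn_gt0 : 0 < (n * n)%:R :> R.
Proof. by rewrite ltr0n muln_gt0 n_gt0. Qed.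

Lemma level_band j s : (j < n * n)%N -> (j < s)%N -> (s < reversal j)%N -> 0 < level j s < 1.
Proof.
move=> jn js sb; rewrite /level sb (gtn_eqF js) andbF.
rewrite divr_gt0 ?subr_gt0 ?ltr_nat //= ltr_pdivrMr // mul1r.
have : (s < n * n)%N := ltn_trans sb (reversal_lt jn).
rewrite -(ltr_nat R) => h; have : 0 <= j%:R :> R by []; move: h; clear; lra.
Qed.

Lemma level_out j s : (reversal j <= s)%N -> 2 <= level j s.
Proof. by rewrite /level ltnNge => h; rewrite h /= lerDl subr_ge0 ler_nat. Qed.

Lemma level_reversal j : level j (reversal j) = 2.
Proof. by rewrite /level ltnn subrr addr0. Qed.

Lemma level_self j : (j < reversal j)%N -> level j j = if flip then 0 else - 2.
Proof. by move=> h; rewrite /level h eqxx andbT subrr mul0r; case: flip. Qed.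

(** Strands keep their vertical order when entering a slot, so that the pieces
    leading there are disjoint. *)
Lemma level_lt j s s' : (j < n * n)%N -> (j <= s)%N -> (s < s')%N -> level j s < level j s'.
Proof.
move=> jn js ss'.
have [sb'|bs'] := ltnP s' (reversal j).
  have /andP[l1 l2] := level_band jn (leq_ltn_trans js ss') sb'.
  have sb := ltn_trans ss' sb'; move: l1; rewrite {1}/level sb' (gtn_eqF (leq_ltn_trans js ss')) andbF.
  rewrite /level sb sb' (gtn_eqF (leq_ltn_trans js ss')) andbF; case: ifP => _ l1; first by lra.
  by rewrite ltr_pM2r ?invr_gt0 // ltrD2r ltr_nat.
have [sb|bs] := ltnP s (reversal j); last by rewrite /level !ltnNge bs bs' /= ltrD2l ltrD2r ltr_nat.
apply: lt_le_trans (level_out bs').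
move: js; rewrite leq_eqVlt => /orP[/eqP js|js]; last by have /andP[_ ?] := level_band jn js sb; lra.
by subst s; rewrite level_self //; case: flip; lra.
Qed.

Definition before (j s : nat) : R := if j is j'.+1 then level j' s else (n * (s %/ n))%:R.

Lemma before_le j s s' : (j < n * n)%N -> (j <= s)%N -> (s < s')%N -> before j s <= before j s'.
Proof.
case: j => [|j] jn js ss'; first by rewrite ler_nat leq_mul2l leq_div2r ?orbT // ltnW.
by rewrite ltW // level_lt // ltnW.
Qed.

End Levels.

Section Strands.
Local Open Scope classical_set_scope.
Local Open Scope ring_scope.
Variables (R : realType) (m : nat) (tau : nat -> nat) (flip : bool).
Variable r : @holed_sphere R m -> @holed_sphere R m -> Prop.
Hypothesis scheme : gluing_scheme tau flip r.
Local Notation pp := (plane_point r).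
Variable n : nat.
Hypothesis n_gt0 : (0 < n)%N.
Hypothesis jump : forall (j : nat) (t : R), (j < n * n)%N -> `|t| < 1 ->
  if flip then pp (8 * j%:R - 1, t) = pp (8 * j%:R + 1, - t) /\
               pp (8 * j%:R + 3, - t) = pp (8 * j%:R + 5, t)
  else pp (8 * j%:R - 1, t) = pp (8 * j%:R + 5, t).
Local Notation lev := (@level R n flip).
Local Notation bef := (@before R n flip).
Local Notation rv := (reversal n).

Definition vertex_point (w : nat) : R * R := (- 3, (n * w)%:R).
(** Between two slots the strands are interpolated linearly.  Inside a slot a strand
    at height at least 2 continues horizontally; a strand through handles jumps from
    the left of the first hole to the right of the second one; a strand through
    cross-caps crosses the strip between the two holes at the opposite height. *)
Definition gap_piece (j s : nat) : set (R * R) := [set z |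
  [/\ 8 * j%:R - 3 < z.1, z.1 <= 8 * j%:R - 1 &
      z.2 = bef j s + (z.1 - (8 * j%:R - 3)) / 2 * (lev j s - bef j s)]].
Definition slot_piece (j s : nat) : set (R * R) := [set z |
  [/\ 8 * j%:R - 1 < z.1, z.1 <= 8 * j%:R + 5 &
      if (rv j <= s)%N then z.2 = lev j s
      else [/\ flip, 8 * j%:R + 1 < z.1, z.1 <= 8 * j%:R + 3 & z.2 = - lev j s]]].
Fixpoint strand (s i : nat) : set (R * R) :=
  if i is i'.+1 then strand s i' `|` slot_piece i' s `|` gap_piece i s
  else [set vertex_point (s %/ n)] `|` gap_piece 0 s.

Lemma strandP s i z : strand s i z -> z = vertex_point (s %/ n) \/
  exists2 j, (j <= i)%N & gap_piece j s z \/ (slot_piece j s z /\ (j < i)%N).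
Proof.
elim: i => [|i IH] /=; first by case=> h; [left|right; exists 0%N => //; left].
case=> [[/IH[h|[j ji h]]|h]|h]; first by left.
- right; exists j; first exact: leqW.
  by case: h => [h|[h ij]]; [left|right; split => //; exact: leqW].
- by right; exists i => //; right.
- by right; exists i.+1 => //; left.
Qed.

Lemma column_uniq (x : R) (j k : nat) : 8 * j%:R - 3 < x -> x <= 8 * j%:R + 5 ->
  8 * k%:R - 3 < x -> x <= 8 * k%:R + 5 -> j = k.
Proof.
move=> h1 h2 h3 h4; apply/eqP; rewrite eqn_leq -(ltnS j k) -(ltnS k j) -!(ltr_nat R) -!natr1.
by apply/andP; split; lra.
Qed.

Lemma piece_column j s z : gap_piece j s z \/ slot_piece j s z ->
  8 * j%:R - 3 < z.1 /\ z.1 <= 8 * j%:R + 5.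
Proof. by case=> -[h1 h2 _]; split; lra. Qed.

Lemma gap_disjoint j s s' z : (j < n * n)%N -> (j <= s)%N -> (s < s')%N ->
  gap_piece j s z -> gap_piece j s' z -> False.
Proof.
move=> jn js ss' [h1 h2 e1] [_ _]; rewrite {}e1.
have := level_lt R flip n_gt0 jn js ss'; have := before_le R flip n_gt0 jn js ss'.
move: (bef j s) (bef j s') (lev j s) (lev j s') => b b' l l' bb ll.
set w := (z.1 - _) / 2; have w0 : 0 < w by rewrite /w; lra.
have w1 : w <= 1 by rewrite /w; lra.
have : 0 < w * (l' - l) by rewrite mulr_gt0 // subr_gt0.
have : 0 <= (1 - w) * (b' - b) by rewrite mulr_ge0 // subr_ge0.
move: w w0 w1 => w w0 w1 p1 p2 e; nra.
Qed.

Lemma slot_disjoint j s s' z : (j < n * n)%N -> (j < s)%N -> (s < s')%N ->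
  slot_piece j s z -> slot_piece j s' z -> False.
Proof.
move=> jn js ss' [h1 h2 h3] [_ _ h4]; have lt := level_lt R flip n_gt0 jn (ltnW js) ss'.
move: h3 h4; have [bs|sb] := leqP (rv j) s.
  by rewrite (leq_trans bs (ltnW ss')) => -> e; rewrite e ltxx in lt.
have [bs'|sb'] := leqP (rv j) s'.
  have := level_out R flip bs'; have /andP[l0 l1] := level_band R flip n_gt0 jn js sb.
  by move=> l2 [_ _ _ ->] e; lra.
by move=> [_ _ _ ->] [_ _ _ /oppr_inj e]; rewrite e ltxx in lt.
Qed.

Lemma strands_disjoint s s' i i' z : (s < n * n)%N -> (s' < n * n)%N -> s != s' ->
  (i <= s)%N -> (i' <= s')%N ->
  strand s i z -> strand s' i' z -> z = vertex_point (s %/ n) /\ (s %/ n = s' %/ n)%N.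
Proof.
move=> sn s'n ss' is_ i's' /strandP[zE|[j ji zj]] /strandP[zE'|[j' ji' zj']].
- split=> //; move: zE'; rewrite zE /vertex_point => -[] /eqP; rewrite eqr_nat eqn_pmul2l //.
  by move/eqP.
- have [] := piece_column (z := z) (j := j') (s := s') ltac:(case: zj' => [|[]]; [left|right]; done).
  by rewrite {}zE /=; have := ler0n R j'; move=> ? ? ?; exfalso; lra.
- have [] := piece_column (z := z) (j := j) (s := s) ltac:(case: zj => [|[]]; [left|right]; done).
  by rewrite {}zE' /=; have := ler0n R j; move=> ? ? ?; exfalso; lra.
exfalso.
have [c1 c2] := piece_column (z := z) (j := j) (s := s) ltac:(case: zj => [|[]]; [left|right]; done).
have [c3 c4] := piece_column (z := z) (j := j') (s := s') ltac:(case: zj' => [|[]]; [left|right]; done).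
have jj := column_uniq c1 c2 c3 c4; subst j'.
have jn : (j < n * n)%N by apply: leq_ltn_trans sn; exact: leq_trans is_.
have js := leq_trans ji is_; have js' := leq_trans ji' i's'.
case: zj zj' => [zg|[zs ji1]] [zg'|[zs' ji1']].
- by move: ss'; rewrite neq_ltn => /orP[] lt; [exact: gap_disjoint lt zg zg' | exact: gap_disjoint lt zg' zg].
- by case: zg zs' => _ h1 _ [h2 _ _]; lra.
- by case: zs zg' => h1 _ _ [_ h2 _]; lra.
- have ls := leq_trans ji1 is_; have ls' := leq_trans ji1' i's'.
  by move: ss'; rewrite neq_ltn => /orP[] lt; [exact: slot_disjoint lt zs zs' | exact: slot_disjoint lt zs' zs].
Qed.

Lemma vertex_clean w : clean (vertex_point w).
Proof. by apply: clean_between => a; left; rewrite /=; have := ler0n R a; lra. Qed.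

Let nat_split (j a : nat) : 4 * a%:R + 1 <= 8 * j%:R - 3 :> R \/ 8 * j%:R - 1 <= 4 * a%:R - 1 :> R.
Proof.
have [h|h] := ltnP a (2 * j); [left|right]; move: h.
  by rewrite -(ler_nat R) -natr1 natrM; lra.
by rewrite -(ler_nat R) natrM; lra.
Qed.

Let nat_split_mid (j a : nat) : 4 * a%:R + 1 <= 8 * j%:R + 1 :> R \/ 8 * j%:R + 3 <= 4 * a%:R - 1 :> R.
Proof.
have [h|h] := leqP a (2 * j); [left|right]; move: h.
  by rewrite -(ler_nat R) natrM; lra.
by rewrite -(ler_nat R) -natr1 natrM; lra.
Qed.

Lemma gap_clean j s z : gap_piece j s z -> clean z.
Proof.
by case=> h1 h2 _; apply: clean_between => a; case: (nat_split j a) => h; [right|left]; lra.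
Qed.

Lemma slot_clean j s z : (j < s)%N -> slot_piece j s z -> clean z.
Proof.
move=> js [h1 h2]; case: ifP => [bs e|_ [_ h3 h4 _]].
  by apply: clean_outside; rewrite e; have := level_out R flip bs => ?; rewrite ltr_normr; apply/orP; left; lra.
by apply: clean_between => a; case: (nat_split_mid j a) => h; [right|left]; lra.
Qed.

Lemma strand_clean s i z : (i <= s)%N -> strand s i z -> clean z.
Proof.
move=> si /strandP[->|[j ji [|[h ij]]]]; first exact: vertex_clean.
  exact: gap_clean.
by apply: slot_clean h; exact: leq_trans si.
Qed.

Lemma strand_left s i z : strand s i z -> z.1 <= 8 * i%:R - 1.
Proof.
move=> /strandP[->|[j ji h]] /=; first by have := ler0n R i; lra.
case: h => [[_ h _]|[[_ h _] ij]]; first by move: ji; rewrite -(ler_nat R); lra.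
by move: ij; rewrite -(ler_nat R) -natr1; lra.
Qed.

Let gap_segment j s : gap_piece j s = segment_from (8 * j%:R - 3, bef j s) (8 * j%:R - 1, lev j s).
Proof.
have e : 8 * j%:R - 1 - (8 * j%:R - 3) = 2 :> R by ring.
apply/seteqP; split=> z; rewrite segment_fromP /= ?e //; lra.
Qed.

(** Strand [s] survives up to slot [i] as long as [i <= s].  Through the holes the end
    of each piece is glued to the beginning of the next one, as stated in [jump]. *)
Lemma strand_arc s i : (s < n * n)%N -> (i <= s)%N ->
  is_arc R (pp @` strand s i) (pp (vertex_point (s %/ n))) (pp (8 * i%:R - 1, lev i s)) /\
  strand s i (8 * i%:R - 1, lev i s).
Proof.
move=> sn; elim: i => [|i IH] si.
  split; last by right; split; rewrite /=; lra.
  have g0 : gap_piece 0 s = segment_from (vertex_point (s %/ n)) (8 * 0%:R - 1, lev 0 s).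
    by rewrite gap_segment mulr0 sub0r.
  have lt : (vertex_point (s %/ n)).1 < ((8 * 0%:R - 1, lev 0 s) : R * R).1 by rewrite /=; lra.
  rewrite /= image_setU image_set1 g0; apply: (segment_arc scheme).
  - by move=> h; rewrite -h ltxx in lt.
  - exact: clean_holed (vertex_clean _).
  - by rewrite -g0 => z; exact: gap_clean.
  - move=> z zs /(clean_inj scheme).
    have cz : clean z by apply: (@gap_clean 0 s); rewrite g0.
    move=> /(_ cz (vertex_clean _)) ze; move: zs; rewrite (segment_fromP _ lt) ze => -[].
    by rewrite ltxx.
have [arc_i end_i] := IH (ltnW si).
set e := (8 * i%:R - 1, lev i s) in arc_i end_i.
have i_n : (i < n * n)%N := ltn_trans si sn.
have left_i := @strand_left s i.
have clean_i : strand s i `<=` @clean R by move=> z; apply: strand_clean; exact: ltnW.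
have natS : i.+1%:R = i%:R + 1 :> R by rewrite natr1.
pose f : R * R := (8 * i%:R + 5, lev i s).
suff [arc_s [x xs xf]] : is_arc R (pp @` (strand s i `|` slot_piece i s)) (pp (vertex_point (s %/ n))) (pp f) /\
    exists2 x, (strand s i `|` slot_piece i s) x & pp x = pp f.
  split; last by right; split; rewrite /= natS; clear xf; lra.
  have fE : f = (8 * i.+1%:R - 3, bef i.+1 s) by rewrite /f natS; congr (_, _); ring.
  rewrite /= gap_segment -fE; apply: (arc_extend scheme _ _ xs xf).
  - by rewrite xf.
  - by move=> z [/clean_i //|]; exact: slot_clean.
  - by rewrite /f natS => -[h]; clear xf fE; lra.
  - apply: holed_between => a; rewrite /f /=; clear xf fE; case: (nat_split i.+1 a); rewrite natS; [right|left]; lra.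
  - by rewrite fE -gap_segment; exact: gap_clean.
  - move=> z zs; rewrite fE -gap_segment => -[h _ _]; rewrite natS in h; move: zs h; clear xs xf fE => zs h.
    by case: zs => [/left_i|[_ h2 _]]; lra.
have [bs|sb] := leqP (rv i) s.
  have slotE : slot_piece i s = segment_from e f.
    have ef : e.1 < f.1 by rewrite /e /f /=; lra.
    by apply/seteqP; split=> z; rewrite (segment_fromP _ ef) /slot_piece /= bs subrr mulr0 addr0.
  have lv := level_out R flip bs.
  split; last by exists f => //; right; split; rewrite /f /= ?bs //; lra.
  rewrite slotE; apply: (arc_extend scheme arc_i clean_i end_i) => //.
  - by rewrite /e /f => -[h]; lra.
  - by apply: clean_holed; exact: clean_i.
  - by rewrite -slotE => z; exact: slot_clean.
  - by move=> z /left_i h; rewrite -slotE => -[h' _ _]; lra.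
have /andP[l0 l1] := level_band R flip n_gt0 i_n si sb.
have lt1 : `|lev i s| < 1 by rewrite ltr_norml; apply/andP; split; lra.
have := jump i_n lt1; case: ifP => fl; last first.
  have -> : slot_piece i s = set0.
    by apply/seteqP; split=> // z [_ _]; rewrite leqNgt sb /= fl => -[].
  by rewrite setU0 => jE; rewrite -/e -/f in jE; rewrite -jE; split=> //; exists e.
case=> j1 j2; rewrite -/e -/f in j1 j2.
set e' := (_ + 1, _) in j1; set f' := (_ + 3, _) in j2.
have slotE : slot_piece i s = segment_from e' f'.
  have ef : e'.1 < f'.1 by rewrite /e' /f' /=; lra.
  apply/seteqP; split=> z; rewrite (segment_fromP _ ef) /slot_piece /= leqNgt sb /= subrr mulr0 addr0.
    by case=> _ _ [].
  by case=> h1 h2 h3; split; [lra | lra | split].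
rewrite -j2; split; last first.
  exists f' => //; right; rewrite slotE; exists 1; split=> //.
  by rewrite /on_line !mul1r !subrKC.
rewrite slotE; apply: (arc_extend scheme arc_i clean_i end_i) => //.
- by clear j1 j2; rewrite /e' /f' => -[h]; lra.
- clear j1 j2; apply: holed_between => a; rewrite /e' /=; case: (nat_split_mid i a); [right|left]; lra.
- by rewrite -slotE => z; exact: slot_clean.
- by clear j1 j2; move=> z /left_i h; rewrite -slotE => -[h' _ _]; lra.
Qed.

(** The two strands of an edge are joined by a vertical segment between the two
    holes of its slot.  With handles its lower end lies below the holes; with
    cross-caps it is at height 0 and is reached through the first cross-cap. *)
Definition foot : R := if flip then 0 else - 2.
Definition foot_start (i : nat) : R := if flip then 8 * i%:R + 1 else 8 * i%:R - 1.
Definition stub (i : nat) := segment_from (foot_start i, foot) (8 * i%:R + 2, foot).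
Definition riser (i : nat) := segment_from (8 * i%:R + 2, foot) (8 * i%:R + 2, 2).
Definition lintel (i : nat) := segment_from (8 * i%:R - 1, 2 : R) (8 * i%:R + 2, 2).
Definition edge_curve (i : nat) : set (R * R) :=
  (strand i i `|` stub i `|` riser i) `|` (strand (rv i) i `|` lintel i).

Let foot_le0 : foot <= 0 /\ - 2 <= foot.
Proof. by rewrite /foot; case: flip; split; lra. Qed.

Let foot_startE i : 8 * i%:R - 1 <= foot_start i /\ foot_start i < 8 * i%:R + 2.
Proof. by rewrite /foot_start; case: flip; split; lra. Qed.

Let stubP i z : stub i z <-> [/\ foot_start i < z.1, z.1 <= 8 * i%:R + 2 & z.2 = foot].
Proof.
have lt : (foot_start i, foot).1 < (8 * i%:R + 2, foot).1 by have [] := foot_startE i.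
by rewrite /stub (segment_fromP _ lt) /= subrr mulr0 addr0.
Qed.

Let riserP i z : riser i z <-> [/\ z.1 = 8 * i%:R + 2, foot < z.2 & z.2 <= 2].
Proof. by apply: vertical_segmentP; have [h _] := foot_le0; lra. Qed.

Let lintelP i z : lintel i z <-> [/\ 8 * i%:R - 1 < z.1, z.1 <= 8 * i%:R + 2 & z.2 = 2].
Proof.
have lt : ((8 * i%:R - 1, 2) : R * R).1 < ((8 * i%:R + 2, 2) : R * R).1 by rewrite /=; lra.
by rewrite /lintel (segment_fromP _ lt) /= subrr mulr0 addr0.
Qed.

Let stub_clean i z : stub i z -> clean z.
Proof.
move=> /stubP[]; rewrite /foot_start /foot; case: ifP => _ h1 h2 h3.
  by apply: clean_between => a; clear h3; case: (nat_split_mid i a) => h; [right|left]; lra.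
by apply: clean_outside; rewrite h3 normrN ger0_norm //; lra.
Qed.

Let riser_clean i z : riser i z -> clean z.
Proof.
move=> /riserP[h1 h2 h3].
by apply: clean_between => a; case: (nat_split_mid i a) => h; [right|left]; lra.
Qed.

Let lintel_clean i z : lintel i z -> clean z.
Proof. by move=> /lintelP[h1 h2 h3]; apply: clean_outside; rewrite h3 ger0_norm //; lra. Qed.

Lemma edge_clean i z : (i < rv i)%N -> edge_curve i z -> clean z.
Proof.
move=> ib [[[|/stub_clean //]|/riser_clean //]|[|/lintel_clean //]]; first exact: strand_clean.
by apply: strand_clean; exact: ltnW.
Qed.

Lemma reversal_div s : (s < n * n)%N -> (rv s %/ n = s %% n)%N.
Proof.
move=> sn; have h : (s %/ n < n)%N by rewrite ltn_divLR.
by rewrite /reversal divnMDl // divn_small // addn0.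
Qed.

Lemma reversalK s : (s < n * n)%N -> rv (rv s) = s.
Proof.
move=> sn; have h : (s %/ n < n)%N by rewrite ltn_divLR.
by rewrite {1}/reversal reversal_div // /reversal modnMDl modn_small // -divn_eq.
Qed.

Lemma reversal_neq_div s : (s < n * n)%N -> (s < rv s)%N -> (s %/ n <> rv s %/ n)%N.
Proof.
move=> sn srv e; have := divn_eq s n; rewrite e {1}reversal_div // -{2}(reversal_div sn) -e => e2.
by move: srv; rewrite /reversal -e2 ltnn.
Qed.

Lemma edge_arc i : (i < n * n)%N -> (i < rv i)%N ->
  is_arc R (pp @` edge_curve i) (pp (vertex_point (i %/ n))) (pp (vertex_point (rv i %/ n))).
Proof.
move=> i_n ib; have b_n := reversal_lt n_gt0 i_n; have [f0 f2] := foot_le0; have [s1 s2] := foot_startE i.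
have cl1 : strand i i `<=` @clean R by move=> z; exact: strand_clean.
have cl2 : strand (rv i) i `<=` @clean R by move=> z; apply: strand_clean; exact: ltnW.
have left1 := @strand_left i i; have left2 := @strand_left (rv i) i.
have [arc1 end1] := strand_arc i_n (leqnn i).
have [arc2 end2] := strand_arc b_n (ltnW ib).
rewrite level_self // -/foot in arc1 end1; rewrite level_reversal in arc2 end2.
pose corner : R * R := (8 * i%:R + 2, foot).
pose top : R * R := (8 * i%:R + 2, 2).
have stub_end : stub i corner by apply/stubP; split.
have riser_end : riser i top by apply/riserP; split => //; rewrite /top /=; lra.
have arc_stub : is_arc R (pp @` (strand i i `|` stub i)) (pp (vertex_point (i %/ n))) (pp corner).
  apply: (arc_extend scheme arc1 cl1 end1).
  - rewrite /foot_start /foot; case: ifP => fl //.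
    have := jump i_n (t := 0); rewrite normr0 ltr01 oppr0 => /(_ isT).
    by rewrite [X in if X then _ else _]fl => -[].
  - by case=> h; lra.
  - apply: holed_between => a; rewrite /= /foot_start; case: ifP => _.
      by case: (nat_split_mid i a); [right|left]; lra.
    by case: (nat_split i a) => ?; [right|left]; lra.
  - by move=> z; exact: stub_clean.
  - by move=> z /left1 h /stubP[h1 _ _]; lra.
have arc_riser : is_arc R (pp @` (strand i i `|` stub i `|` riser i)) (pp (vertex_point (i %/ n))) (pp top).
  apply: (arc_extend scheme arc_stub (e := corner)) => //.
  - by move=> z [/cl1 //|]; exact: stub_clean.
  - by right.
  - by case=> h; lra.
  - by apply: clean_holed; exact: stub_clean stub_end.
  - by move=> z; exact: riser_clean.
  - move=> z [/left1 h /riserP[h1 _ _]|/stubP[_ _ h] /riserP[_ h1 _]]; lra.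
have arc_lintel : is_arc R (pp @` (strand (rv i) i `|` lintel i)) (pp (vertex_point (rv i %/ n))) (pp top).
  apply: (arc_extend scheme arc2 cl2 end2) => //.
  - by case=> h; lra.
  - by apply: clean_holed; exact: cl2.
  - by move=> z; exact: lintel_clean.
  - by move=> z /left2 h /lintelP[h1 _ _]; lra.
rewrite /edge_curve image_setU; apply: is_arc_cat arc_riser (is_arc_rev arc_lintel) _.
move=> q [z zL <-] [w wR wz].
have wclean : clean w by apply: (@edge_clean i) => //; right.
have zclean : clean z by apply: (@edge_clean i) => //; left.
have e := clean_inj scheme wclean zclean wz; subst w; clear wz.
case: wR => [z2|/lintelP[l1 l2 l3]].
  exfalso; have l := left2 _ z2; case: zL => [[z1|/stubP[h _ _]]|/riserP[h _ _]]; [|lra|lra].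
  have [|_] := strands_disjoint i_n b_n _ (leqnn i) (ltnW ib) z1 z2.
    by rewrite neq_ltn ib.
  exact: reversal_neq_div.
have ztop : z.1 = 8 * i%:R + 2 -> pp z = pp top by move=> z1; congr (pp _); rewrite /top -z1 -l3; case: (z).
case: zL => [[/left1 h|/stubP[_ _ h]]|/riserP[h _ _]]; [exfalso; clear ztop; lra | exfalso; clear ztop; lra | exact: ztop].
Qed.

(** Strands of different edges have different heights in every gap and every slot,
    and in slot [i] the other strands pass above the joint of edge [i] or through the
    holes, on the other side of its foot. *)
Lemma edges_disjoint i i' z : (i' < n * n)%N -> (i < rv i)%N -> (i' < rv i')%N -> (i < i')%N ->
  edge_curve i z -> edge_curve i' z -> exists2 w, (w < n)%N & z = vertex_point w.
Proof.
move=> i'_n ib ib' ii'; have i_n := ltn_trans ii' i'_n.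
have b_n := reversal_lt n_gt0 i_n; have b'_n := reversal_lt n_gt0 i'_n.
have [f0 f2] := foot_le0.
have ii'R : i%:R + 1 <= i'%:R :> R by rewrite natr1 ler_nat.
have div_lt s : (s < n * n)%N -> (s %/ n < n)%N by move=> sn; rewrite ltn_divLR.
have two s s' : (s = i \/ s = rv i) -> (s' = i' \/ s' = rv i') -> strand s i z -> strand s' i' z ->
    exists2 w, (w < n)%N & z = vertex_point w.
  move=> sE s'E zs zs'.
  have s_n : (s < n * n)%N by case: sE => ->.
  have s'_n : (s' < n * n)%N by case: s'E => ->.
  have is_ : (i <= s)%N by case: sE => -> //; exact: ltnW.
  have i's' : (i' <= s')%N by case: s'E => -> //; exact: ltnW.
  have ss' : s != s'.
    apply/eqP => e; subst s'; case: sE => e1; case: s'E => e2; rewrite e1 in e2.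
    - by rewrite e2 ltnn in ii'.
    - by move: ib' (ltn_trans ii' ib'); rewrite -e2 ltnn.
    - by move: ib'; rewrite -e2 reversalK // ltnNge (ltnW ib).
    - by move: ii'; rewrite -(reversalK i_n) e2 reversalK // ltnn.
  have [-> _] := strands_disjoint s_n s'_n ss' is_ i's' zs zs'.
  by exists (s %/ n)%N => //; exact: div_lt.
pose joint k := stub k z \/ riser k z \/ lintel k z.
have jointE k : joint k -> [/\ 8 * k%:R - 1 < z.1, z.1 <= 8 * k%:R + 2, foot <= z.2 & z.2 <= 2].
  have [s1 s2] := foot_startE k.
  by case=> [/stubP[h1 h2 ->]|[/riserP[-> h1 h2]|/lintelP[h1 h2 ->]]]; split; lra.
have edgeE k : edge_curve k z -> (exists2 s, s = k \/ s = rv k & strand s k z) \/ joint k.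
  case=> [[[h|h]|h]|[h|h]]; [left; exists k => //; by left | right; by left | right; right; by left | |].
    by left; exists (rv k) => //; right.
  by right; right; right.
move=> /edgeE zi /edgeE[[s' s'E zs']|/jointE[h1 h2 h3 h4]]; last first.
  exfalso; case: zi => [[s _ /strand_left h]|/jointE[h5 h6 h7 h8]]; lra.
case: zi => [[s sE zs]|/jointE[h1 h2 h3 h4]]; first exact: two zs zs'.
exfalso; have i0 := ler0n R i; move: zs' => /strandP[zE|[j ji' zj]].
  by move: h1; rewrite {}zE /=; lra.
have [c1 c2] := piece_column (z := z) (j := j) (s := s') ltac:(case: zj => [|[]]; [left|right]; done).
have ji : j = i by apply: column_uniq c1 c2 _ _; lra.
subst j; case: zj => [[_ h _]|[[_ _ h] _]]; first by lra.
have is' : (i < s')%N by case: s'E => -> //; exact: ltn_trans ib'.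
have s'b : s' != rv i.
  case: s'E => ->; apply/eqP => e; first by move: ib'; rewrite e reversalK // ltnNge (ltnW ib).
  by move: ii'; rewrite -(reversalK i_n) -e reversalK // ltnn.
move: h; have [bs|sb] := leqP (rv i) s'.
  have := level_lt R flip n_gt0 i_n (ltnW ib) (_ : (rv i < s')%N).
  rewrite ltn_neqAle eq_sym s'b bs level_reversal => /(_ isT) h e; clear s'E s'b; lra.
have /andP[l0 l1] := level_band R flip n_gt0 i_n is' sb.
move=> [fl _ _ e]; move: h3; rewrite /foot fl e; clear s'E; lra.
Qed.

Lemma edge_ends i w : (i < n * n)%N -> (i < rv i)%N -> edge_curve i (vertex_point w) ->
  w = (i %/ n)%N \/ w = (rv i %/ n)%N.
Proof.
move=> i_n ib; have := ler0n R i => i0; have [s1 s2] := foot_startE i.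
have vinj u v : vertex_point u = vertex_point v -> u = v.
  by rewrite /vertex_point => -[] /eqP; rewrite eqr_nat eqn_pmul2l // => /eqP.
have st s : strand s i (vertex_point w) -> w = (s %/ n)%N.
  move=> /strandP[/vinj //|[j ji zj]]; exfalso; have j0 := ler0n R j.
  by case: zj => [[h _ _]|[[h _ _] _]]; move: h; rewrite /=; lra.
case=> [[[/st ->|/stubP[h _ _]]|/riserP[h _ _]]|[/st ->|/lintelP[h _ _]]]; [by left| | |by right|];
  by exfalso; move: h; rewrite /=; lra.
Qed.

(** Vertex [w] is placed at height [n * w], left of all the slots, and the [n]
    strands of [w] leave it in increasing order. *)
Theorem complete_embeddable : embeddable R (glued_space r) (fun x y : 'I_n => x != y).
Proof.
have code (x y : 'I_n) : (x < y)%N -> [/\ (x * n + y < n * n)%N, rv (x * n + y) = (y * n + x)%N,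
    (x * n + y < y * n + x)%N, ((x * n + y) %/ n = x)%N & ((y * n + x) %/ n = y)%N].
  move=> xy; have xn := ltn_ord x; have yn := ltn_ord y; split.
  - by move: xn yn; clear; nia.
  - exact: reversalE.
  - by move: xy xn yn; clear; nia.
  - by rewrite divnMDl // divn_small // addn0.
  - by rewrite divnMDl // divn_small // addn0.
have vinj (x y : 'I_n) : pp (vertex_point x) = pp (vertex_point y) -> x = y.
  move=> /(clean_inj scheme (vertex_clean x) (vertex_clean y)) [/eqP].
  by rewrite eqr_nat eqn_pmul2l // => /eqP /ord_inj.
apply: (@embeddable_of_arcs R _ n (fun w => pp (vertex_point w))
  (fun x y => pp @` edge_curve (x * n + y))) => //.
- move=> x y /code[h1 h2 h3 h4 h5].
  by have := edge_arc h1; rewrite h2 h4 h5; apply.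
- move=> x y z /code[h1 h2 h3 h4 h5] [w we].
  have ib : (x * n + y < rv (x * n + y))%N by rewrite h2.
  move=> /(clean_inj scheme (edge_clean ib we) (vertex_clean z)) wz; rewrite wz in we.
  have := edge_ends h1 ib we; rewrite h2 h4 h5.
  by case=> /ord_inj; [left|right].
- move=> x y z w q /code[h1 h2 h3 h4 h5] /code[g1 g2 g3 g4 g5] ne [p pe <-] [p' pe'].
  have ib : (x * n + y < rv (x * n + y))%N by rewrite h2.
  have ib' : (z * n + w < rv (z * n + w))%N by rewrite g2.
  move=> /(clean_inj scheme (edge_clean ib' pe') (edge_clean ib pe)) pp'; rewrite pp' in pe'; clear p' pp'.
  have codes : (x * n + y)%N != (z * n + w)%N.
    apply/eqP => e; apply: ne; congr (_, _); apply: ord_inj; first by rewrite -h4 -g4 e.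
    have := congr1 (modn^~ n) e; rewrite !modnMDl !modn_small //.
  move: codes; rewrite neq_ltn => /orP[] lt.
    by have [v vn ->] := edges_disjoint g1 ib ib' lt pe pe'; exists (Ordinal vn).
  by have [v vn ->] := edges_disjoint h1 ib' ib lt pe' pe; exists (Ordinal vn).
Qed.

End Strands.

(** * Tournaments without large acyclic sets *)

Section Tournaments.
Import mathcomp.boot.fintype mathcomp.boot.finset.
Local Open Scope nat_scope.

(** A tournament without directed triangles is transitive, so that sorting
    applies. *)
Lemma transitive_ordering (V : finType) (D : rel V) (A : {set V}) :
  oriented D -> (forall x y, x != y -> underlying D x y) -> acyclic_on D A ->
  exists p : seq V, [/\ uniq p, size p = #|A| & pairwise D p].
Proof.
move=> orD tot acA; pose leT x y := (x == y) || D x y.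
exists (sort leT (enum A)); rewrite sort_uniq enum_uniq size_sort -cardE; split=> //.
have Aall : all (mem A) (enum A) by apply/allP => x; rewrite mem_enum.
have leT_tot : {in mem A &, total leT}.
  move=> x y _ _; rewrite /leT; have [->|/tot/orP[->|->]] := eqVneq x y; by rewrite ?eqxx ?orbT.
have leT_tr : {in mem A & &, transitive leT}.
  move=> y x z yA xA zA /orP[/eqP -> //|xy] /orP[/eqP <-|yz]; first by rewrite /leT xy orbT.
  rewrite /leT; have [//|xz] := eqVneq x z; case/orP: (tot _ _ xz) => // zx.
  have ne u w : D u w -> u != w by move=> uw; apply: contraTneq uw => ->; have := orD w w; rewrite andbb.
  exfalso; apply: (acA [:: x; y; z]) => //.
    by move=> u; rewrite !inE => /or3P[] /eqP ->.
  by rewrite /ucycle /= xy yz zx /= !inE negb_or (ne _ _ xy) xz (ne _ _ yz).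
have : pairwise leT (sort leT (enum A)).
  rewrite -(sorted_pairwise_in leT_tr) ?all_sort //.
  exact: (sort_sorted_in leT_tot Aall).
have : uniq (sort leT (enum A)) by rewrite sort_uniq enum_uniq.
elim: (sort _ _) => //= x s IH /andP[xs us] /andP[h1 h2]; rewrite IH // andbT.
apply/allP => y ys; have := allP h1 y ys; rewrite /leT => /orP[/eqP e|//].
by rewrite e ys in xs.
Qed.

Variable n : nat.

(** Tournaments are encoded by arbitrary boolean functions on pairs, of which the
    increasing pairs matter; this makes counting them a product. *)
Definition tournament_of (f : {ffun 'I_n * 'I_n -> bool}) : rel 'I_n := fun x y =>
  ((x < y) && f (x, y)) || ((y < x) && ~~ f (y, x)).

Lemma tournament_oriented f : oriented (tournament_of f).
Proof.
by move=> x y; rewrite /tournament_of; case: (ltngtP x y) => //= _; rewrite ?orbF; case: (f _).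
Qed.

Lemma tournament_underlying f x y : underlying (tournament_of f) x y = (x != y).
Proof.
rewrite /underlying /tournament_of -val_eqE; case: (ltngtP x y) => //= _; rewrite ?orbF; by case: (f _).
Qed.

Definition increasing_pairs (p : seq 'I_n) : {set 'I_n * 'I_n} :=
  [set q : 'I_n * 'I_n | [&& q.1 < q.2, q.1 \in p & q.2 \in p]].

Lemma card_increasing_pairs p : uniq p -> size p * (size p).-1 <= 2 * #|increasing_pairs p|.
Proof.
move=> up; pose A := [set x in p].
have cA : #|A| = size p by rewrite cardsE; exact/card_uniqP.
have sub : setX A A \subset increasing_pairs p :|:
    (((fun q : 'I_n * 'I_n => (q.2, q.1)) @: increasing_pairs p) :|: ((fun x => (x, x)) @: A)).
  apply/subsetP => -[x y]; rewrite !inE /= => /andP[xp yp].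
  case: (ltngtP x y) => h; first by rewrite xp yp.
    by rewrite /=; apply/orP; left; apply/imsetP; exists (y, x); rewrite ?inE //= h xp yp.
  by rewrite /=; apply/orP; right; move/ord_inj: h => <-; rewrite imset_f // inE.
have := subset_leq_card sub; rewrite cardsX cA => le.
have := leq_trans le (leq_trans (leq_card_setU _ _) (leq_add (leqnn _) (leq_card_setU _ _))).
have h1 := leq_imset_card (fun q : 'I_n * 'I_n => (q.2, q.1)) (increasing_pairs p).
have h2 := leq_imset_card (fun x : 'I_n => (x, x)) A; rewrite cA in h2.
move: h1 h2; move: (#|_ @: _|) (#|_ @: _|) (#|increasing_pairs p|) (size p) => a b c k; clear.
by case: k => [|k] /=; nia.
Qed.

(** Listing a transitive set in order prescribes the direction of every pair. *)
Lemma card_ordered_tournaments (p : seq 'I_n) : uniq p ->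
  #|[set f | pairwise (tournament_of f) p]| * 2 ^ #|increasing_pairs p| <= 2 ^ (n * n).
Proof.
move=> up; set P := increasing_pairs p.
pose F (q : 'I_n * 'I_n) : pred bool := if q \in P then pred1 (index q.1 p < index q.2 p) else predT.
have sub : [set f | pairwise (tournament_of f) p] \subset family F.
  apply/subsetP => f; rewrite inE => pf; apply/familyP => q; rewrite /F.
  case: ifP => // qP; move: (qP); rewrite inE => /and3P[lt q1 q2]; rewrite inE; apply/eqP.
  have [i1 i2] : index q.1 p < size p /\ index q.2 p < size p by rewrite !index_mem.
  have x0 := q.1; have /(pairwiseP x0) pw := pf.
  case: (ltngtP (index q.1 p) (index q.2 p)) => h.
  - have := pw _ _ i1 i2 h; rewrite !nth_index // /tournament_of lt /=.
    by rewrite ltnNge (ltnW lt) /= orbF -surjective_pairing.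
  - have := pw _ _ i2 i1 h; rewrite !nth_index // /tournament_of lt /=.
    by rewrite ltnNge (ltnW lt) /= -surjective_pairing => /negbTE.
  - by have := congr1 (nth x0 p) h; rewrite !nth_index // => e; rewrite e ltnn in lt.
apply: leq_trans (leq_mul (subset_leq_card sub) (leqnn _)) _.
rewrite card_family foldrE big_map big_enum /=.
rewrite (bigID (mem P)) /= (eq_bigr (fun=> 1)); last by move=> q qP; rewrite /F qP card1.
rewrite big1 // mul1n (eq_bigr (fun=> 2)); last by move=> q qP; rewrite /F (negbTE qP) card_bool.
rewrite prod_nat_const -expnD; apply: eq_leq; congr (_ ^ _).
have := cardC P; rewrite card_prod card_ord => <-; rewrite addnC; congr (_ + _).
Qed.

(** If every tournament had a transitive set of [a] vertices, then [n ^ a] lists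
    would have to account for all of them. *)
Lemma tournament_without_large_acyclic (a : nat) : n ^ 2 < 2 ^ a.-1 -> 0 < a ->
  exists D : rel 'I_n, [/\ oriented D, forall x y, underlying D x y = (x != y) &
    forall A, acyclic_on D A -> #|A| < a].
Proof.
move=> na a0.
pose bad (p : a.-tuple 'I_n) : {set {ffun 'I_n * 'I_n -> bool}} := [set f | uniq p && pairwise (tournament_of f) p].
have small (p : a.-tuple 'I_n) : #|bad p| ^ 2 * n ^ (2 * a) <= 2 ^ (2 * (n * n)) /\
   (0 < n -> #|bad p| ^ 2 * n ^ (2 * a) < 2 ^ (2 * (n * n))).
  have [up|nup] := boolP (uniq p); last first.
    have -> : bad p = set0 by apply/setP => f; rewrite !inE (negbTE nup).
    by rewrite cards0 mul0n expn_gt0.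
  have h1 := card_ordered_tournaments up; have h2 := card_increasing_pairs up.
  have bE : bad p = [set f | pairwise (tournament_of f) p] by apply/setP => f; rewrite !inE up.
  rewrite bE; move: h1 h2; rewrite size_tuple; move: (#|[set f | _]|) (#|increasing_pairs p|) => b c h1 h2.
  have h3 : n ^ (2 * a) <= 2 ^ (2 * c).
    rewrite expnM; apply: leq_trans (leq_pexp2l _ h2) => //; rewrite mulnC expnM.
    by rewrite leq_exp2r // ltnW.
  have h3' : n ^ (2 * a) < 2 ^ (2 * c).
    rewrite expnM; apply: leq_trans (leq_pexp2l _ h2) => //; rewrite mulnC expnM.
    by rewrite ltn_exp2r.
  have h4 : b ^ 2 * 2 ^ (2 * c) <= 2 ^ (2 * (n * n)).
    by rewrite [2 * c]mulnC [2 * (n * n)]mulnC !(expnM 2 _ 2) -expnMn leq_exp2r.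
  have [b0|b0] := posnP b; first by rewrite b0 mul0n expn_gt0.
  split; first by apply: leq_trans h4; rewrite leq_mul2l h3 orbT.
  by move=> _; apply: leq_trans h4; rewrite ltn_mul2l expn_gt0 b0.
suff [f hf] : exists f, f \notin \bigcup_(p : a.-tuple 'I_n) bad p.
  exists (tournament_of f); split; [exact: tournament_oriented | exact: tournament_underlying |].
  move=> A acA; rewrite ltnNge; apply: contra hf => aA.
  have tot x y : x != y -> underlying (tournament_of f) x y by rewrite tournament_underlying.
  have [p [up sp pw]] := transitive_ordering (tournament_oriented f) tot acA.
  have st : size (take a p) == a by rewrite size_take sp; case: ltngtP aA => // ->.
  apply/bigcupP; exists (Tuple st) => //; rewrite inE /= take_uniq //=.
  exact: subseq_pairwise (take_subseq _ _) pw.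
apply/existsP; apply: contraT; rewrite negb_exists => /forallP all_bad.
have full : #|{ffun 'I_n * 'I_n -> bool}| <= \sum_(p : a.-tuple 'I_n) #|bad p|.
  apply: leq_trans (_ : #|\bigcup_(p : a.-tuple 'I_n) bad p| <= _).
    by rewrite -cardsT; apply/subset_leq_card/subsetP => f _; rewrite -[_ \in _]negbK all_bad.
  elim/big_ind2: _ => [|A x B y hA hB|//]; first by rewrite cards0.
  exact: leq_trans (leq_card_setU _ _) (leq_add hA hB).
rewrite card_ffun card_bool card_prod card_ord in full.
have [n0|n0] := posnP n.
  have : \sum_(p : a.-tuple 'I_n) #|bad p| = 0.
    rewrite big1 // => p _; exfalso.
    by have := leq_ltn_trans (leq0n _) (ltn_ord (tnth p (Ordinal a0))); rewrite n0.
  by move=> e; rewrite e n0 in full.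
have : (\sum_(p : a.-tuple 'I_n) #|bad p|) <= #|{: a.-tuple 'I_n}| * \max_(p : a.-tuple 'I_n) #|bad p|.
  by rewrite -sum_nat_const; apply: leq_sum => p _; exact: (leq_bigmax_cond (F := fun p => #|bad p|)).
have [p ->] : exists p, \max_(p : a.-tuple 'I_n) #|bad p| = #|bad p|.
  have [|p _ ->] := @eq_bigmax_cond _ predT (fun p : a.-tuple 'I_n => #|bad p|).
    by rewrite card_tuple card_ord expn_gt0 n0.
  by exists p.
rewrite card_tuple card_ord => le; have [_ /(_ n0) lt] := small p.
have : (2 ^ (n * n)) ^ 2 <= (n ^ a * #|bad p|) ^ 2 by rewrite leq_exp2r //; exact: leq_trans full le.
rewrite expnMn -!expnM [a * 2]mulnC [n * n * 2]mulnC [n ^ _ * _]mulnC => le2.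
by have := leq_ltn_trans le2 lt; rewrite ltnn.
Qed.

Lemma dicolourable_card (D : rel 'I_n) (a k : nat) :
  (forall A, acyclic_on D A -> #|A| <= a) -> dicolourable D k -> n <= k * a.
Proof.
move=> small [f hf].
rewrite -[n in n <= _]card_ord -sum1_card (partition_big f predT) //=.
rewrite -[k in k * _]card_ord -sum_nat_const; apply: leq_sum => i _; rewrite sum1_card.
by apply: leq_trans (small _ (hf i)); rewrite cardsE.
Qed.
End Tournaments.

(** * Surfaces of given Euler characteristic *)

Section Surfaces.
Local Open Scope classical_set_scope.
Local Open Scope ring_scope.
Variable R : realType.

Lemma plane_point_mirror (m : nat) (tau : nat -> nat) (flip : bool)
    (r : @holed_sphere R m -> @holed_sphere R m -> Prop) (a : nat) (z w : R * R) :
  gluing_scheme tau flip r -> (a < m)%N -> `|z - hole_center R a| = 1 ->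
  w = mirror tau flip a z -> plane_point r z = plane_point r w.
Proof.
move=> scheme am za wE; have [tauK tau_m _ _] := scheme.
have g : glued m tau flip z w by exists a.
by have [hz hw] := glued_holed tauK tau_m g; apply/(plane_point_eq scheme hz hw); right.
Qed.

Let side_norm (c y : R) : `|y| < 1 -> `|((c - 1, y) : R * R) - (c, 0)| = 1.
Proof.
move=> y1; rewrite norm_pair /= subr0 addrAC subrr add0r normrN1.
by apply/max_idPl; exact: ltW.
Qed.

Let even_center (j : nat) : 4 * j.*2%:R = 8 * j%:R :> R.
Proof. by rewrite -muln2 natrM; ring. Qed.

Let odd_center (j : nat) : 4 * j.*2.+1%:R = 8 * j%:R + 4 :> R.
Proof. by rewrite -[j.*2.+1]addn1 natrD mulrDr even_center mulr1. Qed.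

Lemma handle_jump (k j : nat) (t : R) : (j < k)%N -> `|t| < 1 ->
  plane_point (@handle_gluing R k) (8 * j%:R - 1, t) = plane_point (@handle_gluing R k) (8 * j%:R + 5, t).
Proof.
move=> jk t1.
apply: (plane_point_mirror (handle_scheme R k) (a := j.*2)); first by rewrite ltn_double.
  by rewrite /hole_center even_center side_norm.
rewrite /mirror /partner odd_double even_center odd_center; congr (_, _) => /=; ring.
Qed.

Lemma crosscap_jump (k j : nat) (t : R) : (j.*2.+1 < k)%N -> `|t| < 1 ->
  plane_point (@crosscap_gluing R k) (8 * j%:R - 1, t) = plane_point (@crosscap_gluing R k) (8 * j%:R + 1, - t) /\
  plane_point (@crosscap_gluing R k) (8 * j%:R + 3, - t) = plane_point (@crosscap_gluing R k) (8 * j%:R + 5, t).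
Proof.
move=> jk t1; split.
  apply: (plane_point_mirror (crosscap_scheme R k) (a := j.*2)); first exact: ltn_trans jk.
    by rewrite /hole_center even_center side_norm.
  by rewrite /mirror even_center; congr (_, _) => /=; ring.
apply: (plane_point_mirror (crosscap_scheme R k) (a := j.*2.+1)) => //.
  rewrite /hole_center odd_center (_ : 8 * j%:R + 3 = 8 * j%:R + 4 - 1); last by ring.
  by rewrite side_norm // normrN.
by rewrite /mirror odd_center; congr (_, _) => /=; ring.
Qed.

Lemma embeddable_homeomorphic (S T : topologicalType) (V : finType) (e : rel V) :
  homeomorphic S T -> embeddable R T e -> embeddable R S e.
Proof.
move=> [f [g [cf cg fK gK]]] [pt [arc draw]].
exists (g \o pt), (fun x y => g \o arc x y); exact: drawing_map cg (can_inj gK) draw.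
Qed.

(** The two facts about a surface of Euler characteristic [- g] on which both
    bounds rest: its graphs are sparse, and it carries a large complete graph. *)
Lemma surface_graphs (S : topologicalType) (c : int) :
  surface_of_euler_char R S c -> c <= - 2%:Z -> exists g : nat,
  [/\ (2 <= g)%N, c = - g%:Z,
    forall (V : finType) (e : rel V), symmetric e -> irreflexive e -> embeddable R S e ->
      forall W : {set V}, (\sum_(x in W) #|[set y in W | e x y]%SET| <= 30 * (#|W| + g))%N &
    forall n, (0 < n)%N -> (2 * (n * n) <= g + 2)%N -> embeddable R S (fun x y : 'I_n => x != y)].
Proof.
case=> [[k [hom ->]]|[k [k0 hom ->]]] c2.
  have k2 : (2 <= k)%N by move: c2; lia.
  exists (2 * k - 2)%N; split; [lia | lia | |].
    move=> V e es ei emb W; have sch := handle_scheme R k.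
    have tau_flip a : false || (partner a != a).
      by rewrite /partner; case: ifP => oa; [case: a oa => //= a _; rewrite neq_ltn ltnSn | rewrite neq_ltn ltnSn orbT].
    have := @embeddable_sparse R S k.*2 partner false _ V e tau_flip _ sch hom es ei emb W.
    move: (\sum_(_ in _) _)%N => s h; have : (s <= 8 * #|W| + 12 * (k.*2 + 1))%N by apply: h; rewrite double_gt0; lia.
    by move: k2; clear; lia.
  move=> n n0 nk; apply: embeddable_homeomorphic hom _.
  apply: (complete_embeddable (handle_scheme R k) n0) => j t jn t1.
  by apply: handle_jump => //; move: jn nk k2; clear; lia.
have k4 : (4 <= k)%N by move: c2; lia.
exists (k - 2)%N; split; [lia | lia | |].
  move=> V e es ei emb W; have sch := crosscap_scheme R k.
  have := @embeddable_sparse R S k id true _ V e (fun=> isT) k0 sch hom es ei emb W.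
  by move: (\sum_(_ in _) _)%N => s; move: k4; clear; lia.
move=> n n0 nk; apply: embeddable_homeomorphic hom _.
apply: (complete_embeddable (crosscap_scheme R k) n0) => j t jn t1.
by apply: crosscap_jump => //; move: jn nk k4; clear; lia.
Qed.

Lemma nat_sqrt (h : nat) : exists n, (n * n <= h < n.+1 * n.+1)%N.
Proof.
elim: h => [|h [n /andP[h1 h2]]]; first by exists 0%N.
have [lt|le] := ltnP h.+1 (n.+1 * n.+1); first by exists n; rewrite leqW.
by exists n.+1; rewrite le /=; move: h1 h2 le; clear; nia.
Qed.

(** A complete graph on about [sqrt (g / 2)] vertices, oriented so that acyclic
    sets have size [O(ln g)]. *)
Lemma surface_lower_bound (S : topologicalType) (g k : nat) : (2 <= g)%N ->
  (forall n, (0 < n)%N -> (2 * (n * n) <= g + 2)%N -> embeddable R S (fun x y : 'I_n => x != y)) ->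
  surface_dicolourable R S k -> 12^-1 * (Num.sqrt g%:R / ln g%:R) <= k%:R :> R.
Proof.
move=> g2 emb col; have [n /andP[n1 n2]] := nat_sqrt g.+2./2.
have n0 : (0 < n)%N by rewrite lt0n; apply/eqP => n0; move: n2; rewrite n0; lia.
have ng : (2 * (n * n) <= g + 2)%N by move: n1; lia.
have gn : (g <= 9 * (n * n))%N by move: n2 n0; nia.
have nng : (n * n <= g)%N by move: ng g2; clear; lia.
(* the least [A] allowed by the counting of tournaments *)
pose A := (trunc_log 2 (n ^ 2)).+1.
have nA : (n ^ 2 < 2 ^ A)%N by apply: trunc_log_ltn.
have [D [orD undD acD]] := @tournament_without_large_acyclic n A.+1 nA isT.
have undE : underlying D = (fun x y : 'I_n => x != y) by apply/funext => x; apply/funext => y.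
have nkA : (n <= k * A)%N.
  by apply: (dicolourable_card acD); apply: col => //; rewrite undE; exact: emb.
have g0 : (0 < g)%N by exact: ltn_trans g2.
have lng : ln 2 <= ln g%:R :> R by rewrite ler_ln ?posrE ?ltr0n // ler_nat.
have ln2 : 2^-1 <= ln 2 :> R.
  have := @ln_le_subr1 R 2^-1; rewrite lnV ?posrE ?ltr0n // invr_gt0 ltr0n => /(_ isT).
  have : (2 : R)^-1 * 2 = 1 by rewrite mulVf // pnatr_eq0.
  by lra.
have Ag : (A.-1)%:R * ln 2 <= ln g%:R :> R.
  rewrite mulrC mulr_natr -lnXn ?ltr0n // ler_ln ?posrE ?exprn_gt0 ?ltr0n // -natrX ler_nat.
  apply: leq_trans (trunc_logP _ _) _ => //; first by rewrite expn_gt0 n0.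
have quarter (B l2 lg hf : R) : 0 <= B -> B * l2 <= lg -> hf <= l2 -> l2 <= lg -> hf * 2 = 1 -> B + 1 <= 4 * lg.
  move=> B0 Bl hl ll h2; have h1 : B * hf <= B * l2 by rewrite ler_wpM2l.
  have h3 : B = B * hf * 2 by rewrite -mulrA h2 mulr1.
  by lra.
have A4 : A%:R <= 4 * ln g%:R :> R.
  by rewrite /A -natr1; apply: quarter Ag ln2 lng _ => //; rewrite mulVf // pnatr_eq0.
have lg0 : 0 < ln g%:R :> R by apply: lt_le_trans lng; apply: lt_le_trans ln2; rewrite invr_gt0 ltr0n.
have sq : Num.sqrt g%:R <= 3 * n%:R :> R.
  have -> : 3 * n%:R = Num.sqrt ((3 * n%:R) ^+ 2) :> R by rewrite sqrtr_sqr ger0_norm // mulr_ge0.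
  rewrite ler_sqrt ?exprn_ge0 ?mulr_ge0 // exprMn -natrX -natrX -natrM ler_nat.
  by apply: leq_trans gn _; rewrite -mulnn.
rewrite mulrA ler_pdivrMr //.
have nk : n%:R <= k%:R * A%:R :> R by rewrite -natrM ler_nat.
have kA : k%:R * A%:R <= k%:R * (4 * ln g%:R) :> R by rewrite ler_wpM2l.
have t12 : (12 : R)^-1 * 12 = 1 by rewrite mulVf // pnatr_eq0.
have : 12^-1 * Num.sqrt g%:R <= 12^-1 * (12 * (k%:R * ln g%:R)) :> R.
  by rewrite ler_wpM2l ?invr_ge0 //; move: (sq) (nk) (kA); lra.
by rewrite [_ * (12 * _)]mulrA t12 mul1r.
Qed.
End Surfaces.

Local Open Scope ring_scope.
Theorem theorem3p1 (R : realType) :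
  exists a1 a2 : R,
    [/\ 0 < a1, 0 < a2
      & forall (S : topologicalType) (c : int),
          surface_of_euler_char R S c -> c <= - 2%:Z ->
          exists k : nat,
            surface_dichromatic_number R S k /\
            a1 * (Num.sqrt (- c%:~R) / ln (- c%:~R)) <= k%:R
              <= a2 * (Num.sqrt (- c%:~R) / ln (- c%:~R))].
Proof.
have [a a0 upper] := @dichromatic_sparse_bound R 30 isT.
exists 12^-1, a; split=> // S c surf c2.
have [g [g2 -> sparse complete]] := surface_graphs surf c2.
rewrite (_ : - (- g%:Z)%:~R = g%:R :> R); last by rewrite mulrNz opprK -pmulrn.
have [k0 k0_le k0_col] := upper g g2.
have col0 : surface_dicolourable R S k0.
  move=> V D orD emb; apply: k0_col => // W; apply: sparse emb W => [x y|x].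
    by rewrite /underlying orbC.
  by have := orD x x; rewrite /underlying andbb orbb => /negbTE.
have ex : exists k, `[< surface_dicolourable R S k >] by exists k0; apply/asboolP.
have [k /asboolP kcol kmin] := ex_minnP ex.
exists k; split; first by split=> // j jcol; apply: kmin; apply/asboolP.
apply/andP; split; first exact: surface_lower_bound g2 complete kcol.
by apply: le_trans k0_le; rewrite ler_nat; apply: kmin; apply/asboolP.
Qed.
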